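(* Let $0<p<1$ be a constant. With high probability, the random graph $G_{n,p}$ is elementary in remainder class $\{0,1,\dots,\gamma\}$ and is ideal in remainder class $\{\beta,\beta+1,\dots,n-1\}$ for some integers $\gamma,\beta$ (which may depend on the sampled graph) with $\gamma=\Theta(\sqrt{n\log n})$ and $\beta=\gamma+1$ or $\beta=\gamma+2$. (Here $\gamma=\Theta(\sqrt{n\log n})$ means $c\sqrt{n\log n}\le\gamma\le C\sqrt{n\log n}$ for some constants $0<c<C$ depending only on $p$.)
   Context: All graphs are finite and simple; logarithms are natural. $G_{n,p}$ is the Erdős–Rényi random graph on $n$ vertices in which each potential edge appears independently with probability $p$. An event holds with high probability if its probability tends to $1$ as $n\to\infty$. A graph $G$ is $H$-covered if every vertex of $G$ lies in a (not necessarily induced) subgraph of $G$ isomorphic to $H$. An $N$-vertex $H$-covered graph is edge-minimal if it has the minimum number of edges among all $N$-vertex $H$-covered graphs. Let $H$ be a graph with $n$ vertices and $0\le r<n$. Define $\mathcal{L}_{n+r}^H$ to be the collection of graphs $G$ on a vertex set $V\sqcup V_1\sqcup V_2$ (disjoint union) with $|V|=n-r$, $|V_1|=|V_2|=r$, such that: there are no edges between $V_1$ and $V_2$; the subgraph induced on $V$ is isomorphic to an $(n-r)$-vertex subgraph of $H$ having the maximum possible number of edges; and the subgraphs induced on $V_1\sqcup V$ and on $V_2\sqcup V$ are both isomorphic to $H$. $H$ is ideal in remainder class $r$ if for all $N=qn+r$ with $q$ a positive integer, an $N$-vertex graph $G$ is edge-minimal among $N$-vertex $H$-covered graphs if and only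 if $G$ is (isomorphic to) the disjoint union of a graph in $\mathcal{L}_{n+r}^H$ and $q-1$ copies of $H$. For $n\le M<2n$, define $\mathcal{M}_M^H$ to be the collection of graphs $G$ on vertex set $[M]=\{1,\dots,M\}$ such that for all $n\le i\le M$ the vertex subset $[n-1]\cup\{i\}$ induces a copy of $H$, and the number of edges of $G$ is the minimum possible subject to this. $H$ is elementary in remainder class $r$ if for all $N=qn+r$ with $q$ a positive integer, an $N$-vertex graph $G$ is edge-minimal among $N$-vertex $H$-covered graphs if and only if $G$ is (isomorphic to) the disjoint union of $q$ graphs, the $i$-th one from $\mathcal{M}_{b_i}^H$ for some $n\le b_i<2n$, such that $\sum_{i=1}^q b_i=N$. For $S\subseteq\{0,1,\dots,n-1\}$, $H$ is ideal (respectively elementary) in remainder class $S$ if it is ideal (respectively elementary) in remainder class $r$ for all $r\in S$. *)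

(* Defs.v *)
From HB Require Import structures.
From mathcomp Require Import all_boot all_order all_algebra.
From mathcomp Require Import all_classical all_reals all_analysis.

Set Implicit Arguments.
Unset Strict Implicit.
Unset Printing Implicit Defensive.

Import Order.TTheory GRing.Theory Num.Theory.
Import numFieldNormedType.Exports.

Local Open Scope ring_scope.

(* A finite simple graph with vertex type T, given by its set of edges, an edge
   being a two-element set of vertices. *)
Record sgraph (T : finType) := SGraph {
  edges : {set {set T}};
  edges_card2 : [forall e in edges, #|e| == 2%N] }.

HB.instance Definition _ (T : finType) := [isSub for @edges T].
HB.instance Definition _ (T : finType) := [Finite of sgraph T by <:].

Definition adj (T : finType) (G : sgraph T) : rel T :=
  fun x y => [set x; y] \in edges G.

Definition nb_edges (T : finType) (G : sgraph T) : nat := #|edges G|.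

Definition isomorphic (T U : finType) (G : sgraph T) (K : sgraph U) : Prop :=
  exists2 f : T -> U, bijective f & forall x y, adj K (f x) (f y) = adj G x y.

(* f identifies K with a (not necessarily induced) subgraph of G. *)
Definition copy_in (T U : finType) (K : sgraph U) (G : sgraph T) (f : U -> T) :
  Prop := injective f /\ forall x y, adj K x y -> adj G (f x) (f y).

Definition is_subgraph (T U : finType) (K : sgraph U) (G : sgraph T) : Prop :=
  exists f : U -> T, copy_in K G f.

Definition induced_edges (T : finType) (G : sgraph T) (A : {set T}) :
    {set {set {x : T | x \in A}}} :=
  [set e : {set {x : T | x \in A}} | [set val x | x in e] \in edges G].

Lemma induced_card2 (T : finType) (G : sgraph T) (A : {set T}) :
  [forall e in induced_edges G A, #|e| == 2%N].
Proof.
apply/forall_inP => e; rewrite inE => eG.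
have /forall_inP/(_ _ eG) := edges_card2 G.
by rewrite card_imset //; exact: val_inj.
Qed.

Definition induced (T : finType) (G : sgraph T) (A : {set T}) :
  sgraph {x : T | x \in A} := SGraph (induced_card2 G A).

Definition dunion2_edges (T U : finType) (G : sgraph T) (K : sgraph U) :
    {set {set (T + U)%type}} :=
  [set [set (inl x : (T + U)%type) | x in e] | e : {set T} in edges G] :|:
  [set [set (inr x : (T + U)%type) | x in e] | e : {set U} in edges K].

Lemma dunion2_card2 (T U : finType) (G : sgraph T) (K : sgraph U) :
  [forall e in dunion2_edges G K, #|e| == 2%N].
Proof.
apply/forall_inP => e; rewrite inE => /orP[] /imsetP[e' e'G ->].
  by rewrite card_imset; [exact: (forall_inP (edges_card2 G))|move=> ? ? []].
by rewrite card_imset; [exact: (forall_inP (edges_card2 K))|move=> ? ? []].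
Qed.

Definition dunion2 (T U : finType) (G : sgraph T) (K : sgraph U) :
  sgraph (T + U)%type := SGraph (dunion2_card2 G K).

Definition dunion_edges (I : finType) (T : I -> finType)
    (G : forall i, sgraph (T i)) : {set {set {i : I & T i}}} :=
  \bigcup_(i : I)
    [set [set Tagged T x | x in e] | e : {set T i} in edges (G i)].

Lemma dunion_card2 (I : finType) (T : I -> finType)
    (G : forall i, sgraph (T i)) :
  [forall e in dunion_edges G, #|e| == 2%N].
Proof.
apply/forall_inP => e /bigcupP[i _ /imsetP[e' e'G ->]].
rewrite card_imset; first exact: (forall_inP (edges_card2 (G i))).
by move=> x y /eqP; rewrite -tag_eqE /tag_eq eqxx tagged_asE => /eqP.
Qed.

Definition dunion (I : finType) (T : I -> finType)
    (G : forall i, sgraph (T i)) : sgraph {i : I & T i} :=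
  SGraph (dunion_card2 G).

Definition covered (U T : finType) (H : sgraph U) (G : sgraph T) : Prop :=
  forall v : T, exists f : U -> T, copy_in H G f /\ v \in codom f.

Definition edge_minimal (U : finType) (N : nat) (H : sgraph U)
    (G : sgraph 'I_N) : Prop :=
  covered H G /\
  forall G' : sgraph 'I_N, covered H G' -> (nb_edges G <= nb_edges G')%N.

Definition max_subgraph (U : finType) (m : nat) (H : sgraph U)
    (K : sgraph 'I_m) : Prop :=
  is_subgraph K H /\
  forall K' : sgraph 'I_m, is_subgraph K' H -> (nb_edges K' <= nb_edges K)%N.

(* The vertex set of a graph in L_{n+r}^H is the disjoint sum V + V1 + V2. *)
Definition Lvert (n r : nat) : finType := ('I_(n - r) + 'I_r + 'I_r)%type.

Definition Lvert0 (n r : nat) : {set Lvert n r} :=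
  [set (inl (inl x) : Lvert n r) | x : 'I_(n - r)].
Definition Lvert1 (n r : nat) : {set Lvert n r} :=
  [set (inl (inr x) : Lvert n r) | x : 'I_r].
Definition Lvert2 (n r : nat) : {set Lvert n r} :=
  [set (inr x : Lvert n r) | x : 'I_r].

Definition Lclass (n r : nat) (H : sgraph 'I_n) (G : sgraph (Lvert n r)) :
  Prop :=
  [/\ forall x y, x \in Lvert1 n r -> y \in Lvert2 n r -> ~~ adj G x y,
      exists2 K : sgraph 'I_(n - r),
        max_subgraph H K & isomorphic (induced G (Lvert0 n r)) K,
      isomorphic (induced G (Lvert1 n r :|: Lvert0 n r)) H
    & isomorphic (induced G (Lvert2 n r :|: Lvert0 n r)) H].

Definition ideal (n : nat) (H : sgraph 'I_n) (r : nat) : Prop :=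
  forall q : nat, (0 < q)%N -> forall G : sgraph 'I_(q * n + r),
    edge_minimal H G <->
    exists2 L : sgraph (Lvert n r),
      Lclass H L & isomorphic G (dunion2 L (dunion (fun _ : 'I_q.-1 => H))).

(* With vertices numbered from 0, the set [n-1] u {i} is made of the vertices
   below n-1 together with i, where i runs over the vertices n-1, ..., M-1. *)
Definition Mcond (n M : nat) (H : sgraph 'I_n) (G : sgraph 'I_M) : Prop :=
  forall i : 'I_M, (n.-1 <= i)%N ->
    isomorphic (induced G (i |: [set j : 'I_M | (j < n.-1)%N])) H.

Definition Mclass (n M : nat) (H : sgraph 'I_n) (G : sgraph 'I_M) : Prop :=
  Mcond H G /\
  forall G' : sgraph 'I_M, Mcond H G' -> (nb_edges G <= nb_edges G')%N.

Definition elementary (n : nat) (H : sgraph 'I_n) (r : nat) : Prop :=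
  forall q : nat, (0 < q)%N -> forall G : sgraph 'I_(q * n + r),
    edge_minimal H G <->
    exists (b : 'I_q -> nat) (F : forall i : 'I_q, sgraph 'I_(b i)),
      [/\ forall i, (n <= b i < 2 * n)%N,
          forall i, Mclass H (F i),
          (\sum_(i < q) b i = q * n + r)%N
        & isomorphic G (dunion F)].

Definition ideal_in (n : nat) (H : sgraph 'I_n) (S : {set 'I_n}) : Prop :=
  forall r : 'I_n, r \in S -> ideal H r.

Definition elementary_in (n : nat) (H : sgraph 'I_n) (S : {set 'I_n}) : Prop :=
  forall r : 'I_n, r \in S -> elementary H r.

Definition Gnp_weight (R : realType) (n : nat) (p : R) (G : sgraph 'I_n) : R :=
  \prod_(e : {set 'I_n} | #|e| == 2%N) (if e \in edges G then p else 1 - p).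

Definition Gnp_prob (R : realType) (n : nat) (p : R)
    (A : set (sgraph 'I_n)) : R :=
  \sum_(G : sgraph 'I_n | G \in A) Gnp_weight p G.

Definition whp (R : realType) (p : R) (A : forall n, set (sgraph 'I_n)) :
  Prop := ((fun n => Gnp_prob p (A n)) @ \oo --> (1 : R))%classic.

(* Main.v *)
From mathcomp Require Import all_boot all_order all_algebra.
From mathcomp Require Import zify ring lra.
Require Import Defs.

(** Let f x = M n - M (n - x), where M k is twice the maximum number of edges of H
inside k vertices; f x / 2 is the least number of edges that a copy of H with x
new vertices adds to a graph, and f 1 is twice the minimum degree. Suppose that
x * f 1 < f x for 2 <= x <= gamma and f (gamma + 1) <= (gamma + 1) * f 1, that f
is strictly subadditive beyond gamma, and that f n + f (x + y - n) < f x + f y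
whenever x + y >= n. A cover of qn + r vertices contains q disjoint copies of H,
and by an exchange argument the other r vertices are covered most cheaply one
by one, as clones of a vertex of minimum degree, if r <= gamma, and by a single
copy if r > gamma, up to a possible tie at r = gamma + 1.

For the random graph put L = log n and s = sqrt (n L). The degrees are within 4 s
of p n, and the edge counts of all vertex sets are concentrated. The minimum degree
is attained at one vertex u, all other degrees exceed it by at least K = n^(3/20),
and at most K vertices have degree at most deg u + 2 c s, for a small constant c.
Among x <= c s vertices, the low ones other than u, fewer than K in number, lose
more by their degrees than they save by the edges between them, and each of the
others loses 2 c s, so x * f 1 < f x. On the other hand 36 s / p vertices have
degree at most some threshold xs and almost none of them much less, so f x is close
to 2 x xs - p x^2 for x of order s. Hence f x - x * f 1 changes sign once, at a
gamma of order s, and f is subadditive beyond. The last condition says that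
M is strictly superadditive. By concentration this can only fail because of a set
of O(L) vertices with edge density at least 2.4 p, and there it follows from a large
deviation dichotomy: degrees into such a set that are unlikely enough not to be
attained by many vertices are also too unlikely for a set of that density to
exist. *)

Set Implicit Arguments.
Unset Strict Implicit.
Unset Printing Implicit Defensive.

Import Order.TTheory GRing.Theory Num.Theory.

Local Open Scope ring_scope.

(** * Optimal splitting of the vertex count *)

(** Edge counts are doubled, as ordered pairs, so that no halves occur. The exchange argument is a
    potential argument: a copy that adds x vertices to a set already built pays f x, and the optimal
    value grows by at most that. Hence building an optimal graph from copies is tight at every step,
    in whatever order they are added, and this tightness forces the structure. The exponents come
    from the left tail of the degrees. There the ratio of consecutive binomial probabilities is at
    most 1 + O(L / s), so a single value carries only about an n^(-2/5) share of the tail. The gap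
    is sought below the quantile of level n^(-19/20), where about n^(1/20) vertices lie. Moving
    right by 2 c s multiplies the tail by at most n^(1/20), leaving about n^(1/10) vertices, fewer
    than K, while the expected number of pairs closer than K is about n^(-1/10). The threshold xs
    sits near level n^(-1/2), so that more than order s vertices lie below it, and yet far enough
    left of the mean for the tail to lose a power of n within a small multiple of s. *)

Section OptimalSplitting.
Local Open Scope nat_scope.

(* f stands for cost H below, and c for gamma. *)
Record profile (n c : nat) (f : nat -> nat) : Prop := Profile {
  profile_ge2 : 2 <= c;
  profile_half : 2 * c + 2 <= n;
  profile0 : f 0 = 0;
  profile_small : forall x, 2 <= x <= c -> x * f 1 < f x;
  profile_switch : f c.+1 <= c.+1 * f 1;
  profile_incr : forall x, c < x < n -> f x.+1 < f x + f 1;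
  profile_subadd : forall x y, c < x -> c < y -> x + y <= n ->
    f (x + y) < f x + f y;
  profile_supermod : forall x y, x < n -> y < n -> n <= x + y ->
    f n + f (x + y - n) < f x + f y }.

Definition rest_cost (c : nat) (f : nat -> nat) (x : nat) : nat :=
  if x <= c then x * f 1 else f x.

(** This turns out to be twice the least number of edges of a covered graph on [N] vertices:
    disjoint copies for the quotient, and the residue paid for by clones or by one further copy. *)
Definition cover_cost (n c : nat) (f : nat -> nat) (N : nat) : nat :=
  (N %/ n) * f n + rest_cost c f (N %% n).

Variables (n c : nat) (f : nat -> nat).
Hypothesis Hf : profile n c f.

Let n_gt0 : 0 < n. Proof. by have := profile_half Hf; lia. Qed.

Lemma profile_incrD (x y : nat) : c < x -> x + y <= n -> 0 < y ->
  f (x + y) < f x + y * f 1.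
Proof.
move=> cx; elim: y => // -[|y] IH xyn _.
  by rewrite addn1 mul1n; apply: (profile_incr Hf); lia.
have := IH _ isT; have := @profile_incr _ _ _ Hf (x + y.+1).
rewrite (addnS x y.+1) (mulSn y.+1); lia.
Qed.

(** At [c.+1] this is the switch condition; every later step costs less than [f 1]. *)
Lemma profile_le_linear (x : nat) : c < x <= n -> f x <= x * f 1.
Proof.
move=> /andP[cx xn]; have [->|xc] := eqVneq x c.+1; first exact: profile_switch Hf.
have := @profile_incrD c.+1 (x - c.+1) (ltnSn _).
have -> : c.+1 + (x - c.+1) = x by lia.
move=> /(_ xn) h; have {}h := h ltac:(lia).
have := profile_switch Hf; rewrite -[in x * _](@subnKC c.+1 x) // mulnDl; lia.
Qed.

Lemma profile_lt_linear (x : nat) : c.+1 < x <= n -> f x < x * f 1.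
Proof.
move=> /andP[cx xn].
have := @profile_incrD c.+1 (x - c.+1) (ltnSn _).
have -> : c.+1 + (x - c.+1) = x by lia.
move=> /(_ xn) h; have {}h := h ltac:(lia).
have := profile_switch Hf; rewrite -[in x * _](@subnKC c.+1 x) ?mulnDl //; lia.
Qed.

Lemma profile_ge_linear (x : nat) : x <= c -> x * f 1 <= f x.
Proof.
case: x => [|[|x]] xc; rewrite ?mul0n ?mul1n //.
by apply: ltnW; apply: (profile_small Hf).
Qed.

(* Residues x for which the extremal copies of size x may be split off. *)
Definition tight_step (r x : nat) : bool :=
  [|| x == 0, x == n, (0 < r <= c) && (x == 1) | (c < r) && (x == r)].

(** Below [c] the function [f] lies above its linear minorant, and replacing it by that minorant
    restores subadditivity. The cases are whether [a] and [a + x] exceed [c]; crossing [c] uses the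
    linear upper bound beyond the switch or growth by less than [f 1] per vertex. *)
Lemma rest_cost_step (a x : nat) : a < n -> 0 < x < n -> a + x < n ->
  rest_cost c f (a + x) <= rest_cost c f a + f x.
Proof.
move=> an /andP[x0 xn] axn.
rewrite /rest_cost; have dx := @profile_ge_linear x.
case: (leqP a c) => ac; case: (leqP (a + x) c) => axc.
- by rewrite mulnDl leq_add2l dx //; lia.
- case: (leqP x c) => xc.
    have := @profile_le_linear (a + x); rewrite mulnDl; move: (dx xc); lia.
  have [->|a0] := posnP a; first by rewrite add0n.
  by have := @profile_incrD x a xc; rewrite addnC; lia.
- lia.
- case: (leqP x c) => xc.
    have := @profile_incrD a x ac; move: (dx xc); lia.
  have := @profile_subadd _ _ _ Hf a x ac xc; lia.
Qed.

(** Every case of the preceding inequality is strict except clones added one at a time up to [c],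
    and the jump from 0 to a residue beyond it. The disjunction excludes a tie at [c.+1], where both
    ways of covering could end. *)
Lemma rest_cost_step_eq (a x : nat) : a < n -> 0 < x < n -> a + x < n ->
  (c.+1 < a + x) || (f c.+1 < c.+1 * f 1) || (a + x <= c) ->
  rest_cost c f (a + x) = rest_cost c f a + f x -> tight_step (a + x) x.
Proof.
move=> an /andP[x0 xn] axn hb; rewrite /rest_cost /tight_step.
have dx := @profile_ge_linear x; have dx2 := @profile_small _ _ _ Hf x.
case: (leqP a c) => ac; case: (leqP (a + x) c) => axc.
- by rewrite mulnDl; move: dx2 => /=; lia.
- have [a0|a0] := posnP a; first by rewrite a0 add0n eqxx !orbT.
  case: (leqP x c) => xc.
    have [e|ne] := eqVneq (a + x) c.+1.
      by move: hb; rewrite e; move: (dx xc); rewrite -[in c.+1 * _]e mulnDl; lia.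
    have := @profile_lt_linear (a + x); rewrite mulnDl; move: (dx xc); lia.
  by have := @profile_incrD x a xc; rewrite addnC; lia.
- lia.
- case: (leqP x c) => xc.
    have := @profile_incrD a x ac; move: (dx xc); lia.
  have := @profile_subadd _ _ _ Hf a x ac xc; lia.
Qed.

(** Completing a multiple of [n] is strictly wasteful unless done by a whole copy. Since
    [2 * c + 2 <= n], the numbers [a] and [x] are not both at most [c]: if one is, the other is
    filled up to [n] at less than [f 1] per vertex, and otherwise [profile_supermod] applies. *)
Lemma rest_cost_wrap (a x : nat) : a < n -> 0 < x < n -> n <= a + x ->
  let y := a + x - n in
  f n + rest_cost c f y <= rest_cost c f a + f x /\
  (f n + rest_cost c f y = rest_cost c f a + f x -> 0 < y <= c /\ x = 1).
Proof.
move=> an /andP[x0 xn] axn y; rewrite /y /rest_cost.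
have hh := profile_half Hf; have c2 := profile_ge2 Hf.
have dx := @profile_ge_linear x; have dx2 := @profile_small _ _ _ Hf x.
have dy := @profile_ge_linear y.
case: (leqP a c) => ac.
  have cx : c < x by lia.
  have := @profile_incrD x (n - x) cx; rewrite subnKC; last lia.
  move=> /(_ (leqnn n)) h; have {}h := h ltac:(lia).
  have -> : a + x - n <= c by lia.
  have -> : a = n - x + (a + x - n) by lia.
  rewrite mulnDl; have -> : n - x + (a + x - n) + x - n = a + x - n by lia.
  lia.
case: (leqP x c) => xc.
  have := @profile_incrD a (n - a) ac; rewrite subnKC; last lia.
  move=> /(_ (leqnn n)) h; have {}h := h ltac:(lia).
  have -> : a + x - n <= c by lia.
  move: (dx xc) dx2; rewrite {1 3}(_ : x = n - a + (a + x - n)); last lia.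
  rewrite mulnDl; have [x1|x1] := eqVneq x 1; first by lia.
  by move=> ? /(_ ltac:(lia)); lia.
have h6 := @profile_supermod _ _ _ Hf a x an xn axn.
by case: (leqP (a + x - n) c) => yc; [have := dy yc; rewrite /y|]; lia.
Qed.

Lemma cover_cost0 : cover_cost n c f 0 = 0.
Proof. by rewrite /cover_cost div0n mod0n /rest_cost mul0n. Qed.

Lemma cover_costDn (k N : nat) :
  cover_cost n c f (k * n + N) = k * f n + cover_cost n c f N.
Proof. by rewrite /cover_cost modnMDl divnMDl // mulnDl addnA. Qed.

Lemma cover_cost_lt (x : nat) : x < n -> cover_cost n c f x = rest_cost c f x.
Proof. by move=> xn; rewrite /cover_cost divn_small // modn_small. Qed.

(* At c.+1 the two ways of covering may tie; then this residue is excluded. *)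
Definition good_residue (r : nat) : Prop :=
  (c.+1 < r) || (f c.+1 < c.+1 * f 1) || (r <= c).

(** The potential inequality: a copy that contributes [x] new vertices pays for the increase of the
    optimum. Reduction modulo [n] leaves the two residue lemmas, according to whether [a + x]
    reaches [n]. *)
Lemma cover_cost_step (N x : nat) : x <= n ->
  cover_cost n c f (N + x) <= cover_cost n c f N + f x.
Proof.
move=> xn; have [->|x0] := posnP x.
  by rewrite addn0 (profile0 Hf) addn0.
have [->|xn'] := eqVneq x n.
  by rewrite addnC -[X in X + _]mul1n cover_costDn mul1n addnC.
rewrite (divn_eq N n) -addnA !cover_costDn -addnA leq_add2l.
have a_lt := ltn_pmod N n_gt0; set a := N %% n in a_lt *.
rewrite (cover_cost_lt a_lt).
case: (ltnP (a + x) n) => ax.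
  rewrite cover_cost_lt //; apply: rest_cost_step => //; lia.
have [|le _] := @rest_cost_wrap a x a_lt _ ax; first by lia.
rewrite (_ : a + x = 1 * n + (a + x - n)); last lia.
by rewrite cover_costDn mul1n cover_cost_lt //; lia.
Qed.

(** All uniqueness rests on this: in an optimal graph a copy may bring only 0 or [n] new vertices,
    or a single one in the elementary range, or the whole residue beyond it. *)
Lemma cover_cost_step_eq (N x : nat) : x <= n ->
  good_residue ((N + x) %% n) ->
  cover_cost n c f (N + x) = cover_cost n c f N + f x ->
  tight_step ((N + x) %% n) x.
Proof.
move=> xn; have [->|x0] := posnP x; first by rewrite /tight_step eqxx.
have [->|xn'] := eqVneq x n; first by rewrite /tight_step eqxx orbT.
rewrite (divn_eq N n) -addnA !cover_costDn -addnA modnMDl.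
move=> gr /eqP; rewrite eqn_add2l => /eqP.
have a_lt := ltn_pmod N n_gt0; set a := N %% n in a_lt gr *.
rewrite (cover_cost_lt a_lt).
case: (ltnP (a + x) n) => ax.
  move: gr; rewrite modn_small // => gr; rewrite cover_cost_lt // => e.
  by apply: rest_cost_step_eq => //; lia.
have [|le h] := @rest_cost_wrap a x a_lt _ ax; first by lia.
have e1 : a + x = 1 * n + (a + x - n) by lia.
rewrite {1}e1 cover_costDn mul1n cover_cost_lt; last lia.
move=> /h [h1 x1]; rewrite e1 modnMDl modn_small; last lia.
by rewrite /tight_step h1 x1 eqxx !orbT.
Qed.

End OptimalSplitting.

(** * Edge counts and copies *)

Section Graphs.
Local Open Scope nat_scope.

Section Basics.
Variables (T : finType) (G : sgraph T).
Implicit Types (A B C : {set T}).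

Lemma adjC x y : adj G x y = adj G y x.
Proof. by rewrite /adj setUC. Qed.

Lemma adjxx x : adj G x x = false.
Proof.
apply/negP => h; have /forall_inP/(_ _ h) := edges_card2 G.
by rewrite setUid cards1.
Qed.

(* Ordered pairs, so that inner_pairs counts every edge twice. *)
Definition pairs_between A B : nat := \sum_(x in A) \sum_(y in B) adj G x y.
Definition inner_pairs A : nat := pairs_between A A.
Definition degree x : nat := pairs_between [set x] [set: T].

Lemma pairs_betweenC A B : pairs_between A B = pairs_between B A.
Proof.
rewrite /pairs_between exchange_big; apply: eq_bigr => x _.
by apply: eq_bigr => y _; rewrite adjC.
Qed.

Lemma pairs_between1l x B : pairs_between [set x] B = \sum_(y in B) adj G x y.
Proof. by rewrite /pairs_between big_set1. Qed.

Lemma sum_setU (F : T -> nat) A B : [disjoint A & B] ->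
  \sum_(x in A :|: B) F x = \sum_(x in A) F x + \sum_(x in B) F x.
Proof. by move=> dAB; rewrite -bigU //; apply: eq_bigl => x; rewrite inE. Qed.

Lemma pairs_betweenUl A B C : [disjoint A & B] ->
  pairs_between (A :|: B) C = pairs_between A C + pairs_between B C.
Proof. exact: sum_setU. Qed.

Lemma pairs_betweenUr A B C : [disjoint A & B] ->
  pairs_between C (A :|: B) = pairs_between C A + pairs_between C B.
Proof. by move=> d; rewrite pairs_betweenC pairs_betweenUl // !(pairs_betweenC C). Qed.

Lemma inner_pairsU A B : [disjoint A & B] ->
  inner_pairs (A :|: B) =
  inner_pairs A + 2 * pairs_between A B + inner_pairs B.
Proof.
move=> d; rewrite /inner_pairs pairs_betweenUl // !pairs_betweenUr //.
rewrite (pairs_betweenC B A); lia.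
Qed.

Lemma leq_pairs_between A A' B B' : A \subset A' -> B \subset B' ->
  pairs_between A B <= pairs_between A' B'.
Proof.
move=> /subsetP sA /subsetP sB; rewrite /pairs_between.
rewrite [X in _ <= X](bigID (mem A)) /= -[X in X <= _]addn0 leq_add //.
rewrite [X in _ <= X](eq_bigl (mem A)); last first.
  by move=> x /=; case: (boolP (x \in A)) => [/sA ->|]; rewrite ?andbF.
apply: leq_sum => x _.
rewrite [X in _ <= X](bigID (mem B)) /= -[X in X <= _]addn0 leq_add //.
rewrite [X in _ <= X](eq_bigl (mem B)) //.
by move=> y /=; case: (boolP (y \in B)) => [/sB ->|]; rewrite ?andbF.
Qed.

Lemma leq_inner_pairs A B : A \subset B -> inner_pairs A <= inner_pairs B.
Proof. by move=> s; apply: leq_pairs_between. Qed.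

Lemma inner_pairs1 x : inner_pairs [set x] = 0.
Proof. by rewrite /inner_pairs /pairs_between !big_set1 adjxx. Qed.

Lemma inner_pairs0 : inner_pairs set0 = 0.
Proof. by rewrite /inner_pairs /pairs_between big_set0. Qed.

Lemma pairs_between_sum A B :
  pairs_between A B = \sum_(x in A) pairs_between [set x] B.
Proof. by apply: eq_bigr => x _; rewrite pairs_between1l. Qed.

Lemma pairs_between_eq0 A B x y : pairs_between A B = 0 ->
  x \in A -> y \in B -> adj G x y = false.
Proof.
move=> /eqP; rewrite sum_nat_eq0 => /forall_inP h xA yB.
move: (h x xA); rewrite sum_nat_eq0 => /forall_inP/(_ y yB).
by rewrite eqb0 => /negbTE.
Qed.

Lemma pairs_between_le A B : pairs_between A B <= #|A| * #|B|.
Proof.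
rewrite -sum_nat_const; apply: leq_sum => x _; rewrite -[X in _ <= X]muln1.
by rewrite -sum_nat_const; apply: leq_sum => y _; case: adj.
Qed.

(** Adjacent ordered pairs are grouped by the edge they span, and each edge has exactly two
    orientations. *)
Lemma inner_pairsT2 : inner_pairs [set: T] = 2 * nb_edges G.
Proof.
rewrite /inner_pairs /pairs_between /nb_edges mulnC -sum_nat_const.
rewrite pair_big_dep /=.
rewrite (eq_bigr (fun p => if adj G p.1 p.2 then 1 else 0)); last first.
  by move=> p _; case: adj.
rewrite -big_mkcondr /=.
rewrite (partition_big (fun p : T * T => [set p.1; p.2]) (mem (edges G))) /=;
  last by move=> p /andP[_].
apply: eq_bigr => e eG.
have /forall_inP/(_ _ eG)/cards2P[x [y [xy E0]]] := edges_card2 G; subst e.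
have yx : (x, y) != (y, x) by rewrite xpair_eqE negb_and xy.
rewrite (bigD1 (x, y)) /=; last by rewrite !inE /adj eG eqxx.
rewrite (bigD1 (y, x)) /=; last by rewrite !inE adjC /adj eG setUC eqxx eq_sym.
rewrite big1 // => -[a b] /=; rewrite !inE /= => /andP[/andP[/andP[_ /eqP E]] ab ba].
have ax : a \in [set x; y] by rewrite -E !inE eqxx.
have bx : b \in [set x; y] by rewrite -E !inE eqxx orbT.
have xa : x \in [set a; b] by rewrite E !inE eqxx.
have ya : y \in [set a; b] by rewrite E !inE eqxx orbT.
move: ax bx xa ya ab ba; rewrite !inE !xpair_eqE.
by do 2 case/orP => /eqP->; rewrite ?eqxx ?orbT //= ?orbb ?(negbTE xy) // eq_sym (negbTE xy).
Qed.

End Basics.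


Section Maps.
Variables (T U : finType) (G : sgraph T) (K : sgraph U).
Implicit Types A B : {set U}.

Lemma pairs_between_copy (f : U -> T) A B : copy_in K G f ->
  pairs_between K A B <= pairs_between G (f @: A) (f @: B).
Proof.
move=> [fI fK]; rewrite /pairs_between big_imset /=; last by move=> ? ? _ _ /fI.
apply: leq_sum => x _; rewrite big_imset /=; last by move=> ? ? _ _ /fI.
by apply: leq_sum => y _; case E: (adj K x y) => //; rewrite fK.
Qed.

Lemma pairs_between_iso (f : U -> T) A B : injective f ->
  (forall x y, adj G (f x) (f y) = adj K x y) ->
  pairs_between G (f @: A) (f @: B) = pairs_between K A B.
Proof.
move=> fI fK; rewrite /pairs_between big_imset /=; last by move=> ? ? _ _ /fI.
apply: eq_bigr => x _; rewrite big_imset /=; last by move=> ? ? _ _ /fI.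
by apply: eq_bigr => y _; rewrite fK.
Qed.

(** The map can only create adjacencies, so the two double sums compare term by term, and equal
    totals force equal terms. This is how an equality of edge counts yields an induced copy. *)
Lemma copy_exact (f : U -> T) A : copy_in K G f ->
  inner_pairs G (f @: A) <= inner_pairs K A ->
  {in A &, forall x y, adj G (f x) (f y) = adj K x y}.
Proof.
move=> [fI fK]; rewrite /inner_pairs /pairs_between.
rewrite big_imset /=; last by move=> ? ? _ _ /fI.
under eq_bigr => x _ do (rewrite big_imset /=; last by move=> ? ? _ _ /fI).
move=> le x y xA yA.
have h (u v : U) : adj K u v <= adj G (f u) (f v).
  by case E: (adj K u v) => //; rewrite fK.
have h1 (u : U) : u \in A ->
  \sum_(v in A) adj K u v <= \sum_(v in A) adj G (f u) (f v).
  by move=> _; apply: leq_sum.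
have h2 : \sum_(u in A) \sum_(v in A) adj K u v <=
          \sum_(u in A) \sum_(v in A) adj G (f u) (f v) by apply: leq_sum.
have {}le := anti_leq (introT andP (conj le h2)).
move: le; rewrite (bigD1 x) // [RHS](bigD1 x) //=.
rewrite (bigD1 y) // [X in _ = X + _](bigD1 y) //=.
have := @leq_sum _ (index_enum U) (fun v => (v \in A) && (v != y)) _ _ (fun v _ => h x v).
have := @leq_sum _ (index_enum U) (fun v => (v \in A) && (v != x)) _ _
   (fun v hv => h1 v (proj1 (andP hv))).
have := h x y; case: adj; case: adj => //=; lia.
Qed.

End Maps.

Lemma isomorphic_sym (T U : finType) (G : sgraph T) (K : sgraph U) :
  isomorphic G K -> isomorphic K G.
Proof.
move=> [f [g fK gK] h]; exists g; first by exists f.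
by move=> x y; rewrite -{2}(gK x) -{2}(gK y) h.
Qed.

Lemma isomorphic_nb_edges (T U : finType) (G : sgraph T) (K : sgraph U) :
  isomorphic G K -> nb_edges G = nb_edges K.
Proof.
move=> [f fb fh]; have fI := bij_inj fb.
have : inner_pairs K [set: U] = inner_pairs G [set: T].
  rewrite /inner_pairs -(pairs_between_iso [set: T] [set: T] fI fh).
  suff -> : f @: [set: T] = [set: U] by [].
  apply/setP => y; rewrite inE; case: fb => g _ gK.
  by apply/imsetP; exists (g y); rewrite ?gK.
rewrite !inner_pairsT2; lia.
Qed.

Section MkGraph.
Variables (T : finType) (e : rel T).

Definition mkgraph_edges : {set {set T}} :=
  [set [set p.1; p.2] | p : T * T & (p.1 != p.2) && e p.1 p.2].

Lemma mkgraph_card2 : [forall a in mkgraph_edges, #|a| == 2].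
Proof.
by apply/forall_inP => a /imsetP[[x y]]; rewrite inE /= => /andP[h _ ->]; rewrite cards2 h.
Qed.

Definition mkgraph : sgraph T := SGraph mkgraph_card2.

Lemma mkgraph_adj : symmetric e -> forall x y,
  adj mkgraph x y = (x != y) && e x y.
Proof.
move=> es x y; apply/idP/idP.
  move=> /imsetP[[a b]]; rewrite inE /= => /andP[ab eab] E.
  have : x \in [set a; b] by rewrite -E !inE eqxx.
  have : y \in [set a; b] by rewrite -E !inE eqxx orbT.
  have : a \in [set x; y] by rewrite E !inE eqxx.
  have : b \in [set x; y] by rewrite E !inE eqxx orbT.
  rewrite !inE => hb ha /orP[] /eqP hy /orP[] /eqP hx; move: ha hb; rewrite hx hy.
  - by move=> _; rewrite orbb eq_sym (negbTE ab).
  - by move=> _ _; rewrite eq_sym ab es eab.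
  - by move=> _ _; rewrite ab eab.
  - by rewrite orbb (negbTE ab).
by move=> /andP[h1 h2]; apply/imsetP; exists (x, y); rewrite ?inE ?h1.
Qed.

End MkGraph.

Section Pull.
Variables (T U : finType) (G : sgraph T) (s : U -> T).
(** The map [s] need not be injective: vertices with the same image become non-adjacent twins, which
    is how clones are produced. *)
Definition pull : sgraph U := mkgraph (fun x y => adj G (s x) (s y)).

Lemma pull_adj x y : adj pull x y = adj G (s x) (s y).
Proof.
rewrite mkgraph_adj; last by move=> a b; rewrite adjC.
by have [->|//] := eqVneq x y; rewrite adjxx.
Qed.
End Pull.

Lemma induced_adj (T : finType) (G : sgraph T) (A : {set T})
  (x y : {x : T | x \in A}) : adj (induced G A) x y = adj G (val x) (val y).
Proof. by rewrite /adj inE imsetU1 imset_set1. Qed.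

Lemma isomorphic_induced (T U : finType) (G : sgraph T) (K : sgraph U)
  (A : {set T}) (f : U -> T) : injective f -> f @: [set: U] = A ->
  (forall x y, adj G (f x) (f y) = adj K x y) -> isomorphic (induced G A) K.
Proof.
move=> fI fA fh; apply: isomorphic_sym.
have fin x : f x \in A by rewrite -fA imset_f.
exists (fun x => exist _ (f x) (fin x) : {x : T | x \in A}); last first.
  by move=> x y; rewrite induced_adj /= fh.
apply: inj_card_bij; first by move=> x y [] /fI.
by rewrite card_sig -fA card_imset // cardsT.
Qed.

Lemma isomorphic_inducedP (T U : finType) (G : sgraph T) (K : sgraph U)
  (A : {set T}) : isomorphic (induced G A) K ->
  exists f : U -> T, [/\ injective f, f @: [set: U] = A &
    forall x y, adj G (f x) (f y) = adj K x y].
Proof.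
move=> /isomorphic_sym [f fb fh]; exists (fun x => val (f x)); split.
- by move=> x y /val_inj /(bij_inj fb).
- apply/setP => x; apply/imsetP/idP => [[y _ ->]|xA]; first exact: valP.
  case: fb => g _ gK; exists (g (exist _ x xA)) => //; by rewrite gK.
- by move=> x y; rewrite -fh induced_adj.
Qed.

Section Density.
Variables (U : finType) (H : sgraph U).
Implicit Types A B : {set U}.

(** [dens] and [cost] are the functions M and f of the overview. *)
Definition dens (k : nat) : nat := \max_(A : {set U} | #|A| == k) inner_pairs H A.
Definition cost (x : nat) : nat := dens #|U| - dens (#|U| - x).

Lemma dens_ge A : inner_pairs H A <= dens #|A|.
Proof. by rewrite /dens; apply: leq_bigmax_cond. Qed.

Lemma dens_ex k : k <= #|U| -> exists2 A : {set U}, #|A| = k & inner_pairs H A = dens k.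
Proof.
move=> kU; have [A0 A0k] : exists A : {set U}, #|A| == k.
  have : 0 < #|[set A : {set U} | #|A| == k]| by rewrite card_draws bin_gt0.
  by move=> /card_gt0P[A]; rewrite inE; exists A.
have [A Ak E] := @eq_bigmax_cond _ (fun A : {set U} => #|A| == k) (inner_pairs H)
   ltac:(by apply/card_gt0P; exists A0).
by exists A; [apply/eqP|rewrite /dens E].
Qed.

Lemma densT : dens #|U| = inner_pairs H [set: U].
Proof.
have [A Ak <-] := dens_ex (leqnn #|U|); congr inner_pairs.
by apply/eqP; rewrite eqEcard subsetT cardsT Ak /=.
Qed.

Lemma card_lt_ex A : #|A| < #|U| -> exists x, x \notin A.
Proof.
move=> lt; have /card_gt0P[x] : 0 < #|~: A| by have := cardsC A; lia.
by rewrite inE; exists x.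
Qed.

Lemma dens_leS k : k < #|U| -> dens k <= dens k.+1.
Proof.
move=> kU; have [A Ak <-] := dens_ex (ltnW kU).
have [x xA] : exists x, x \notin A by apply: card_lt_ex; rewrite Ak.
have := dens_ge (x |: A); rewrite cardsU1 xA Ak => h.
by apply: leq_trans h; apply/leq_inner_pairs/subsetUr.
Qed.

Lemma dens_le k l : k <= l -> l <= #|U| -> dens k <= dens l.
Proof.
elim: l => [|l IH]; first by rewrite leqn0 => /eqP->.
rewrite leq_eqVlt => /orP[/eqP->//|kl] lU.
by apply: leq_trans (IH kl (ltnW lU)) (dens_leS lU).
Qed.

Lemma dens_cost x : x <= #|U| -> cost x + dens (#|U| - x) = dens #|U|.
Proof. by move=> xU; rewrite subnK // dens_le // leq_subr. Qed.

Lemma cost0 : cost 0 = 0.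
Proof. by rewrite /cost subn0 subnn. Qed.

Lemma cost_card : cost #|U| = inner_pairs H [set: U].
Proof.
rewrite -densT /cost subnn; have [A A0 <-] := @dens_ex 0 isT.
by rewrite (cards0_eq A0) inner_pairs0 subn0.
Qed.

Lemma inner_pairs_split A : inner_pairs H [set: U] =
  inner_pairs H A + 2 * pairs_between H A (~: A) + inner_pairs H (~: A).
Proof. by rewrite -inner_pairsU ?setUCr // -setI_eq0 setICr. Qed.

(** The complement of [A] is one of the sets over which [dens] maximises. *)
Lemma cost_le A : cost #|A| <=
  2 * pairs_between H A (~: A) + inner_pairs H A.
Proof.
have := dens_ge (~: A); have := inner_pairs_split A.
have cA : #|A| <= #|U| := max_card _.
have := dens_cost cA; rewrite densT.
have -> : #|~: A| = #|U| - #|A| by have := cardsC A; lia.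
lia.
Qed.

Lemma inner_pairsC1 v :
  inner_pairs H (~: [set v]) + 2 * degree H v = inner_pairs H [set: U].
Proof.
rewrite (inner_pairs_split [set v]) inner_pairs1 /degree.
rewrite -{1}(setUCr [set v]) pairs_betweenUr -?setI_eq0 ?setICr //.
have := inner_pairs1 H v; rewrite /inner_pairs => ->; lia.
Qed.

Lemma cost1_le v : cost 1 <= 2 * degree H v.
Proof.
have := cost_le [set v]; rewrite cards1 inner_pairs1.
have := inner_pairs_split [set v]; have := inner_pairsC1 v.
rewrite inner_pairs1; lia.
Qed.

Lemma cost1_ex : 0 < #|U| -> exists v, cost 1 = 2 * degree H v.
Proof.
move=> U0; have [A A1 E] := dens_ex (leq_subr 1 #|U|).
have /cards1P[v vA] : #|~: A| == 1 by apply/eqP; have := cardsC A; lia.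
exists v; have := inner_pairsC1 v; rewrite -vA setCK E.
have := dens_cost U0; rewrite densT; lia.
Qed.

End Density.

Section CopyStep.
Variables (T U : finType) (G : sgraph T) (H : sgraph U).

(** Pairs of [H] not contained in the preimage of [A] are mapped to pairs not contained in [A], so
    they are new. *)
Lemma copy_step_exact (f : U -> T) (A : {set T}) : copy_in H G f ->
  inner_pairs G A + (inner_pairs H [set: U] - inner_pairs H (f @^-1: A)) <=
  inner_pairs G (A :|: f @: [set: U]).
Proof.
move=> fc; have fI := fc.1.
rewrite (inner_pairs_split H (f @^-1: A)).
set B := f @: (~: (f @^-1: A)).
have -> : A :|: f @: [set: U] = A :|: B.
  apply/setP => x; rewrite !inE; case: (boolP (x \in A)) => //= xA.
  apply/imsetP/imsetP => -[u hu E]; exists u => //.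
  by rewrite !inE -E.
have dAB : [disjoint A & B].
  rewrite disjoint_sym; apply/pred0P => x /=; apply/negP => /andP[].
  by move=> /imsetP[u]; rewrite !inE => hu -> hu'; rewrite hu' in hu.
rewrite inner_pairsU //.
have h1 := pairs_between_copy (f @^-1: A) (~: (f @^-1: A)) fc.
have h2 := pairs_between_copy (~: (f @^-1: A)) (~: (f @^-1: A)) fc.
have h3 : pairs_between G (f @: (f @^-1: A)) B <= pairs_between G A B.
  by apply: leq_pairs_between => //; apply/subsetP => x /imsetP[u]; rewrite inE => ? ->.
rewrite -/B -/(inner_pairs _ _) -/(inner_pairs _ _) in h1 h2; lia.
Qed.

Lemma card_copy_new (f : U -> T) (A : {set T}) : injective f ->
  #|f @: [set: U] :\: A| + #|f @^-1: A| = #|U|.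
Proof.
move=> fI; have -> : f @: [set: U] :\: A = f @: (~: (f @^-1: A)).
  apply/setP => x; rewrite !inE; apply/andP/imsetP => [[xA /imsetP[u _ E]]|[u]].
    by exists u => //; rewrite !inE -E.
  by rewrite !inE => hu ->; rewrite hu imset_f.
by rewrite card_imset // addnC cardsC.
Qed.

(** The preimage of [A] consists of the old vertices of the copy, so it spans at most [dens] of
    their number. *)
Lemma copy_step (f : U -> T) (A : {set T}) : copy_in H G f ->
  inner_pairs G A + cost H #|f @: [set: U] :\: A| <=
  inner_pairs G (A :|: f @: [set: U]).
Proof.
move=> fc; apply: leq_trans (copy_step_exact A fc); rewrite leq_add2l.
have E := card_copy_new A fc.1.
rewrite /cost densT leq_sub2l //.
by have := dens_ge H (f @^-1: A); rewrite (_ : #|U| - _ = #|f @^-1: A|) //; lia.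
Qed.

End CopyStep.

End Graphs.

(** * The lower bound for covered graphs and its equality case *)

Section CoverLowerBound.
Local Open Scope nat_scope.

Variables (T U : finType) (G : sgraph T) (H : sgraph U) (c : nat).
Local Notation n := #|U|.
Hypothesis Hp : profile n c (cost H).
Hypothesis cov : covered H G.
Implicit Types A : {set T}.

Let phi := cover_cost n c (cost H).

Lemma card_setC_copy (A : {set T}) (f : U -> T) :
  #|~: A| = #|~: (A :|: f @: [set: U])| + #|f @: [set: U] :\: A|.
Proof.
rewrite addnC -cardsUI; set X := _ :&: _; have -> : X = set0.
  by apply/setP => x; rewrite !inE; case: (x \in A); case: (x \in f @: _).
rewrite cards0 addn0; congr #|pred_of_set _|.
by apply/setP => x; rewrite !inE; case: (x \in A); case: (x \in f @: _).
Qed.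

Lemma card_copy_new_le (A : {set T}) (f : U -> T) : injective f ->
  #|f @: [set: U] :\: A| <= n.
Proof. by move=> fI; have := card_copy_new A fI; lia. Qed.

Lemma covered_copy_new A : 0 < #|~: A| -> exists f : U -> T,
  copy_in H G f /\ 0 < #|f @: [set: U] :\: A|.
Proof.
move=> /card_gt0P[v]; rewrite inE => vA; have [f [fc vf]] := cov v.
exists f; split => //; apply/card_gt0P; exists v.
by rewrite !inE vA; case/codomP: vf => u ->; rewrite imset_f.
Qed.

(** As long as a vertex is outside [A], a copy through it is added: by [copy_step] the gain is at
    least its [cost], and the potential drops by at most that. *)
Lemma cover_lower A : inner_pairs G A + phi #|~: A| <= inner_pairs G [set: T].
Proof.
have [m] := ubnP #|~: A|; elim: m A => // m IH A Am.
have [|h0] := posnP #|~: A|.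
  by move=> ->; rewrite /phi cover_cost0 addn0 leq_inner_pairs // subsetT.
have [f [fc x0]] := covered_copy_new h0.
have E := card_setC_copy A f; have xn := card_copy_new_le A fc.1.
have h := IH (A :|: f @: [set: U]) ltac:(lia).
have h1 := copy_step A fc; have h2 := cover_cost_step Hp #|~: (A :|: f @: [set: U])| xn.
rewrite -E in h2; rewrite /phi in h *; lia.
Qed.

(** Sets for which the lower bound is attained. In an optimal graph the empty set is tight, and
    tightness survives the addition of any copy, whichever is chosen. *)
Definition tight A : Prop :=
  inner_pairs G A + phi #|~: A| = inner_pairs G [set: T].

Lemma tight_copy A f : tight A -> copy_in H G f ->
  tight (A :|: f @: [set: U]) /\
  (good_residue c (cost H) (#|~: A| %% n) ->
   tight_step n c (#|~: A| %% n) #|f @: [set: U] :\: A|).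
Proof.
rewrite /tight => tA fc.
have E := card_setC_copy A f; have xn := card_copy_new_le A fc.1.
have h := cover_lower (A :|: f @: [set: U]).
have h1 := copy_step A fc; have h2 := cover_cost_step Hp #|~: (A :|: f @: [set: U])| xn.
rewrite -E in h2; rewrite /phi in h tA *; split; first lia.
by rewrite E => g; apply: (cover_cost_step_eq Hp xn g); rewrite -E; lia.
Qed.

(** A copy through an uncovered vertex either brings [n] vertices, hence is disjoint from [A], or
    lowers the residue and keeps tightness. The residue cannot drop forever, and a copy disjoint
    from the enlarged set is disjoint from [A]. *)
Lemma tight_disjoint_copy m r A : tight A -> #|~: A| = m * n + r ->
  r < n -> good_residue c (cost H) r -> 0 < m ->
  exists2 f : U -> T, copy_in H G f & [disjoint f @: [set: U] & A].
Proof.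
have hn := profile_half Hp; have c2 := profile_ge2 Hp.
elim/ltn_ind: r A => r IH A tA E rn gr m0.
have h0 : 0 < #|~: A| by nia.
have [f [fc x0]] := covered_copy_new h0.
have [tA' ts] := tight_copy tA fc.
have E' := card_setC_copy A f.
have Er : #|~: A| %% n = r by rewrite E modnMDl modn_small.
move: ts; rewrite Er => /(_ gr).
set x := #|_ :\: A| in x0 E' *.
have next : 0 < r -> good_residue c (cost H) (r - x) -> x <= r ->
  exists2 f : U -> T, copy_in H G f & [disjoint f @: [set: U] & A].
  move=> r0 g xr; have [|||g' gc gd] := IH (r - x) _ _ tA' _ _ g m0; [lia|lia|lia|].
  exists g' => //; apply: disjointWr gd; exact: subsetUl.
move=> /or4P[/eqP|/eqP xn|/andP[hr /eqP x1]|/andP[hr /eqP xr]].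
- by move=> x00; rewrite x00 in x0.
- exists f => //; rewrite -setI_eq0 -cards_eq0.
  have := cardsID A (f @: [set: U]); rewrite -/x xn card_imset ?cardsT; [lia|exact: fc.1].
- by apply: next; rewrite ?x1 /good_residue; lia.
- by apply: next; rewrite ?xr ?subnn /good_residue; lia.
Qed.

Lemma tight0 N : #|T| = N -> inner_pairs G [set: T] = phi N -> tight set0.
Proof. by move=> TN E; rewrite /tight inner_pairs0 setC0 cardsT TN. Qed.

Lemma tight_family q r : #|T| = q * n + r -> tight set0 ->
  r < n -> good_residue c (cost H) r ->
  exists h : 'I_q -> U -> T,
    [/\ forall i, copy_in H G (h i),
        forall i j, i != j -> [disjoint h i @: [set: U] & h j @: [set: U]],
        tight (\bigcup_i h i @: [set: U]) &
        #|~: (\bigcup_i h i @: [set: U])| = r].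
Proof.
move=> TN t0 rn gr.
case: (posnP q) => [q0|q0].
  have noq (i : 'I_q) : False by have := ltn_ord i; lia.
  exists (fun i => match noq i with end).
  have -> : \bigcup_(i < q) (match noq i with end : U -> T) @: [set: U] = set0.
    by apply: big1 => i; case: (noq i).
  by split=> [i|i|//|]; rewrite ?setC0 ?cardsT ?TN ?q0 //; case: (noq i).
(* Some copy exists; it serves as the default value of a family indexed by [nat]. *)
have [f0 _ _] : exists2 f : U -> T, copy_in H G f & [disjoint f @: [set: U] & set0].
  by apply: (@tight_disjoint_copy q r); rewrite ?setC0 ?cardsT ?TN.
suff step k : k <= q -> exists h : nat -> U -> T,
    [/\ forall i, i < k -> copy_in H G (h i),
        forall i j, i < k -> j < k -> i != j -> [disjoint h i @: [set: U] & h j @: [set: U]],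
        tight (\bigcup_(i < k) h i @: [set: U]) &
        #|~: (\bigcup_(i < k) h i @: [set: U])| = (q - k) * n + r].
  have [h [hc hd ht hr]] := step q (leqnn q).
  exists (fun i => h i); split=> [i|i j ij|//|]; first by apply: hc.
    by apply: hd.
  by rewrite hr subnn.
elim: k => [_|k IH kq].
  exists (fun=> f0); split=> //; first by rewrite big_ord0.
  by rewrite big_ord0 setC0 cardsT subn0.
have [h [hc hd ht hr]] := IH (ltnW kq).
have [|f fc fd] := @tight_disjoint_copy (q - k) r _ ht hr rn gr; first by lia.
exists (fun i => if i == k then f else h i).
have E : \bigcup_(i < k.+1) (if i == k :> nat then f else h i) @: [set: U] =
    (\bigcup_(i < k) h i @: [set: U]) :|: f @: [set: U].
  rewrite big_ord_recr /= eqxx; congr (_ :|: _); apply: eq_bigr => i _.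
  by rewrite ltn_eqF.
have fd' i : i < k -> [disjoint h i @: [set: U] & f @: [set: U]].
  move=> ik; rewrite disjoint_sym; apply: disjointWr fd.
  exact: (bigcup_sup (Ordinal ik)).
split.
- move=> i ik; case: eqP => // ne; apply: hc; lia.
- move=> i j ik jk ij; case: (eqVneq i k) => [ei|ni]; case: (eqVneq j k) => [ej|nj].
  + by rewrite ei ej eqxx in ij.
  + by rewrite disjoint_sym; apply: fd'; lia.
  + by apply: fd'; lia.
  + by apply: hd => //; lia.
- by rewrite E; case: (tight_copy ht fc).
- rewrite E; have := card_setC_copy (\bigcup_(i < k) h i @: [set: U]) f.
  rewrite hr; set B := f @: [set: U] :\: _; have -> : B = f @: [set: U].
    by apply/setDidPl.
  rewrite card_imset ?cardsT; last exact: fc.1.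
  have : (q - k) * n = (q - k.+1) * n + n by rewrite -mulSnr; congr (_ * _); lia.
  lia.
Qed.

End CoverLowerBound.

(** * Disjoint unions and covered graphs *)

Section Unions.
Local Open Scope nat_scope.

Lemma sum_tight (I : finType) (A : {set I}) (a b : I -> nat) :
  (forall x, x \in A -> a x <= b x) ->
  \sum_(x in A) b x <= \sum_(x in A) a x -> forall x, x \in A -> b x = a x.
Proof.
move=> le h x xA; have := le x xA.
have : \sum_(y in A | y != x) a y <= \sum_(y in A | y != x) b y.
  by apply: leq_sum => y /andP[yA _]; apply: le.
by move: h; rewrite (bigD1 x) // [X in _ <= X](bigD1 x) //=; lia.
Qed.

Section Covered.
Variables (U : finType) (H : sgraph U).

Lemma covered_iso (T S : finType) (G : sgraph T) (K : sgraph S) :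
  isomorphic G K -> covered H G -> covered H K.
Proof.
move=> [g [g' gK g'K] gh] cov v; have [f [[fI fh] vf]] := cov (g' v).
exists (g \o f); split; first split.
- by apply: inj_comp => //; exact: can_inj gK.
- by move=> x y /fh; rewrite -gh.
- by case/codomP: vf => u E; apply/codomP; exists u; rewrite /= -E g'K.
Qed.

Lemma tagged_inj (I : finType) (T : I -> finType) (i : I) :
  injective (fun x : T i => Tagged T x).
Proof. by move=> x y /eqP; rewrite -tag_eqE /tag_eq eqxx tagged_asE => /eqP. Qed.

Lemma dunion_adj (I : finType) (T : I -> finType) (G : forall i, sgraph (T i))
  (i : I) (x y : T i) :
  adj (dunion G) (Tagged T x) (Tagged T y) = adj (G i) x y.
Proof.
rewrite /adj /=; apply/bigcupP/idP => [[j _ /imsetP[e eG E]]|h].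
  have : Tagged T x \in [set Tagged T z | z in e] by rewrite -E !inE eqxx.
  move=> /imsetP[z ze /eqP]; rewrite -tag_eqE => /andP[/= /eqP ij _].
  subst j; move: E; rewrite -(imset_set1 _ x) -(imset_set1 _ y) -imsetU.
  by move=> /(imset_inj (@tagged_inj I T i)) ->.
by exists i => //; apply/imsetP; exists [set x; y]; rewrite // imsetU !imset_set1.
Qed.

Lemma dunion_adj_tag (I : finType) (T : I -> finType) (G : forall i, sgraph (T i))
  (x y : {i : I & T i}) : adj (dunion G) x y -> tag x = tag y.
Proof.
rewrite /adj /= => /bigcupP[j _ /imsetP[e eG E]].
have : x \in [set Tagged T z | z in e] by rewrite -E !inE eqxx.
have : y \in [set Tagged T z | z in e] by rewrite -E !inE eqxx orbT.
by move=> /imsetP[z _ ->] /imsetP[w _ ->].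
Qed.

Lemma dunion_covered (I : finType) (T : I -> finType) (G : forall i, sgraph (T i)) :
  (forall i, covered H (G i)) -> covered H (dunion G).
Proof.
move=> cov [i v]; have [f [[fI fh] vf]] := cov i v.
exists (fun u => Tagged T (f u)); split; first split.
- move=> x y E; apply: fI; exact: (@tagged_inj I T i _ _ E).
- by move=> x y /fh; rewrite dunion_adj.
- by case/codomP: vf => u E; apply/codomP; exists u; rewrite /= -E.
Qed.

Lemma big_tagged (I : finType) (T : I -> finType) (F : {i : I & T i} -> nat) :
  \sum_x F x = \sum_i \sum_(x : T i) F (Tagged T x).
Proof.
rewrite (partition_big (fun x : {i : I & T i} => tag x) predT) //=.
apply: eq_bigr => i _; rewrite [RHS](eq_bigl (mem [set: T i])); last by move=> x; rewrite !inE.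
rewrite -(@big_imset _ _ _ _ _ (fun x : T i => Tagged T x) [set: T i] F) /=; last first.
  by move=> x y _ _ E; exact: (@tagged_inj I T i _ _ E).
apply: eq_bigl => -[j x] /=; apply/eqP/imsetP => [E|[y _ E]].
  by subst j; exists x.
by have := congr1 tag E.
Qed.

Lemma inner_pairsTE (T : finType) (G : sgraph T) :
  inner_pairs G [set: T] = \sum_x \sum_y adj G x y.
Proof.
rewrite /inner_pairs /pairs_between; under eq_bigl => x do rewrite inE.
by apply: eq_bigr => x _; apply: eq_bigl => y; rewrite inE.
Qed.

Lemma dunion_nb_edges (I : finType) (T : I -> finType) (G : forall i, sgraph (T i)) :
  nb_edges (dunion G) = \sum_i nb_edges (G i).
Proof.
suff : 2 * nb_edges (dunion G) = \sum_i 2 * nb_edges (G i) by rewrite -big_distrr /=; lia.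
rewrite -inner_pairsT2 inner_pairsTE big_tagged; apply: eq_bigr => i _.
rewrite -inner_pairsT2 inner_pairsTE; apply: eq_bigr => x _.
rewrite big_tagged (bigD1 i) //= [X in _ + X]big1 ?addn0.
  by apply: eq_bigr => y _; rewrite dunion_adj.
move=> j ji; apply: big1 => y _; apply/eqP; rewrite eqb0; apply/negP => /dunion_adj_tag /= E.
by rewrite E eqxx in ji.
Qed.

Section Dunion2.
Variables (T S : finType) (G : sgraph T) (K : sgraph S).

Lemma dunion2_adjl x y : adj (dunion2 G K) (inl x) (inl y) = adj G x y.
Proof.
rewrite /adj /= inE -(imset_set1 _ x) -(imset_set1 _ y) -imsetU.
rewrite mem_imset; last by apply: imset_inj => ? ? [].
rewrite orbC; case: imsetP => //= -[e _ E].
have : (inl x : T + S) \in [set inr z | z in e].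
  by rewrite -E imset_f // !inE eqxx.
by move=> /imsetP[].
Qed.

Lemma dunion2_adjr x y : adj (dunion2 G K) (inr x) (inr y) = adj K x y.
Proof.
rewrite /adj /= inE -(imset_set1 _ x) -(imset_set1 _ y) -imsetU.
rewrite orbC mem_imset; last by apply: imset_inj => ? ? [].
rewrite orbC; case: imsetP => //= -[e _ E].
have : (inr x : T + S) \in [set inl z | z in e].
  by rewrite -E imset_f // !inE eqxx.
by move=> /imsetP[].
Qed.

Lemma dunion2_adjlr x y : adj (dunion2 G K) (inl x) (inr y) = false.
Proof.
rewrite /adj /= inE; apply/negP => /orP[] /imsetP[e _ E].
  have : (inr y : T + S) \in [set inl z | z in e] by rewrite -E !inE eqxx orbT.
  by move=> /imsetP[].
have : (inl x : T + S) \in [set inr z | z in e] by rewrite -E !inE eqxx.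
by move=> /imsetP[].
Qed.

Lemma dunion2_covered : covered H G -> covered H K -> covered H (dunion2 G K).
Proof.
move=> cG cK [] v.
  have [f [[fI fh] vf]] := cG v; exists (fun u => inl (f u)); split; first split.
  - by move=> x y [] /fI.
  - by move=> x y /fh; rewrite dunion2_adjl.
  - by case/codomP: vf => u E; apply/codomP; exists u; rewrite /= -E.
have [f [[fI fh] vf]] := cK v; exists (fun u => inr (f u)); split; first split.
- by move=> x y [] /fI.
- by move=> x y /fh; rewrite dunion2_adjr.
- by case/codomP: vf => u E; apply/codomP; exists u; rewrite /= -E.
Qed.

Lemma dunion2_nb_edges : nb_edges (dunion2 G K) = nb_edges G + nb_edges K.
Proof.
suff : 2 * nb_edges (dunion2 G K) = 2 * nb_edges G + 2 * nb_edges K by lia.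
rewrite -!inner_pairsT2 !inner_pairsTE big_sumType /=; congr (_ + _).
  apply: eq_bigr => x _; rewrite big_sumType /= [X in _ + X]big1 ?addn0.
    by apply: eq_bigr => y _; rewrite dunion2_adjl.
  by move=> y _; rewrite dunion2_adjlr.
apply: eq_bigr => x _; rewrite big_sumType /= [X in X + _]big1 ?add0n.
  by apply: eq_bigr => y _; rewrite dunion2_adjr.
by move=> y _; rewrite adjC dunion2_adjlr.
Qed.
End Dunion2.

Lemma covered_refl : covered H H.
Proof. by move=> v; exists id; split; [split|apply/codomP; exists v]. Qed.

Lemma nb_edges_cost : 2 * nb_edges H = cost H #|U|.
Proof. by rewrite cost_card inner_pairsT2. Qed.

End Covered.

Section Clones.
Variables (n : nat) (H : sgraph 'I_n).

Lemma Mcond_covered M (G : sgraph 'I_M) : 0 < n -> n <= M -> Mcond H G -> covered H G.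
Proof.
move=> n0 nM hG v.
have key (i : 'I_M) : n.-1 <= i -> (v < n.-1) || (v == i) ->
    exists f : 'I_n -> 'I_M, copy_in H G f /\ v \in codom f.
  move=> ni vi; have [f [fI fA fh]] := isomorphic_inducedP (hG i ni).
  exists f; split; first by split=> // x y; rewrite fh.
  have : v \in f @: [set: 'I_n] by rewrite fA !inE orbC.
  by move=> /imsetP[u _ ->]; apply: codom_f.
case: (ltnP v n.-1) => [lt|ge]; last by apply: (key v ge); rewrite eqxx orbT.
have Hi : n.-1 < M by lia.
by apply: (key (Ordinal Hi)); rewrite //= lt.
Qed.

End Clones.
End Unions.

(** * The elementary range *)

Section ElementaryStructure.
Local Open Scope nat_scope.

Lemma degree_copy (T S : finType) (G : sgraph T) (K : sgraph S) (f : S -> T) (a : S) :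
  copy_in K G f -> degree K a <= pairs_between G [set f a] (f @: [set: S] :\ f a).
Proof.
move=> fc; have := pairs_between_copy [set a] [set: S] fc.
rewrite imset_set1 -/(degree K a) => h; apply: leq_trans h _.
have fa : f a \in f @: [set: S] by apply: imset_f.
rewrite -{1}(setD1K fa) pairs_betweenUr; last by rewrite disjoints1 !inE eqxx.
by have := inner_pairs1 G (f a); rewrite /inner_pairs => ->; rewrite add0n.
Qed.

Lemma inner_pairsD1 (T : finType) (G : sgraph T) (A : {set T}) x : x \in A ->
  inner_pairs G A = inner_pairs G (A :\ x) + 2 * pairs_between G [set x] (A :\ x).
Proof.
move=> xA; rewrite -{1}(setD1K xA) inner_pairsU ?inner_pairs1 ?disjoints1 ?inE ?eqxx //.
lia.
Qed.

Lemma sum_degree (T : finType) (G : sgraph T) (A : {set T}) :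
  \sum_(x in A) degree G x = pairs_between G A (~: A) + inner_pairs G A.
Proof.
rewrite /inner_pairs -pairs_betweenUr; last by rewrite -setI_eq0 setIC setICr.
by rewrite setUC setUCr pairs_between_sum.
Qed.

Lemma cost_le_degrees (T : finType) (G : sgraph T) (A : {set T}) :
  cost G #|A| + inner_pairs G A <= 2 * \sum_(x in A) degree G x.
Proof. by have := cost_le G A; rewrite sum_degree; lia. Qed.

Variables (T U : finType) (G : sgraph T) (H : sgraph U) (c q r : nat).
Local Notation n := #|U|.
Hypothesis Hp : profile n c (cost H).
Hypothesis cov : covered H G.
Hypothesis TN : #|T| = q * n + r.
Hypothesis tot : inner_pairs G [set: T] = cover_cost n c (cost H) #|T|.

(** Deleting two vertices of minimum degree would cost at most twice [cost H 1], against the strict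
    inequality [profile_small] at 2. *)
Lemma min_degree_unique u v : 2 * degree H u <= cost H 1 ->
  2 * degree H v <= cost H 1 -> u = v.
Proof.
move=> hu hv; apply/eqP/negPn/negP => uv.
have c2 := profile_ge2 Hp.
have := @profile_small _ _ _ Hp 2 ltac:(lia).
have := cost_le_degrees H [set u; v]; rewrite cards2 uv.
rewrite big_setU1 ?inE // big_set1 /=; lia.
Qed.

Lemma bigcup_pairs (P : 'I_q -> {set T}) (B : {set T}) :
  (forall i j, i != j -> [disjoint P i & P j]) ->
  pairs_between G (\bigcup_i P i) B = \sum_i pairs_between G (P i) B.
Proof. by move=> d; rewrite /pairs_between partition_disjoint_bigcup. Qed.

Lemma bigcup_inner_pairs (P : 'I_q -> {set T}) :
  (forall i j, i != j -> [disjoint P i & P j]) ->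
  inner_pairs G (\bigcup_i P i) = \sum_i \sum_j pairs_between G (P i) (P j).
Proof.
move=> d; rewrite /inner_pairs bigcup_pairs //; apply: eq_bigr => i _.
by rewrite pairs_betweenC bigcup_pairs //; apply: eq_bigr => j _; rewrite pairs_betweenC.
Qed.

(** Tightness leaves exactly [q] times the edges of [H] for the [q] copies, and each copy already
    needs its share. Hence all copies are induced, no edges run between them, and each single copy
    is tight as well. *)
Lemma tight_family_exact (h : 'I_q -> U -> T) :
  (forall i, copy_in H G (h i)) ->
  (forall i j, i != j -> [disjoint h i @: [set: U] & h j @: [set: U]]) ->
  tight G H c (\bigcup_i h i @: [set: U]) ->
  #|~: (\bigcup_i h i @: [set: U])| = r -> r < n ->
  [/\ inner_pairs G (\bigcup_i h i @: [set: U]) = q * inner_pairs H [set: U],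
      forall i, inner_pairs G (h i @: [set: U]) = inner_pairs H [set: U],
      forall i x y, adj G (h i x) (h i y) = adj H x y,
      forall i j x y, i != j -> adj G (h i x) (h j y) = false &
      forall i, tight G H c (h i @: [set: U])].
Proof.
move=> hc hd ht hr rn; set P := fun i => h i @: [set: U].
have cTr : cover_cost n c (cost H) #|T| = q * inner_pairs H [set: U] +
    cover_cost n c (cost H) r by rewrite TN (cover_costDn Hp) cost_card.
have D : inner_pairs G (\bigcup_i P i) = q * inner_pairs H [set: U].
  by move: ht; rewrite /tight hr tot cTr /P; lia.
have ge i : inner_pairs H [set: U] <= pairs_between G (P i) (P i).
  exact: pairs_between_copy.
have E := D; rewrite bigcup_inner_pairs // in E.
have E1 : \sum_(i in [set: 'I_q]) \sum_j pairs_between G (P i) (P j) <=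
          \sum_(i in [set: 'I_q]) inner_pairs H [set: U].
  under [X in X <= _]eq_bigl => i do rewrite inE.
  by rewrite E sum_nat_const cardsT card_ord.
have E2 i : \sum_j pairs_between G (P i) (P j) = inner_pairs H [set: U].
  apply: (sum_tight _ E1); last by rewrite inE.
  by move=> j _; rewrite (bigD1 j) //=; apply: leq_trans (ge j) _; apply: leq_addr.
have E3 i : pairs_between G (P i) (P i) = inner_pairs H [set: U].
  by have := E2 i; rewrite (bigD1 i) //=; have := ge i; lia.
have E4 i j : i != j -> pairs_between G (P i) (P j) = 0.
  move=> ij; have := E2 i; rewrite (bigD1 i) //= E3 (bigD1 j) /=; last by rewrite eq_sym.
  lia.
split=> //.
- move=> i x y; have le : inner_pairs G (h i @: [set: U]) <= inner_pairs H [set: U].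
    by rewrite [inner_pairs G _]E3.
  by apply: (copy_exact (hc i) le); rewrite inE.
- by move=> i j x y ij; apply: (pairs_between_eq0 (E4 i j ij)); apply: imset_f.
- move=> i; rewrite /tight -/(P i) [inner_pairs G (P i)]E3 tot cTr.
  have : #|P i| = n by rewrite /P card_imset ?cardsT //; exact: (hc i).1.
  have := cardsC (P i); rewrite TN => h1 h2.
  have q0 : 0 < q by apply: leq_ltn_trans (ltn_ord i).
  have -> : #|~: P i| = q.-1 * n + r by case: (q) q0 h1 => // q' _; rewrite mulSn; lia.
  by rewrite (cover_costDn Hp) cost_card; case: (q) q0 => // q' _; rewrite mulSn; lia.
Qed.

(** [core i] is the image of [H] without its vertex of minimum degree, and [comp] assigns to each
    vertex the copy it belongs to or whose core it completes. The point is that each of the [r]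
    remaining vertices replaces the minimum degree vertex of one copy. *)
Lemma elementary_structure : r <= c -> exists (core : 'I_q -> {set T}) (comp : T -> 'I_q),
  [/\ forall i, #|core i| = n.-1,
      forall i x, x \in core i -> comp x = i,
      forall x y, adj G x y -> comp x = comp y,
      forall i, n <= #|[set x | comp x == i]| &
      forall x, x \notin core (comp x) -> exists f : U -> T,
        [/\ injective f, f @: [set: U] = x |: core (comp x) &
            forall u v, adj G (f u) (f v) = adj H u v]].
Proof.
move=> rc; have hn := profile_half Hp; have c2 := profile_ge2 Hp.
have rn : r < n by lia.
have gr : good_residue c (cost H) r by rewrite /good_residue rc !orbT.
have [h [hc hd ht hr]] := tight_family Hp cov TN (tight0 erefl tot) rn gr.
have [D hF hadj hcross hti] := tight_family_exact hc hd ht hr rn.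
set U0 := \bigcup_i _ in ht hr D.
have [u0 u0d] : exists u, cost H 1 = 2 * degree H u by apply: cost1_ex; lia.
have phir : cover_cost n c (cost H) r = r * cost H 1.
  by rewrite (cover_cost_lt _ _ rn) /rest_cost rc.

have hU i x : h i x \in U0 by apply/bigcupP; exists i => //; apply: imset_f.
have iP x : x \in U0 -> exists i, x \in h i @: [set: U] by case/bigcupP => i _; exists i.
have deltale v : cost H 1 <= 2 * degree H v := cost1_le H v.
(* A copy through an uncovered vertex [v] brings only [v], both relative to [U0] and relative to a
   single one of the [q] copies that it meets. So it exchanges one vertex [h i w] of that copy for
   [v]. *)
have extra v : v \notin U0 -> exists i f w,
    [/\ copy_in H G f, f @: [set: U] = v |: (h i @: [set: U] :\ h i w) &
        exists a, f a = v].
  move=> vU; have [f [fc /codomP[a va]]] := cov v.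
  have r0 : 0 < r by rewrite -hr; apply/card_gt0P; exists v; rewrite inE.
  have nvi i : v \notin h i @: [set: U].
    by apply: contra vU => /imsetP[z _ ->].
  have vf : v \in f @: [set: U] by rewrite va imset_f.
  have [_] := tight_copy Hp cov ht fc.
  rewrite hr modn_small // => /(_ gr).
  set x := #|_ :\: _| => tx.
  have x0 : 0 < x by apply/card_gt0P; exists v; rewrite inE vU.
  have xr : x <= r by rewrite -hr; apply/subset_leq_card/subsetP => y; rewrite !inE => /andP[].
  have x1 : x = 1 by move: tx; rewrite /tight_step; lia.
  have [i im] : exists i, ~~ [disjoint f @: [set: U] & h i @: [set: U]].
    have : 0 < #|f @: [set: U] :&: U0|.
      have := cardsID U0 (f @: [set: U]); rewrite -/x x1 card_imset ?cardsT; [lia|exact: fc.1].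
    move=> /card_gt0P[y]; rewrite inE => /andP[yf /iP[i yi]]; exists i.
    by apply/pred0Pn; exists y; rewrite /= yf yi.
  have [_] := tight_copy Hp cov (hti i) fc.
  have -> : #|~: (h i @: [set: U])| %% n = r.
    have : #|h i @: [set: U]| = n by rewrite card_imset ?cardsT //; exact: (hc i).1.
    have := cardsC (h i @: [set: U]); rewrite TN => h1 h2.
    have q0 : 0 < q by apply: leq_ltn_trans (ltn_ord i).
    have -> : #|~: (h i @: [set: U])| = q.-1 * n + r.
      by case: (q) q0 h1 => // q' _; rewrite mulSn; lia.
    by rewrite modnMDl modn_small.
  move=> /(_ gr); set y := #|_ :\: _| => ty.
  have y0 : 0 < y by apply/card_gt0P; exists v; rewrite inE nvi.
  have fn : #|f @: [set: U]| = n by rewrite card_imset ?cardsT //; exact: fc.1.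
  have yn : y != n.
    move: im; apply: contra => /eqP yn; rewrite -setI_eq0 -cards_eq0.
    by have := cardsID (h i @: [set: U]) (f @: [set: U]); rewrite -/y fn; lia.
  have y1 : y = 1 by move: ty; rewrite /tight_step; lia.
  have fD : f @: [set: U] :\: (h i @: [set: U]) = [set v].
    move/eqP/cards1P: y1 => [z E]; rewrite E; congr [set _].
    by apply/esym/eqP; rewrite -in_set1 -E !inE nvi.
  have cI : #|f @: [set: U] :&: h i @: [set: U]| = n.-1.
    by have := cardsID (h i @: [set: U]) (f @: [set: U]); rewrite -/y fn; lia.
  have hin : #|h i @: [set: U]| = n by rewrite card_imset ?cardsT //; exact: (hc i).1.
  have /cards1P[w' ww] : #|h i @: [set: U] :\: f @: [set: U]| == 1.
    by have := cardsID (f @: [set: U]) (h i @: [set: U]); rewrite setIC cI hin; lia.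
  have /imsetP[w _ Ew] : w' \in h i @: [set: U].
    by have := set11 w'; rewrite -ww inE => /andP[].
  exists i, f, w; split=> //; last by exists a.
  apply/setP => z; have := congr1 (fun A : {set T} => z \in A) fD.
  have := congr1 (fun A : {set T} => z \in A) ww; rewrite -Ew !inE.
  by case: (z \in h i @: _); case: (z \in f @: _); case: (z == v); case: (z == w').
have tot' : inner_pairs G [set: T] = q * inner_pairs H [set: U] + r * cost H 1.
  by rewrite tot TN (cover_costDn Hp) cost_card phir.
have PI i : h i @: [set: U] \subset U0 by apply: (bigcup_sup i).
have split0 := inner_pairs_split G U0.
have sumW : \sum_(v in ~: U0) 2 * pairs_between G [set v] U0 =
    2 * pairs_between G U0 (~: U0).
  by rewrite -big_distrr /= -pairs_between_sum pairs_betweenC.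
have sumC : \sum_(v in ~: U0) cost H 1 = r * cost H 1 by rewrite sum_nat_const hr.
(* Each uncovered vertex has at least the minimum degree towards [U0]. The budget [r * cost H 1]
   allows no more than that, and no edges among the uncovered vertices. *)
have geW v : v \in ~: U0 -> cost H 1 <= 2 * pairs_between G [set v] U0.
  rewrite inE => vU; have [i [f [w [fc fE [a fa]]]]] := extra v vU.
  apply: leq_trans (deltale a) _; rewrite leq_mul2l /=.
  apply: leq_trans (degree_copy a fc) _; rewrite fa fE; apply: leq_pairs_between => //.
  by rewrite subDset setUS // (subset_trans (subsetDl _ _) (PI i)).
have eqW v : v \in ~: U0 -> 2 * pairs_between G [set v] U0 = cost H 1.
  apply: (@sum_tight _ (~: U0) (fun=> cost H 1) (fun v => 2 * pairs_between G [set v] U0)) => //.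
  by rewrite sumW sumC; lia.
have W0 : inner_pairs G (~: U0) = 0.
  have : \sum_(v in ~: U0) cost H 1 <= \sum_(v in ~: U0) 2 * pairs_between G [set v] U0.
    exact: leq_sum.
  by rewrite sumW sumC; lia.
have extra' v : v \notin U0 -> exists i f,
    [/\ injective f, f @: [set: U] = v |: (h i @: [set: U] :\ h i u0),
        forall x y, adj G (f x) (f y) = adj H x y &
        forall y, y \in U0 -> y \notin h i @: [set: U] -> adj G v y = false].
  move=> vU; have [i [f [w [fc fE [a fa]]]]] := extra v vU.
  set S := h i @: [set: U] :\ h i w in fE.
  have SU : S \subset U0 by apply: subset_trans (subsetDl _ _) (PI i).
  have vS : v \notin S by apply: contra vU; apply: (subsetP SU).
  have fD : f @: [set: U] :\ v = S by rewrite fE setU1K.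
  have vf : v \in f @: [set: U] by rewrite fE setU11.
  have d1 := degree_copy a fc; rewrite fa fD in d1.
  have d2 : pairs_between G [set v] S <= pairs_between G [set v] U0.
    by apply: leq_pairs_between.
  have d3 := eqW v; rewrite inE vU in d3; have {}d3 := d3 isT.
  have da := deltale a.
  have D1 := inner_pairsD1 G vf; rewrite fD in D1.
  have hw : h i w \in h i @: [set: U] by apply: imset_f.
  have D2 := inner_pairsD1 G hw; rewrite -/S hF in D2.
  have dw := degree_copy w (hc i); rewrite -/S in dw.
  have D3 : inner_pairs H [set: U] <= inner_pairs G (f @: [set: U]).
    exact: pairs_between_copy.
  have dl := deltale w.
  (* Exchanging [h i w] for [v] loses at least the degree of [w] and gains at most the minimum
     degree, so [w] has minimum degree. *)
  have wu : w = u0 by apply: min_degree_unique; lia.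
  have le : inner_pairs G (f @: [set: U]) <= inner_pairs H [set: U] by lia.
  exists i, f; split; first exact: fc.1.
  - by rewrite fE /S wu.
  - by move=> x y; apply: (copy_exact fc le); rewrite inE.
  - move=> y yU yP; have yS : y \notin S by rewrite !inE (negbTE yP) andbF.
    have : pairs_between G [set v] (y |: S) <= pairs_between G [set v] U0.
      by apply: leq_pairs_between; rewrite // subUset sub1set yU.
    rewrite pairs_betweenUr ?disjoints1 // {1}/pairs_between !big_set1.
    by case: adj => //; lia.
pose core i := h i @: [set: U] :\ h i u0.
pose good x i := x \in h i @: [set: U] \/ x \notin U0 /\ exists f,
    [/\ injective f, f @: [set: U] = x |: core i,
        forall x y, adj G (f x) (f y) = adj H x y &
        forall y, y \in U0 -> y \notin h i @: [set: U] -> adj G x y = false].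
have /fin_all_exists[comp compP] x : exists i, good x i.
  case: (boolP (x \in U0)) => [/iP[i]|xU]; first by exists i; left.
  by have [i [f fP]] := extra' x xU; exists i; right; split=> //; exists f.
have comph i a : comp (h i a) = i.
  case: (compP (h i a)) => [hin|[]]; last by rewrite hU.
  apply/eqP/negPn/negP => /hd /pred0P/(_ (h i a)) /=.
  by rewrite hin imset_f.
exists core, comp; split.
- move=> i; have hi : h i u0 \in h i @: [set: U] by apply: imset_f.
  by have := cardsD1 (h i u0) (h i @: [set: U]); rewrite hi card_imset ?cardsT -/(core i); [lia|exact: (hc i).1].
- by move=> i x /setD1P[_ /imsetP[a _ ->]].
- have key x y : x \notin U0 -> y \in U0 -> adj G x y -> comp x = comp y.
    move=> xU yU; case: (compP x) => [/imsetP[a _ E]|[_ [f [_ _ _ h0]]]].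
      by rewrite E hU in xU.
    case: (boolP (y \in h (comp x) @: [set: U])) => [/imsetP[a _ ->] _|yP]; first by rewrite comph.
    by rewrite h0.
  move=> x y xy; case: (boolP (x \in U0)) => xU; case: (boolP (y \in U0)) => yU.
  + move: xy; case: (iP _ xU) => i /imsetP[a _ ->]; case: (iP _ yU) => j /imsetP[b _ ->].
    rewrite !comph; have [->//|ij] := eqVneq i j; by rewrite hcross.
  + by apply/esym/key => //; rewrite adjC.
  + exact: key.
  + by move: xy; rewrite (pairs_between_eq0 W0) // inE.
- move=> i; rewrite -[n]cardsT -(card_imset _ (hc i).1); apply/subset_leq_card/subsetP.
  by move=> x /imsetP[a _ ->]; rewrite inE comph.
- move=> x xc; case: (compP x) => [/imsetP[a _ E]|[_ [f [fI fE fh _]]]]; last by exists f.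
  have a0 : a = u0.
    apply/eqP/negPn/negP => au; move: xc; rewrite E comph !inE imset_f // andbT.
    by rewrite (inj_eq (hc (comp x)).1) au.
  exists (h (comp x)); split=> //; first exact: (hc (comp x)).1.
  have hi : h (comp x) u0 \in h (comp x) @: [set: U] by apply: imset_f.
  by rewrite {2}E a0 /core setD1K.
Qed.
End ElementaryStructure.

Section ElementaryCharacterization.
Local Open Scope nat_scope.

(** Listing [A] before the rest of [B] matches the convention of [Mcond], where the common part of
    the copies consists of the first indices. With [A] empty this is a plain enumeration. *)
Lemma enum_split (T : finType) (A B : {set T}) m : A \subset B -> #|B| = m ->
  exists s : 'I_m -> T, [/\ injective s, s @: [set: 'I_m] = B &
    forall j, (s j \in A) = (j < #|A|)].
Proof.
move=> AB; case: m => [|m] Bm.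
  have no (j : 'I_0) : False by case: j.
  exists (fun j => match no j with end); split=> [[]//||[]//].
  rewrite (cards0_eq Bm); apply/setP => x; rewrite inE; apply/negP => /imsetP[] [] //.
have [x0 _] : exists x0, x0 \in B by apply/card_gt0P; rewrite Bm.
pose l := enum A ++ enum (B :\: A).
have lu : uniq l.
  rewrite cat_uniq !enum_uniq andbT /=; apply/hasPn => x.
  by rewrite !mem_enum !inE => /andP[].
have lm x : (x \in l) = (x \in B).
  rewrite mem_cat !mem_enum inE; case: (boolP (x \in A)) => //= xA.
  by rewrite (subsetP AB _ xA).
have ls : size l = m.+1.
  by rewrite -Bm cardE; apply/perm_size/uniq_perm; rewrite ?enum_uniq // => x; rewrite lm mem_enum.
exists (fun j => nth x0 l j); split.
- by move=> i j /eqP; rewrite nth_uniq ?ls // => /eqP /val_inj.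
- apply/setP => x; apply/imsetP/idP => [[j _ ->]|].
    by rewrite -lm mem_nth ?ls.
  rewrite -lm => xl; have il : index x l < m.+1 by rewrite -ls index_mem.
  by exists (Ordinal il); rewrite ?inE //= nth_index.
- move=> j; rewrite nth_cat -cardE; case: ltnP => jA.
    by rewrite -mem_enum mem_nth // -cardE.
  have : nth x0 (enum (B :\: A)) (j - #|A|) \in enum (B :\: A).
    apply: mem_nth; have := ltn_ord j; have := ls; rewrite size_cat -!cardE; lia.
  by rewrite mem_enum inE => /andP[/negbTE].
Qed.

Lemma ord_model (T : finType) (G : sgraph T) N : #|T| = N ->
  exists G' : sgraph 'I_N, isomorphic G G'.
Proof.
move=> TN; have [s [sI sE _]] := @enum_split T set0 [set: T] N (sub0set _) ltac:(by rewrite cardsT).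
exists (pull G s); apply: isomorphic_sym; exists s.
  by apply: inj_card_bij; rewrite // TN card_ord.
by move=> x y; rewrite pull_adj.
Qed.

Lemma inj_surj_bij (T S : finType) (f : S -> T) : injective f ->
  f @: [set: S] = [set: T] -> bijective f.
Proof.
move=> fI fS; apply: inj_card_bij; rewrite // -[#|T|]cardsT -fS -[X in _ <= X]cardsT.
exact: leq_imset_card.
Qed.

Section Optimum.
Variables (n c : nat) (H : sgraph 'I_n).
Hypothesis Hp : profile n c (cost H).

Let Hp' : profile #|'I_n| c (cost H). Proof. by rewrite card_ord. Qed.

Lemma covered_ge (T : finType) (G : sgraph T) : covered H G ->
  cover_cost n c (cost H) #|T| <= 2 * nb_edges G.
Proof.
move=> cov; have := cover_lower Hp' cov set0.
by rewrite inner_pairs0 setC0 cardsT card_ord inner_pairsT2.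
Qed.

(** A covered block on [n + r] vertices with the right number of edges, together with [q - 1] copies
    of [H], attains the lower bound. Minimality thereby becomes an equation for the number of
    edges. *)
Lemma optimum_of_block (X : finType) (B : sgraph X) r q : r < n -> 0 < q ->
  #|X| = n + r -> covered H B ->
  2 * nb_edges B = cost H n + rest_cost c (cost H) r ->
  forall G : sgraph 'I_(q * n + r), edge_minimal H G <->
  covered H G /\ 2 * nb_edges G = cover_cost n c (cost H) (q * n + r).
Proof.
move=> rn q0 Xn cB eB G.
have eH : 2 * nb_edges H = cost H n by rewrite nb_edges_cost card_ord.
have [G0 iso0] : exists G0 : sgraph 'I_(q * n + r),
    isomorphic (dunion2 B (dunion (fun _ : 'I_q.-1 => H))) G0.
  apply: ord_model; rewrite card_sum Xn card_tagged.
  rewrite sumnE big_map big_enum /= sum_nat_const !card_ord.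
  case: (q) q0 => // q' _; rewrite mulSn /=; lia.
have cG0 : covered H G0.
  apply: (covered_iso iso0); apply: dunion2_covered => //.
  by apply: dunion_covered => _; apply: covered_refl.
have eG0 : 2 * nb_edges G0 = cover_cost n c (cost H) (q * n + r).
  rewrite -(isomorphic_nb_edges iso0) dunion2_nb_edges dunion_nb_edges sum_nat_const card_ord.
  rewrite (cover_costDn Hp) (cover_cost_lt _ _ rn); case: (q) q0 => // q' _; rewrite mulSn /=.
  by nia.
split=> [[cG mG]|[cG eG]].
  split=> //; have := covered_ge cG; have := mG _ cG0; rewrite card_ord; lia.
split=> // G' cG'; have := covered_ge cG'; rewrite card_ord; lia.
Qed.

Lemma Mcond_lower M (G : sgraph 'I_M) : n <= M -> M <= n + c -> Mcond H G ->
  cost H n + (M - n) * cost H 1 <= 2 * nb_edges G.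
Proof.
move=> nM Mc /Mcond_covered h; have hn := profile_half Hp.
have := covered_ge (h ltac:(lia) nM); rewrite card_ord.
have {1}-> : M = 1 * n + (M - n) by lia.
rewrite (cover_costDn Hp) mul1n (cover_cost_lt _ _ (x := M - n)) /rest_cost; [|lia].
by case: ifP => //; lia.
Qed.

(** The graph is the pull-back of [H] along a map that sends all indices from [n.-1] on to one
    vertex [u0] of minimum degree. The clones are independent, and each contributes [cost H 1] to
    the doubled count. *)
Lemma clone_exists M : n <= M -> exists G : sgraph 'I_M,
  Mcond H G /\ 2 * nb_edges G = cost H n + (M - n) * cost H 1.
Proof.
move=> nM; have hn := profile_half Hp; have n0 : 0 < n by lia.
have [u0 u0d] : exists u, cost H 1 = 2 * degree H u by apply: cost1_ex; rewrite card_ord.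
have [s [sI sE sA]] := @enum_split _ (~: [set u0]) [set: 'I_n] n (subsetT _) ltac:(by rewrite cardsT card_ord).
have cA : #|~: [set u0]| = n.-1 by have := cardsC [set u0]; rewrite cards1 card_ord; lia.
rewrite cA in sA.
have lt_pn : n.-1 < n by lia.
have slast : s (Ordinal lt_pn) = u0.
  by apply/eqP; have := sA (Ordinal lt_pn); rewrite /= ltnn !inE => /negbFE.
have lt_min (j : 'I_M) : minn j n.-1 < n by lia.
(* Truncating at [n.-1] collapses the last indices, and the enumeration [s] lists [u0] last. *)
pose p (j : 'I_M) : 'I_n := s (Ordinal (lt_min j)).
have p_rest (j : 'I_M) : n.-1 <= j -> p j = u0.
  by move=> nj; rewrite /p -slast; congr s; apply: val_inj => /=; lia.
exists (pull H p).
have copy (i : 'I_M) : n.-1 <= i -> exists f : 'I_n -> 'I_M,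
    [/\ injective f, f @: [set: 'I_n] = i |: [set j : 'I_M | j < n.-1],
      f u0 = i & forall x, p (f x) = x].
  move=> ni.
  have h (x : 'I_n) : exists j : 'I_M, p j = x /\ ((j == i) || (j < n.-1)).
    have /imsetP[k _ ->] : x \in s @: [set: 'I_n] by rewrite sE inE.
    have [kl|kl] := ltnP k n.-1.
      have kM : k < M by have := ltn_ord k; lia.
      exists (Ordinal kM); rewrite /= kl orbT; split=> //; congr s; apply: val_inj => /=.
      by rewrite /minn kl.
    exists i; rewrite eqxx p_rest //; split=> //; rewrite -slast; congr s.
    by apply: val_inj => /=; have := ltn_ord k; lia.
  have [f fP] := fin_all_exists h.
  have pf x : p (f x) = x by case: (fP x).
  have fI : injective f by apply: can_inj pf.
  have sub : f @: [set: 'I_n] \subset i |: [set j : 'I_M | j < n.-1].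
    by apply/subsetP => y /imsetP[x _ ->]; rewrite !inE; case: (fP x).
  exists f; split=> //.
    apply/eqP; rewrite eqEcard sub /= card_imset // cardsT card_ord cardsU1 inE ltnNge ni /=.
    have : #|[set j : 'I_M | j < n.-1]| <= n.-1.
      rewrite -[X in _ <= X]card_ord -cardsT.
      have lt_M (k : 'I_n.-1) : k < M by have := ltn_ord k; lia.
      apply: leq_trans (leq_imset_card (fun k : 'I_n.-1 => Ordinal (lt_M k)) _).
      apply/subset_leq_card/subsetP => j; rewrite inE => jn.
      by apply/imsetP; exists (Ordinal jn) => //; apply: val_inj.
    by move=> h1; rewrite add1n; apply: leq_ltn_trans h1 lt_pn.
  have [_ /orP[/eqP//|lt]] := fP u0.
  have := pf u0; rewrite /p => E; have := sA (Ordinal (lt_min (f u0))).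
  by rewrite E !inE eqxx /= /minn lt lt.
split.
  move=> i ni; have [f [fI fE _ pf]] := copy i ni.
  by apply: (isomorphic_induced fI fE) => x y; rewrite pull_adj !pf.
pose C := [set j : 'I_M | j < n.-1].
have RC : #|~: C| = M - n + 1.
  have lt_M : n.-1 < M by lia.
  have [f [fI fE _ _]] := copy (Ordinal lt_M) (leqnn _).
  have := card_imset [set: 'I_n] fI; rewrite fE -/C cardsU1 cardsT card_ord inE /= ltnn /= => h.
  have := cardsC C; rewrite card_ord => h'.
  have {}h : #|C| = n.-1 by rewrite -[n]h.
  have -> : #|~: C| = M - n.-1 by apply/eqP; rewrite -(eqn_add2l #|C|) h' h; lia.
  lia.
have R0 : inner_pairs (pull H p) (~: C) = 0.
  rewrite /inner_pairs /pairs_between; apply: big1 => x; rewrite !inE -leqNgt => xn.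
  by apply: big1 => y; rewrite !inE -leqNgt => yn; rewrite pull_adj !p_rest // adjxx.
have one i : i \in ~: C -> inner_pairs (pull H p) C = cost H n - cost H 1 /\
    2 * pairs_between (pull H p) [set i] C = cost H 1.
  rewrite !inE -leqNgt => ni; have [f [fI fE fu pf]] := copy i ni.
  have fh x y : adj (pull H p) (f x) (f y) = adj H x y by rewrite pull_adj !pf.
  have e1 := pairs_between_iso [set: 'I_n] [set: 'I_n] fI fh.
  have iC : i \notin C by rewrite inE -leqNgt.
  have fC : f @: (~: [set u0]) = C.
    have iD : i \notin f @: (~: [set u0]).
      by rewrite -fu mem_imset // !inE eqxx.
    rewrite -(setU1K iD) -(setU1K iC); congr (_ :\ _).
    by rewrite -fE -(setUCr [set u0]) imsetU imset_set1 fu.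
  have e2 := pairs_between_iso (~: [set u0]) (~: [set u0]) fI fh.
  have e3 := inner_pairsC1 H u0.
  have e4 : inner_pairs H [set: 'I_n] = cost H n by rewrite -cost_card card_ord.
  have e5 : inner_pairs (pull H p) (i |: C) = inner_pairs H [set: 'I_n] by rewrite -fE.
  rewrite inner_pairsU ?disjoints1 // inner_pairs1 in e5.
  have e6 : inner_pairs (pull H p) C = inner_pairs H (~: [set u0]) by rewrite /inner_pairs -e2 fC.
  lia.
rewrite -inner_pairsT2 (inner_pairs_split _ C) R0 pairs_betweenC pairs_between_sum big_distrr /=.
rewrite (eq_bigr (fun=> cost H 1)); last by move=> i /one[].
rewrite sum_nat_const RC.
have [i iC] : exists i, i \in ~: C by apply/card_gt0P; lia.
have [-> _] := one i iC; rewrite mulnDl mul1n.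
have e4 : inner_pairs H [set: 'I_n] = cost H n by rewrite -cost_card card_ord.
by have := inner_pairsC1 H u0; lia.
Qed.
End Optimum.

(** Both directions go through the edge count [opt]. A minimal graph splits into the classes of
    [comp]; conversely, a member of [Mclass] has at most as many edges as the graph made of clones,
    so the union attains the minimum. *)
Lemma profile_elementary n c (H : sgraph 'I_n) r : profile n c (cost H) -> r <= c ->
  elementary H r.
Proof.
move=> Hp rc q q0 G; have hn := profile_half Hp; have c2 := profile_ge2 Hp.
have rn : r < n by lia.
have Hp' : profile #|'I_n| c (cost H) by rewrite card_ord.
have cT : cover_cost n c (cost H) (q * n + r) = q * cost H n + r * cost H 1.
  by rewrite (cover_costDn Hp) (cover_cost_lt _ _ rn) /rest_cost rc.
have opt : edge_minimal H G <-> covered H G /\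
    2 * nb_edges G = cover_cost n c (cost H) (q * n + r).
  have [B [mB eB]] := clone_exists Hp (leq_addr r n).
  apply: (optimum_of_block Hp (B := B)); rewrite ?card_ord //.
    by apply: (Mcond_covered _ _ mB); lia.
  by rewrite eB /rest_cost rc; congr (_ + _ * _); lia.
(* The excesses [b i - n] add up to [r], so each of them is at most [r], hence at most [c], where
   [Mcond_lower] is available. *)
have bsum (b : 'I_q -> nat) : (forall i, n <= b i) -> \sum_i b i = q * n + r ->
    \sum_i (cost H n + (b i - n) * cost H 1) = q * cost H n + r * cost H 1 /\
    forall i, b i <= n + r.
  move=> bn bs; have bs' : \sum_i (b i - n) = r.
    have : \sum_i (b i - n + n) = q * n + r by rewrite -bs; apply: eq_bigr => i _; rewrite subnK.
    by rewrite big_split /= sum_nat_const card_ord; lia.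
  split; first by rewrite big_split /= sum_nat_const card_ord -big_distrl /= bs'.
  by move=> i; have := bs'; rewrite (bigD1 i) //=; lia.
split.
- move/opt => [cG eG].
  have [core [comp [cc cin ce cn cx]]] := elementary_structure Hp' cG
    (etrans (card_ord _) (congr1 (fun k => q * k + r) (esym (card_ord n)))) ltac:(by rewrite inner_pairsT2 eG !card_ord) rc.
  pose cl i := [set x | comp x == i].
  pose b i := #|cl i|.
  have sub i : core i \subset cl i by apply/subsetP => x /cin; rewrite inE => /eqP.
  have /fin_all_exists[s sP] i := enum_split (sub i) (erefl (b i)).
  pose F i := pull G (s i).
  have sc i j : comp (s i j) = i.
    by have [_ sE _] := sP i; have : s i j \in cl i; [rewrite -sE imset_f|rewrite inE => /eqP].
  have iso : isomorphic G (dunion F).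
    apply: isomorphic_sym; exists (fun x : {i : 'I_q & 'I_(b i)} => s (tag x) (tagged x)).
      apply: inj_surj_bij.
        move=> [i x] [j y] /= E; have ij : i = j by rewrite -(sc i x) -(sc j y) E.
        by subst j; case: (sP i) => sI _ _; rewrite (sI _ _ E).
      apply/setP => x; rewrite !inE; have [_ sE _] := sP (comp x).
      have : x \in cl (comp x) by rewrite inE.
      by rewrite -sE => /imsetP[j _ E]; apply/imsetP; exists (Tagged (fun i => 'I_(b i)) j).
    move=> [i x] [j y] /=; have [ij|ij] := eqVneq i j.
      by subst j; rewrite (dunion_adj F x y) pull_adj.
    have -> : adj (dunion F) (existT _ i x) (existT _ j y) = false.
      by apply/negbTE/negP => /dunion_adj_tag /= E; rewrite E eqxx in ij.
    by apply/negbTE/negP => /ce; rewrite !sc => E; rewrite E eqxx in ij.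
  have bn i : n <= b i by have := cn i; rewrite card_ord.
  have bs : \sum_i b i = q * n + r.
    have [f fb _] := iso; have := bij_eq_card fb.
    rewrite card_ord card_tagged sumnE big_map big_enum /= => ->.
    by apply: eq_bigr => i _; rewrite card_ord.
  have [bE ble] := bsum b bn bs.
  have mc i : Mcond H (F i).
    move=> j nj; have [sI sE sA] := sP i.
    have jc : s i j \notin core (comp (s i j)) by rewrite sc sA cc card_ord -leqNgt.
    have [f [fI fE fh]] := cx _ jc; rewrite sc in fE.
    have imE : f @: [set: 'I_n] = s i @: (j |: [set k : 'I_(b i) | k < n.-1]).
      rewrite fE imsetU1; congr (_ |: _); apply/setP => x; apply/idP/imsetP => [xc|[k]].
        have : x \in cl i := subsetP (sub i) _ xc.
        rewrite -sE => /imsetP[k _ E]; exists k => //.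
        by rewrite inE; move: xc; rewrite E sA cc card_ord.
      by rewrite inE => kn ->; rewrite sA cc card_ord.
    have pre x : exists k, s i k = f x.
      have : f x \in f @: [set: 'I_n] by apply: imset_f.
      by rewrite imE => /imsetP[k _ ->]; exists k.
    have [g gP] := fin_all_exists pre.
    apply: (@isomorphic_induced _ _ _ _ _ g).
    + by move=> x y E; apply: fI; rewrite -!gP E.
    + apply: (imset_inj sI); rewrite -imE -imset_comp; apply: eq_imset => x; exact: gP.
    + by move=> x y; rewrite pull_adj !gP.
  exists b, F; split=> // [i|i]; first by rewrite bn /=; have := ble i; lia.
  split=> // G' mG'.
  (* The total equals the sum of the lower bounds for the parts, so each part attains its own. *)
  have le k : k \in [set: 'I_q] -> cost H n + (b k - n) * cost H 1 <= 2 * nb_edges (F k).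
    by move=> _; apply: (Mcond_lower Hp) => //; have := ble k; lia.
  have := sum_tight le; rewrite -big_distrr /=.
  under eq_bigl => k do rewrite inE.
  under [X in _ <= X -> _]eq_bigl => k do rewrite inE.
  rewrite -dunion_nb_edges -(isomorphic_nb_edges iso) eG cT bE leqnn => /(_ isT i (in_setT i)) E.
  have le2 : b i <= n + c by have := ble i; lia.
  by have := Mcond_lower Hp (bn i) le2 mG'; rewrite -E leq_mul2l.
- move=> [b [F [bn mF bs iso]]]; apply/opt.
  have bn' i : n <= b i by case/andP: (bn i).
  have cG : covered H G.
    apply: (covered_iso (isomorphic_sym iso)); apply: dunion_covered => i.
    by case: (mF i) => mc _; apply: (Mcond_covered _ (bn' i) mc); lia.
  split=> //; have := covered_ge Hp cG; rewrite card_ord cT.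
  have [bE _] := bsum b bn' bs.
  suff : 2 * nb_edges G <= q * cost H n + r * cost H 1 by lia.
  rewrite (isomorphic_nb_edges iso) dunion_nb_edges big_distrr /= -bE.
  apply: leq_sum => i _; have [B [mB <-]] := clone_exists Hp (bn' i).
  by rewrite leq_mul2l /=; case: (mF i) => _; apply.
Qed.

End ElementaryCharacterization.

(** * The ideal range *)

Section IdealCharacterization.
Local Open Scope nat_scope.

Lemma isomorphic_pull_induced (T S U : finType) (G : sgraph T) (H : sgraph U)
  (s : S -> T) (B : {set S}) (f : U -> T) : injective s -> injective f ->
  f @: [set: U] = s @: B -> (forall x y, adj G (f x) (f y) = adj H x y) ->
  isomorphic (induced (pull G s) B) H.
Proof.
move=> sI fI imE fh.
have pre x : exists k, s k = f x.
  have : f x \in f @: [set: U] by apply: imset_f.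
  by rewrite imE => /imsetP[k _ ->]; exists k.
have [g gP] := fin_all_exists pre.
apply: (@isomorphic_induced _ _ _ _ _ g).
+ by move=> x y E; apply: fI; rewrite -!gP E.
+ apply: (imset_inj sI); rewrite -imE -imset_comp; apply: eq_imset => x; exact: gP.
+ by move=> x y; rewrite pull_adj !gP.
Qed.

Lemma imset_full (T S : finType) (f : S -> T) : f @: [set: S] = [set f x | x : S].
Proof. by apply/setP => z; apply/imsetP/imsetP => -[a _ ->]; exists a. Qed.

Lemma subgraph_dens (U : finType) (H : sgraph U) m (K : sgraph 'I_m) :
  is_subgraph K H -> 2 * nb_edges K <= dens H m.
Proof.
move=> [g gc]; rewrite -inner_pairsT2; apply: leq_trans (pairs_between_copy _ _ gc) _.
have := dens_ge H (g @: [set: 'I_m]).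
by rewrite card_imset ?cardsT ?card_ord //; exact: gc.1.
Qed.

Lemma pull_subgraph (T S : finType) (G : sgraph T) (s : S -> T) :
  injective s -> is_subgraph (pull G s) G.
Proof. by move=> sI; exists s; split=> // x y; rewrite pull_adj. Qed.

Lemma pull_nb_edges (T S : finType) (G : sgraph T) (s : S -> T) : injective s ->
  2 * nb_edges (pull G s) = inner_pairs G (s @: [set: S]).
Proof.
move=> sI; rewrite -inner_pairsT2 /inner_pairs.
by rewrite (pairs_between_iso _ _ sI (K := pull G s)) // => x y; rewrite pull_adj.
Qed.

(** Subgraphs need not be induced, but the image of one spans at least as many edges, so the maximum
    is that of induced subgraphs. *)
Lemma max_subgraph_dens (U : finType) (H : sgraph U) m (K : sgraph 'I_m) :
  m <= #|U| -> max_subgraph H K -> 2 * nb_edges K = dens H m.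
Proof.
move=> mU [sK mK]; have le := subgraph_dens sK.
have [A Am EA] := dens_ex H mU.
have [s [sI sE _]] := @enum_split _ set0 A m (sub0set _) Am.
apply/eqP; rewrite eqn_leq le -EA -sE -(pull_nb_edges H sI) leq_mul2l /=.
exact: mK (pull_subgraph H sI).
Qed.

Lemma dens_max_subgraph (U : finType) (H : sgraph U) m (s : 'I_m -> U) : injective s ->
  inner_pairs H (s @: [set: 'I_m]) = dens H m -> max_subgraph H (pull H s).
Proof.
move=> sI E; split; first exact: pull_subgraph.
by move=> K' /subgraph_dens; rewrite -E -(pull_nb_edges H sI) leq_mul2l.
Qed.

Section Lgraphs.
Variables (n r : nat) (H : sgraph 'I_n).
Hypothesis rn : r < n.

Lemma Lvert_cases (x : Lvert n r) :
  [|| x \in Lvert0 n r, x \in Lvert1 n r | x \in Lvert2 n r].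
Proof.
case: x => [[x|x]|x]; apply/or3P;
  [apply: Or31|apply: Or32|apply: Or33]; by apply: imset_f.
Qed.

Lemma Lvert_inE : ((forall x, ((inl (inl x) : Lvert n r) \in Lvert0 n r) = true) *
  (forall x, ((inl (inl x) : Lvert n r) \in Lvert1 n r) = false) *
  (forall x, ((inl (inl x) : Lvert n r) \in Lvert2 n r) = false) *
  (forall x, ((inl (inr x) : Lvert n r) \in Lvert0 n r) = false) *
  (forall x, ((inl (inr x) : Lvert n r) \in Lvert1 n r) = true) *
  (forall x, ((inl (inr x) : Lvert n r) \in Lvert2 n r) = false) *
  (forall x, ((inr x : Lvert n r) \in Lvert0 n r) = false) *
  (forall x, ((inr x : Lvert n r) \in Lvert1 n r) = false) *
  (forall x, ((inr x : Lvert n r) \in Lvert2 n r) = true))%type.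
Proof. by do 8 (split; last by move=> x; apply/imsetP; first [by exists x | by case]); move=> x; apply/imsetP; exists x. Qed.

Lemma card_Lvert : #|Lvert n r| = n + r.
Proof. by rewrite !card_sum !card_ord; lia. Qed.

(** Inclusion and exclusion: the two copies of [H] overlap in a densest set of [n - r] vertices, so
    the second one adds exactly [cost H r]. *)
Lemma Lclass_nb_edges (L : sgraph (Lvert n r)) : Lclass H L ->
  2 * nb_edges L = cost H n + cost H r.
Proof.
move=> [h12 [K mK iso0] iso1 iso2].
have [f1 [f1I f1E f1h]] := isomorphic_inducedP iso1.
have [f2 [f2I f2E f2h]] := isomorphic_inducedP iso2.
have [f0 [f0I f0E f0h]] := isomorphic_inducedP iso0.
have F : inner_pairs H [set: 'I_n] = cost H n by rewrite -cost_card card_ord.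
have e1 := pairs_between_iso [set: 'I_n] [set: 'I_n] f1I f1h; rewrite f1E -!/(inner_pairs _ _) F in e1.
have e2 := pairs_between_iso [set: 'I_n] [set: 'I_n] f2I f2h; rewrite f2E -!/(inner_pairs _ _) F in e2.
have e0 := pairs_between_iso _ _ f0I f0h; have {}e0 := e0 [set: _] [set: _].
rewrite f0E -!/(inner_pairs _ _) inner_pairsT2 in e0.
rewrite (max_subgraph_dens _ mK) ?card_ord ?leq_subr // in e0.
have d01 : [disjoint Lvert1 n r & Lvert0 n r].
  by apply/pred0P => -[[x|x]|x] /=; rewrite !Lvert_inE.
have d02 : [disjoint Lvert2 n r & Lvert0 n r].
  by apply/pred0P => -[[x|x]|x] /=; rewrite !Lvert_inE.
have d12 : [disjoint Lvert1 n r :|: Lvert0 n r & Lvert2 n r].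
  by apply/pred0P => -[[x|x]|x] /=; rewrite !inE !Lvert_inE.
have p12 : pairs_between L (Lvert1 n r) (Lvert2 n r) = 0.
  apply: big1 => x x1; apply: big1 => y y2; by rewrite (negbTE (h12 x y x1 y2)).
have ET : [set: Lvert n r] = (Lvert1 n r :|: Lvert0 n r) :|: Lvert2 n r.
  by apply/setP => -[[x|x]|x]; rewrite !inE !Lvert_inE.
rewrite inner_pairsU // in e2.
rewrite -inner_pairsT2 ET inner_pairsU // pairs_betweenUl // p12 e1.
have := @dens_cost _ H r; rewrite card_ord => /(_ (ltnW rn)).
have := @densT _ H; rewrite card_ord F pairs_betweenC; lia.
Qed.

Lemma Lclass_covered (L : sgraph (Lvert n r)) : Lclass H L -> covered H L.
Proof.
move=> [_ _ iso1 iso2] v.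
have [f1 [f1I f1E f1h]] := isomorphic_inducedP iso1.
have [f2 [f2I f2E f2h]] := isomorphic_inducedP iso2.
case: (boolP (v \in Lvert1 n r :|: Lvert0 n r)) => [|v2].
  rewrite -f1E => /imsetP[u _ ->]; exists f1; split; last exact: codom_f.
  by split=> // x y; rewrite f1h.
have : v \in Lvert2 n r :|: Lvert0 n r.
  by move: v2; rewrite !inE negb_or => /andP[/negbTE v1 /negbTE v0]; have := Lvert_cases v; rewrite v0 v1 /= orbF.
rewrite -f2E => /imsetP[u _ ->]; exists f2; split; last exact: codom_f.
by split=> // x y; rewrite f2h.
Qed.

(** Two copies of [H] are glued along a densest set of [n - r] vertices: [p] folds both outer parts
    onto its complement, and [side] records the part. *)
Lemma Lclass_exists : exists L : sgraph (Lvert n r), Lclass H L.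
Proof.
have [A Am EA] := @dens_ex _ H (n - r) ltac:(by rewrite card_ord leq_subr).
have [s [sI sE _]] := @enum_split _ set0 A (n - r) (sub0set _) Am.
have cAm : #|~: A| = r by have := cardsC A; rewrite Am card_ord; lia.
have [t [tI tE _]] := @enum_split _ set0 (~: A) r (sub0set _) cAm.
have sA x : s x \in A by rewrite -sE imset_f.
have tA x : t x \notin A by have : t x \in ~: A; [rewrite -tE imset_f|rewrite inE].
pose p (x : Lvert n r) : 'I_n :=
  match x with inl (inl a) => s a | inl (inr b) => t b | inr b => t b end.
pose side (x : Lvert n r) : nat :=
  match x with inl (inl _) => 0 | inl (inr _) => 1 | inr _ => 2 end.
(* Sides are 0, 1, 2, and two of them sum to 3 exactly between the outer parts, where edges are
   removed. *)
pose e (x y : Lvert n r) := adj H (p x) (p y) && (side x + side y != 3).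
have es : symmetric e by move=> x y; rewrite /e adjC addnC.
have eE x y : adj (mkgraph e) x y = e x y.
  rewrite mkgraph_adj //; have [->|//] := eqVneq x y.
  by rewrite /e adjxx.
have half (i : 'I_r -> Lvert n r) (B : {set Lvert n r}) :
    (forall b, p (i b) = t b) -> i @: [set: 'I_r] = B ->
    (forall a b, (i a : Lvert n r) <> inl (inl b)) ->
    (forall x y, x \in B :|: Lvert0 n r -> y \in B :|: Lvert0 n r -> side x + side y != 3) ->
    isomorphic (induced (mkgraph e) (B :|: Lvert0 n r)) H.
  move=> pi iB ni sd.
  have h (x : 'I_n) : exists y : Lvert n r, p y = x /\ y \in B :|: Lvert0 n r.
    case: (boolP (x \in A)) => [|xA].
      by rewrite -sE => /imsetP[a _ ->]; exists (inl (inl a)); rewrite inE Lvert_inE orbT.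
    have : x \in ~: A by rewrite inE.
    by rewrite -tE => /imsetP[b _ ->]; exists (i b); rewrite pi inE -iB imset_f.
  have [g gP] := fin_all_exists h.
  have pg x : p (g x) = x by case: (gP x).
  apply: (@isomorphic_induced _ _ _ _ _ g); first exact: can_inj pg.
    apply/setP => y; apply/imsetP/idP => [[x _ ->]|yB]; first by case: (gP x).
    exists (p y) => //; have := pg (p y); have := (gP (p y)).2.
    have inj (u v : Lvert n r) : u \in B :|: Lvert0 n r -> v \in B :|: Lvert0 n r ->
        p u = p v -> u = v.
      rewrite !inE -iB => /orP[/imsetP[a _ ->]|/imsetP[a _ ->]] /orP[/imsetP[b _ ->]|/imsetP[b _ ->]];
        rewrite ?pi /=.
      - by move=> /tI ->.
      - by move=> E; have := sA b; rewrite -E (negbTE (tA a)).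
      - by move=> E; have := sA a; rewrite E (negbTE (tA b)).
      - by move=> /sI ->.
    by move=> gB E; apply: inj.
  by move=> x y; rewrite eE /e !pg sd ?andbT //; [case: (gP x)|case: (gP y)].
exists (mkgraph e); split.
- by move=> x y /imsetP[a _ ->] /imsetP[b _ ->]; rewrite eE /e /= andbF.
- exists (pull H s); first by apply: dens_max_subgraph; rewrite // sE.
  apply: (@isomorphic_induced _ _ _ _ _ (fun a => inl (inl a))) => [x y []//||x y].
    exact: imset_full.
  by rewrite eE pull_adj /e /= andbT.
- apply: (half (fun b => inl (inr b))) => //; first exact: imset_full.
  move=> [[x|x]|x] [[y|y]|y]; by rewrite !inE ?Lvert_inE.
- apply: (half (fun b => inr b)) => //; first exact: imset_full.
  move=> [[x|x]|x] [[y|y]|y]; by rewrite !inE ?Lvert_inE.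
Qed.

End Lgraphs.
(** Beyond [c], a copy through an uncovered vertex must take the whole residue at once, also
    relative to a single one of the [q] copies that it meets. So it overlaps only that one, and the
    edge budget makes the overlap a densest set. *)
Lemma profile_ideal n c (H : sgraph 'I_n) r : profile n c (cost H) ->
  r < n -> c < r -> good_residue c (cost H) r -> ideal H r.
Proof.
move=> Hp rn cr gr q q0 G; have hn := profile_half Hp; have c2 := profile_ge2 Hp.
have Hp' : profile #|'I_n| c (cost H) by rewrite card_ord.
have cTr : cover_cost n c (cost H) r = cost H r.
  by rewrite (cover_cost_lt _ _ rn) /rest_cost leqNgt cr.
have eH : 2 * nb_edges H = cost H n by rewrite nb_edges_cost card_ord.
have opt : edge_minimal H G <-> covered H G /\
    2 * nb_edges G = cover_cost n c (cost H) (q * n + r).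
  have [B cB] := Lclass_exists H rn.
  apply: (optimum_of_block Hp (B := B) rn q0); first exact: card_Lvert.
    exact: Lclass_covered cB.
  by rewrite (Lclass_nb_edges rn cB) /rest_cost leqNgt cr.
split; last first.
  move=> [L cL iso]; apply/opt; split.
    apply: (covered_iso (isomorphic_sym iso)); apply: dunion2_covered.
      exact: Lclass_covered cL.
    by apply: dunion_covered => _; apply: covered_refl.
  rewrite (isomorphic_nb_edges iso) dunion2_nb_edges dunion_nb_edges sum_nat_const card_ord.
  rewrite (cover_costDn Hp) cTr mulnDr (Lclass_nb_edges rn cL).
  by case: (q) q0 => // q' _; rewrite mulSn /=; nia.
move/opt => [cov eG].
have TN : #|'I_(q * n + r)| = q * #|'I_n| + r by rewrite !card_ord.
have tot : inner_pairs G [set: 'I_(q * n + r)] =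
    cover_cost #|'I_n| c (cost H) #|'I_(q * n + r)| by rewrite inner_pairsT2 eG !card_ord.
have rn' : r < #|'I_n| by rewrite card_ord.
have [h [hc hd ht hr]] := tight_family Hp' cov TN (tight0 erefl tot) rn' gr.
have [D hF hadj hcross hti] := tight_family_exact Hp' TN tot hc hd ht hr rn'.
rewrite card_ord in hti ht hr TN.
set U0 := \bigcup_i _ in ht hr D.
have PI i : h i @: [set: 'I_n] \subset U0 by apply: (bigcup_sup i).
have hU i x : h i x \in U0 by apply: (subsetP (PI i)); apply: imset_f.
have [v vU] : exists v, v \in ~: U0 by apply/card_gt0P; rewrite hr; lia.
have [f [fc /codomP[a va]]] := cov v.
have vf : v \in f @: [set: 'I_n] by rewrite va imset_f.
rewrite inE in vU.
have fn : #|f @: [set: 'I_n]| = n by rewrite card_imset ?cardsT ?card_ord //; exact: fc.1.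
have newU : f @: [set: 'I_n] :\: U0 = ~: U0.
  have [_] := tight_copy Hp' cov ht fc.
  rewrite hr card_ord modn_small // => /(_ gr).
  set x := #|_ :\: U0| => ts.
  have sub : f @: [set: 'I_n] :\: U0 \subset ~: U0.
    by apply/subsetP => y; rewrite !inE => /andP[].
  have xr : x <= r by rewrite -hr; apply: subset_leq_card.
  have x0 : 0 < x by apply/card_gt0P; exists v; rewrite inE vU.
  have xE : x = r by move: ts; rewrite /tight_step; lia.
  by apply/eqP; rewrite eqEcard sub hr -/x xE /=.
have [i0 [y yf yi]] : exists i, exists2 y, y \in f @: [set: 'I_n] & y \in h i @: [set: 'I_n].
  have : 0 < #|f @: [set: 'I_n] :&: U0|.
    by have := cardsID U0 (f @: [set: 'I_n]); rewrite newU hr fn; lia.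
  by move=> /card_gt0P[y]; rewrite inE => /andP[yf /bigcupP[i _ yi]]; exists i, y.
set P := h i0 @: [set: 'I_n] in yi.
have Pn : #|P| = n by rewrite card_imset ?cardsT ?card_ord //; exact: (hc i0).1.
have newP : f @: [set: 'I_n] :\: P = ~: U0.
  have [_] := tight_copy Hp' cov (hti i0) fc.
  have -> : #|~: P| %% #|'I_n| = r.
    have := cardsC P; rewrite Pn !card_ord => h2.
    have -> : #|~: P| = q.-1 * n + r.
      by apply/eqP; rewrite -(eqn_add2l n) h2; case: (q) q0 => // q' _; rewrite mulSn; lia.
    by rewrite modnMDl modn_small.
  rewrite -/P card_ord => /(_ gr); set x := #|_ :\: P| => ts.
  have sub : ~: U0 \subset f @: [set: 'I_n] :\: P.
    rewrite -newU; apply: setDS; exact: PI.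
  have rx : r <= x by rewrite -hr; apply: subset_leq_card.
  have xn : x < n.
    rewrite ltn_neqAle; apply/andP; split; last by rewrite -fn; apply/subset_leq_card/subsetDl.
    apply/eqP => xn; have : y \in f @: [set: 'I_n] :\: P.
      suff -> : f @: [set: 'I_n] :\: P = f @: [set: 'I_n] by [].
      by apply/eqP; rewrite eqEcard subsetDl fn -/x xn /=.
    by rewrite inE yi.
  have xE : x = r by move: ts; rewrite /tight_step; lia.
  by apply/esym/eqP; rewrite eqEcard sub hr -/x xE /=.
have splitf x : x \in f @: [set: 'I_n] -> (x \in U0) = (x \in P).
  move=> xf; have := congr1 (fun A : {set _} => x \in A) newP.
  by rewrite !inE xf andbT => /negb_inj.
have PU : P \subset U0 := PI i0.
set I := f @: [set: 'I_n] :&: P.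
have IU : I = f @: [set: 'I_n] :&: U0.
  by apply/setP => x; rewrite !inE; case: (boolP (x \in f @: _)) => // xf; rewrite splitf.
have In : #|I| = n - r.
  by have := cardsID P (f @: [set: 'I_n]); rewrite newP hr fn -/I; lia.
pose A := f @^-1: U0.
have An : #|A| = n - r.
  have := card_copy_new U0 fc.1; rewrite newU hr card_ord -/A; lia.
have fA : f @: A = I.
  rewrite IU; apply/setP => x; apply/imsetP/setIP => [[u uA ->]|[/imsetP[u _ ->] uA]].
    by split; [apply: imset_f|rewrite inE in uA].
  by exists u; rewrite // inE.
have F : inner_pairs H [set: 'I_n] = cost H n by rewrite -cost_card card_ord.
have dc := @dens_cost _ H r; have dT := @densT _ H.
rewrite card_ord in dT; rewrite card_ord dT F in dc; have {}dc := dc (ltnW rn).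
have fT : U0 :|: f @: [set: 'I_n] = [set: 'I_(q * n + r)].
  apply/setP => x; rewrite !inE; case: (boolP (x \in U0)) => //= xU.
  have : x \in ~: U0 by rewrite inE.
  by rewrite -newU inE => /andP[].
have tot' : inner_pairs G [set: 'I_(q * n + r)] = q * cost H n + cost H r.
  by rewrite tot !card_ord (cover_costDn Hp) cTr.
(* The new copy adds at most [cost H r], so its old part is as dense as possible. *)
have DA : inner_pairs H A = dens H (n - r).
  have := copy_step_exact U0 fc; rewrite fT tot' D F -/A.
  by have := dens_ge H A; rewrite An; have := leq_inner_pairs H (subsetT A); rewrite F; lia.
have splitG := inner_pairs_split G U0; rewrite tot' D F in splitG.
have DI : inner_pairs G I <= dens H (n - r).
  pose B := h i0 @^-1: I.
  have hB : h i0 @: B = I.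
    apply/setP => x; apply/imsetP/idP => [[u uA ->]|xI]; first by rewrite inE in uA.
    have := xI; rewrite inE => /andP[_ /imsetP[u _ E]].
    by exists u; rewrite // inE -E.
  rewrite /inner_pairs -hB (pairs_between_iso _ _ (hc i0).1 (hadj i0)).
  by have := dens_ge H B; rewrite -(card_imset _ (hc i0).1) hB In.
have fI : f @: [set: 'I_n] = I :|: ~: U0.
  by rewrite -newP setID.
have dIW : [disjoint I & ~: U0].
  by rewrite -setI_eq0 IU -setIA setICr setI0.
have Df := inner_pairsU G dIW.
have sIW : pairs_between G I (~: U0) <= pairs_between G U0 (~: U0).
  by apply: leq_pairs_between; rewrite // IU subsetIr.
have Dge : inner_pairs H [set: 'I_n] <= inner_pairs G (f @: [set: 'I_n]).
  exact: pairs_between_copy.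
rewrite F fI Df in Dge.
have fadj x z : adj G (f x) (f z) = adj H x z.
  have le : inner_pairs G (f @: [set: 'I_n]) <= inner_pairs H [set: 'I_n].
    by rewrite fI Df F; lia.
  by apply: (copy_exact fc le); rewrite inE.
(* [I] spans at most [dens H (n - r)], so completing it to a full copy uses up every edge between
   [U0] and the uncovered vertices. *)
have cross0 x z : x \in U0 -> x \notin I -> z \in ~: U0 -> adj G x z = false.
  move=> xU xI zU; have : pairs_between G (U0 :\: I) (~: U0) = 0.
    have IU' : U0 :&: I = I by apply/setIidPr; rewrite IU subsetIr.
    have E : U0 = I :|: (U0 :\: I) by rewrite -{1}(setID U0 I) IU'.
    have d : [disjoint I & U0 :\: I].
      by rewrite disjoint_sym -setI_eq0 setIDAC setDE -setIA setICr setI0.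
    have := pairs_betweenUl G (~: U0) d; rewrite -E; clear -Dge DI splitG dc; lia.
  by move=> /pairs_between_eq0; apply; rewrite // inE xI.
have [s0 [s0I s0E _]] := @enum_split _ set0 A (n - r) (sub0set _) An.
have PIr : #|P :\: I| = r.
  have := cardsID I P; rewrite Pn (_ : P :&: I = I) ?In; first by lia.
  by apply/setIidPr; apply: subsetIr.
have [s1 [s1I s1E _]] := @enum_split _ set0 (P :\: I) r (sub0set _) PIr.
have [s2 [s2I s2E _]] := @enum_split _ set0 (~: U0) r (sub0set _) hr.
pose s (x : Lvert n r) := match x with
  inl (inl b) => f (s0 b) | inl (inr b) => s1 b | inr b => s2 b end.
have s0P b : f (s0 b) \in I by rewrite -fA; apply: imset_f; rewrite -s0E; apply: imset_f.
have s1P b : (s1 b \in P) /\ (s1 b \notin I).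
  by have : s1 b \in P :\: I; [rewrite -s1E imset_f|rewrite inE => /andP[]].
have s2P b : s2 b \notin U0 by have : s2 b \in ~: U0; [rewrite -s2E imset_f|rewrite inE].
have IP : I \subset P by apply: subsetIr.
have sI : injective s.
  have n01 b b' : f (s0 b) <> s1 b'.
    by move=> E; have [_] := s1P b'; rewrite -E s0P.
  have n02 b b' : f (s0 b) <> s2 b'.
    by move=> E; have := s2P b'; rewrite -E (subsetP PU) // (subsetP IP).
  have n12 b b' : s1 b <> s2 b'.
    by move=> E; have := s2P b'; rewrite -E (subsetP PU) //; case: (s1P b).
  move=> [[b|b]|b] [[b'|b']|b'] /= E.
  - by rewrite (s0I _ _ (fc.1 _ _ E)).
  - by case: (n01 _ _ E).
  - by case: (n02 _ _ E).
  - by case: (n01 _ _ (esym E)).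
  - by rewrite (s1I _ _ E).
  - by case: (n12 _ _ E).
  - by case: (n02 _ _ (esym E)).
  - by case: (n12 _ _ (esym E)).
  - by rewrite (s2I _ _ E).
have sV0 : s @: Lvert0 n r = I.
  rewrite -fA -s0E -!imset_comp imset_full; exact: eq_imset.
have sV1 : s @: Lvert1 n r = P :\: I.
  rewrite -s1E -imset_comp imset_full; exact: eq_imset.
have sV2 : s @: Lvert2 n r = ~: U0.
  rewrite -s2E -imset_comp imset_full; exact: eq_imset.
exists (pull G s).
  split.
  - move=> x z /imsetP[b _ ->] /imsetP[b' _ ->]; rewrite pull_adj /=.
    by rewrite (cross0 _ _ (subsetP PU _ (s1P b).1) (s1P b).2) // inE s2P.
  - exists (pull H s0); first by apply: dens_max_subgraph; rewrite // s0E.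
    apply: (@isomorphic_induced _ _ _ _ _ (fun b => inl (inl b))) => [x z []//||x z].
      exact: imset_full.
    by rewrite !pull_adj /= fadj.
  - apply: (isomorphic_pull_induced sI (hc i0).1) (hadj i0).
    by rewrite imsetU sV0 sV1 setDE setUIl [~: I :|: I]setUC setUCr setIT; apply/esym/setUidPl.
  - apply: (isomorphic_pull_induced sI fc.1 _ fadj).
    by rewrite imsetU sV0 sV2 fI setUC.
apply: isomorphic_sym.
(* [lift i0] enumerates the copies other than the glued one. *)
pose g (x : Lvert n r + {j : 'I_q.-1 & 'I_n}) : 'I_(q * n + r) := match x with
  inl x => s x | inr y => h (lift i0 (tag y)) (tagged y) end.
have sPU x : s x \in P \/ s x \notin U0.
  case: x => [[b|b]|b] /=; [left; exact: (subsetP IP)|left; by case: (s1P b)|by right].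
have hdis i j x z : h i x = h j z -> i = j.
  move=> E; apply/eqP/negPn/negP => /hd /pred0P/(_ (h i x)) /=.
  by rewrite imset_f // {1}E imset_f.
have hP j x : h (lift i0 j) x \notin P.
  by apply/negP => /imsetP[z _ /hdis E]; have := neq_lift i0 j; rewrite E eqxx.
have cr0 x j z : adj G (s x) (h (lift i0 j) z) = false.
  case: (sPU x) => [/imsetP[b _ ->]|xU]; first by apply: hcross; apply: neq_lift.
  rewrite adjC; apply: cross0; rewrite ?inE //.
  by rewrite (negbTE (hP j z)) andbF.
exists g.
  apply: inj_card_bij.
    move=> [x|[j x]] [z|[k z]] /= E.
    - by rewrite (sI _ _ E).
    - have /negP[] := hP k z; case: (sPU x); first by rewrite E.
      by rewrite E hU.
    - have /negP[] := hP j x; case: (sPU z); first by rewrite E.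
      by rewrite -E hU.
    - have jk := lift_inj (hdis _ _ _ _ E); subst k.
      by rewrite ((hc _).1 _ _ E).
  rewrite [X in _ <= X]card_sum card_Lvert // card_tagged sumnE big_map big_enum /=.
  rewrite sum_nat_const !card_ord; case: (q) q0 => // q' _; rewrite mulSn /=; clear; lia.
move=> [x|[j x]] [z|[k z]].
- by rewrite dunion2_adjl pull_adj.
- by rewrite dunion2_adjlr /= cr0.
- by rewrite adjC cr0 [RHS]adjC dunion2_adjlr.
- rewrite dunion2_adjr /=; have [jk|jk] := eqVneq j k.
    by subst k; rewrite (dunion_adj (fun _ => H) x z) hadj.
  rewrite hcross; last by apply: contraNneq jk => /lift_inj ->.
  by apply/esym/negbTE/negP => /dunion_adj_tag /= E; rewrite E eqxx in jk.
Qed.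

End IdealCharacterization.

(** * Pseudorandom graphs *)

Section Pseudorandom.

(** Here [j] deleted vertices are low and [m] are not, [d] is the smallest degree and [D] counts the
    ordered pairs inside. The excess [2 * (j - 1) * K0] of the low degrees beats [j * (j - 1)], and
    the excess [4 * m * k] of the others beats [2 * m * k]. *)
Lemma isolated_arith (j m k K0 d cst D SJ SM SX : nat) : (j + m = k)%N -> (2 <= k)%N ->
  (0 < K0)%N -> (j <= K0)%N -> (D <= j * (j - 1) + 2 * (m * k))%N ->
  (j * d + (j - 1) * K0 <= SJ)%N -> (m * (d + 2 * k) <= SM)%N -> (SX = SJ + SM)%N ->
  (cst + D = 2 * SX)%N -> (k * (2 * d) < cst)%N.
Proof.
move=> jm k2 K1 jK hD hJ hM hX hc.
have jj : (j * (j - 1) <= (j - 1) * K0)%N by rewrite mulnC leq_mul2l jK orbT.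
have -> : (k * (2 * d) = 2 * (j * d) + 2 * (m * d))%N by rewrite -jm; lia.
rewrite mulnDr in hM; have e : (m * (2 * k) = 2 * (m * k))%N by lia.
rewrite e in hM.
have [m0|m0] := posnP m.
  have jj1 : (0 < (j - 1) * K0)%N by rewrite muln_gt0 K1 andbT; lia.
  by rewrite m0 !mul0n in hD hM *; lia.
have mk : (0 < m * k)%N by rewrite muln_gt0 m0; lia.
lia.
Qed.

Lemma avg_le (R : realFieldType) (T : finType) (A : {set T}) (F : T -> R) :
  (0 < #|A|)%N -> exists2 v, v \in A & #|A|%:R * F v <= \sum_(x in A) F x.
Proof.
move=> A0; case: (boolP [exists v in A, #|A|%:R * F v <= \sum_(x in A) F x]).
  by move=> /exists_inP[v vA le]; exists v.
rewrite negb_exists_in => /forall_inP h.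
have A0' : (0 : R) < #|A|%:R by rewrite ltr0n.
have : \sum_(v in A) (\sum_(x in A) F x) < \sum_(v in A) #|A|%:R * F v.
  have [v vA] := card_gt0P A0.
  rewrite (bigD1 v) // [X in _ < X](bigD1 v) //=; apply: ltr_leD.
    by rewrite real_ltNge ?num_real // h.
  by apply: ler_sum => x /andP[xA _]; rewrite ltW // real_ltNge ?num_real // h.
by rewrite sumr_const -mulr_sumr mulr_natl ltxx.
Qed.

Lemma subset_of_card (T : finType) (A : {set T}) (k : nat) : (k <= #|A|)%N ->
  exists2 B : {set T}, B \subset A & #|B| = k.
Proof.
move=> kA; have [s [sI sE _]] := @enum_split _ set0 A #|A| (sub0set _) erefl.
exists ((s \o widen_ord kA) @: [set: 'I_k]).
  apply/subsetP => x /imsetP[j _ ->].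
  have : s (widen_ord kA j) \in s @: [set: 'I_#|A|] by apply: imset_f.
  by rewrite /=; move: (s (widen_ord kA j)) => y; rewrite sE.
rewrite card_imset ?cardsT ?card_ord //.
by move=> i j /sI /(congr1 val) /= h; apply: val_inj.
Qed.

Section Greedy.
Local Open Scope nat_scope.
Variables (n : nat) (H : sgraph 'I_n).
Implicit Types X : {set 'I_n}.

Lemma cost_ex x : x <= n -> exists2 X : {set 'I_n}, #|X| = x &
  cost H x + inner_pairs H X = 2 * \sum_(v in X) degree H v /\
  cost H x + inner_pairs H (~: X) = inner_pairs H [set: 'I_n].
Proof.
move=> xn; have [Z Zn EZ] := @dens_ex _ H (n - x) ltac:(by rewrite card_ord leq_subr).
have cX : #|~: Z| = x by have := cardsC Z; rewrite Zn card_ord; lia.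
exists (~: Z) => //; rewrite setCK EZ sum_degree setCK.
have := @dens_cost _ H x; rewrite card_ord => /(_ xn).
have := @densT _ H; rewrite card_ord => -> E.
have := inner_pairs_split H (~: Z); rewrite setCK EZ; lia.
Qed.

Lemma cost_le_setC X : cost H #|X| + inner_pairs H (~: X) <= inner_pairs H [set: 'I_n].
Proof. by have := inner_pairs_split H X; have := cost_le H X; lia. Qed.

Lemma cost_extend X v : v \notin X ->
  cost H #|X|.+1 + inner_pairs H (~: X) <=
  inner_pairs H [set: 'I_n] + pairs_between H [set v] (~: X) * 2.
Proof.
move=> vX; have := cost_le_setC (v |: X); rewrite cardsU1 vX add1n.
have vC : v \in ~: X by rewrite inE.
rewrite (inner_pairsD1 H vC); have -> : ~: X :\ v = ~: (v |: X).
  by apply/setP => z; rewrite !inE negb_or.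
have : pairs_between H [set v] (~: (v |: X)) <= pairs_between H [set v] (~: X).
  by apply: leq_pairs_between; rewrite // setCS subsetUr.
lia.
Qed.

Lemma dens_extend X v : v \notin X ->
  inner_pairs H X + pairs_between H [set v] X * 2 <= dens H #|X|.+1.
Proof.
move=> vX; have := dens_ge H (v |: X); rewrite cardsU1 vX add1n.
by rewrite inner_pairsU ?disjoints1 // inner_pairs1; lia.
Qed.

End Greedy.

Variables (R : rcfType) (n : nat) (H : sgraph 'I_n) (p s L : R).
Hypotheses (p0 : 0 < p) (p1 : p < 1) (s0 : 0 < s) (L0 : 0 < L).
Hypothesis sL : s ^+ 2 = n%:R * L.
Hypothesis degA : forall v, `|(degree H v)%:R - p * n%:R| <= 4 * s.
Hypothesis densB : forall Z : {set 'I_n},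
  `|(inner_pairs H Z)%:R - p * #|Z|%:R * (#|Z|%:R - 1)| <=
  4 * #|Z|%:R * Num.sqrt (#|Z|%:R * L).

Let f (x : nat) : R := (cost H x)%:R.
Let D (Z : {set 'I_n}) : R := (inner_pairs H Z)%:R.
Let delta : R := f 1.

Lemma sqrt_le_s (x : nat) : (x <= n)%N -> Num.sqrt (x%:R * L) <= s.
Proof.
move=> xn; have -> : s = Num.sqrt (s ^+ 2) by rewrite sqrtr_sqr gtr0_norm.
rewrite ler_wsqrtr // sL.
by rewrite ler_wpM2r ?ler_nat // ltW.
Qed.

Lemma deg_lb v : p * n%:R - 4 * s <= (degree H v)%:R.
Proof. by have := degA v; rewrite ler_norml => /andP[h _]; lra. Qed.

Lemma inner_lb (Z : {set 'I_n}) : p * #|Z|%:R * (#|Z|%:R - 1) - 4 * #|Z|%:R * Num.sqrt (#|Z|%:R * L) <= D Z.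
Proof. by have := densB Z; rewrite ler_norml /D => /andP[h _]; lra. Qed.

Lemma inner_ub (Z : {set 'I_n}) : D Z <= p * #|Z|%:R * (#|Z|%:R - 1) + 4 * #|Z|%:R * Num.sqrt (#|Z|%:R * L).
Proof. by have := densB Z; rewrite ler_norml /D => /andP[_ h]; lra. Qed.

Lemma sum_deg_in (A Z : {set 'I_n}) :
  \sum_(v in A) (pairs_between H [set v] Z)%:R = (pairs_between H A Z)%:R :> R.
Proof. by rewrite (pairs_between_sum H A) natr_sum. Qed.

(** The next vertex to delete has at most the average degree inside the densest set that remains,
    and this average is known from the edge count of that set. *)
Lemma cost_step_ub (x : nat) : (x < n)%N ->
  f x.+1 <= f x + 2 * (p * (n%:R - x%:R) + 4 * s).
Proof.
move=> xn; have [X Xx [_ E]] := @cost_ex _ H x (ltnW xn).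
have cZ : #|~: X| = (n - x)%N by have := cardsC X; rewrite Xx card_ord; lia.
have Z0 : (0 < #|~: X|)%N by rewrite cZ subn_gt0.
have [v vZ le] := avg_le (fun v => (pairs_between H [set v] (~: X))%:R : R) Z0.
have vX : v \notin X by rewrite inE in vZ.
have := cost_extend H vX; rewrite Xx -E -(ler_nat R) !natrD !natrM -/(f x.+1) -/(f x).
have DZ := inner_ub (~: X); rewrite sum_deg_in -/(inner_pairs H (~: X)) -/(D (~: X)) // in le.
have cR : #|~: X|%:R = n%:R - x%:R :> R by rewrite cZ natrB // ltnW.
have zn : (#|~: X| <= n)%N by rewrite cZ leq_subr.
have sq := sqrt_le_s zn.
have zpos : (0 : R) < #|~: X|%:R by rewrite ltr0n.
have : (pairs_between H [set v] (~: X))%:R <= p * (n%:R - x%:R) + 4 * s.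
  rewrite -(ler_pM2l zpos) -cR; apply: le_trans le _; apply: le_trans DZ _.
  have : #|~: X|%:R * Num.sqrt (#|~: X|%:R * L) <= #|~: X|%:R * s by rewrite ler_pM2l.
  have : 0 < p * #|~: X|%:R by rewrite mulr_gt0.
  lra.
by rewrite /D; lra.
Qed.

Lemma cost_steps_ub (x y : nat) : (x + y <= n)%N ->
  f (x + y) <= f x + 2 * y%:R * p * (n%:R - x%:R) - p * y%:R * (y%:R - 1) + 8 * y%:R * s.
Proof.
elim: y => [|y IH] xyn; first by rewrite addn0; lra.
have {}IH := IH ltac:(lia); rewrite addnS.
have := @cost_step_ub (x + y) ltac:(lia); rewrite natrD -natr1; lra.
Qed.

Lemma cost_ge (y : nat) : (y <= n)%N ->
  2 * y%:R * (p * n%:R - 4 * s) - p * y%:R * (y%:R - 1) - 4 * y%:R * Num.sqrt (y%:R * L) <= f y.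
Proof.
move=> yn; have [X Xx [E _]] := @cost_ex _ H y yn.
have := inner_ub X; rewrite Xx /D => h.
have : y%:R * (p * n%:R - 4 * s) <= \sum_(v in X) (degree H v)%:R.
  by rewrite -Xx mulr_natl -sumr_const; apply: ler_sum => v _; apply: deg_lb.
have : f y + (inner_pairs H X)%:R = 2 * \sum_(v in X) (degree H v)%:R.
  by rewrite /f -natrD E natrM natr_sum.
lra.
Qed.

(** Deleting both blocks together saves 2 p x y for the pairs between them, while the errors of the
    two bounds add up to 20 y s. *)
Lemma cost_subadd_large (x y : nat) : 10 * s < p * x%:R -> (0 < y)%N ->
  (x + y <= n)%N -> f (x + y) < f x + f y.
Proof.
move=> xs y0 xyn; have h1 := cost_steps_ub xyn.
have yn : (y <= n)%N by lia.
have h2 := cost_ge yn; have h3 := sqrt_le_s yn.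
have yp : (0 : R) < y%:R by rewrite ltr0n.
have h4 : y%:R * Num.sqrt (y%:R * L) <= y%:R * s by rewrite ler_pM2l.
have h5 : y%:R * (10 * s) < y%:R * (p * x%:R) by rewrite ltr_pM2l.
lra.
Qed.

Lemma delta_lb : (0 < n)%N -> 2 * (p * n%:R - 4 * s) <= delta.
Proof.
move=> n0; have [v E] : exists v, cost H 1 = (2 * degree H v)%N.
  by apply: cost1_ex; rewrite card_ord.
by rewrite /delta /f E natrM; have := deg_lb v; lra.
Qed.

(** Already the crude bound pushes [f r] below the line once r is about 16 s / p; this bounds the
    switch from above. *)
Lemma cost_le_linear_large (r : nat) : (r <= n)%N -> (0 < r)%N ->
  16 * s <= p * (r%:R - 1) -> f r <= r%:R * delta.
Proof.
move=> rn r0 h; have := @cost_steps_ub 0 r rn; rewrite add0n.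
have -> : f 0 = 0 by rewrite /f cost0.
have rp : (0 : R) < r%:R by rewrite ltr0n.
have : r%:R * (16 * s) <= r%:R * (p * (r%:R - 1)) by rewrite ler_pM2l.
have : r%:R * (2 * (p * n%:R - 4 * s)) <= r%:R * delta.
  by rewrite ler_pM2l // delta_lb //; lia.
lra.
Qed.


Section LowDegrees.
Variables (c xs zeta kap C : R).
Let Low := [set v | (degree H v)%:R <= xs].
Let Few := [set v | (degree H v)%:R <= xs - zeta * s].
Hypotheses (c0 : 0 < c) (C0 : 0 < C) (z0 : 0 <= zeta) (kap0 : 0 < kap).
Hypothesis xs_le : xs <= p * n%:R.
Hypothesis Low_ge : 3 * C * s <= #|Low|%:R.
Hypothesis Few_le : #|Few|%:R <= zeta * s.
Hypothesis kapC : 4 * C * L <= kap ^+ 2 * s.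
Hypothesis zeta_small : 2 * zeta * c + 8 * zeta <= p * c ^+ 2 / 2.
Hypothesis kap_small : 50 * kap <= p * c.
Hypothesis ps : p <= kap * s.
Variable w : nat.
Hypotheses (wl : C * s <= w%:R) (wu : w%:R <= 2 * C * s).

(** The error of the lower bound per vertex, in units of [s]: twice the shift [zeta] of the low
    degrees, the effect of the at most [zeta * s] exceptional vertices spread over at least [c * s],
    and the error of the edge count. *)
Let E := 2 * zeta + 8 * zeta / c + 4 * kap.

Lemma E_small : E + 20 * kap < p * c.
Proof.
have : (2 * zeta * c + 8 * zeta) / c <= (p * c ^+ 2 / 2) / c.
  by rewrite ler_pM2r ?invr_gt0.
have -> : (2 * zeta * c + 8 * zeta) / c = 2 * zeta + 8 * zeta / c.
  by field; rewrite gt_eqF.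
have -> : (p * c ^+ 2 / 2) / c = p * c / 2 by field; rewrite gt_eqF.
have : 0 < p * c by rewrite mulr_gt0.
rewrite /E; move: kap_small; lra.
Qed.

Lemma sqrt_le_kap (z : nat) : z%:R <= 4 * C * s -> Num.sqrt (z%:R * L) <= kap * s.
Proof.
move=> zC; have ks : 0 <= kap * s by rewrite mulr_ge0 // ltW.
have -> : kap * s = Num.sqrt ((kap * s) ^+ 2) by rewrite sqrtr_sqr ger0_norm.
rewrite ler_wsqrtr //; apply: (@le_trans _ _ (4 * C * s * L)).
  by rewrite ler_wpM2r // ltW.
have : (4 * C * L) * s <= (kap ^+ 2 * s) * s by rewrite ler_pM2r.
by rewrite exprMn expr2; lra.
Qed.

(** Vertices outside [Few] have degree above [xs - zeta * s], the others at least p n - 4 s.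
    Subtracting about p r^2 for the pairs inside gives the quadratic main term. *)
Lemma cost_mid_lb (r : nat) : (r <= n)%N -> c * s <= r%:R -> r%:R <= 4 * C * s ->
  2 * r%:R * xs - p * r%:R ^+ 2 - E * r%:R * s <= f r.
Proof.
move=> rn cr rC; have [X Xr [EX _]] := @cost_ex _ H r rn.
have := inner_ub X; rewrite Xr /D => hX.
have sq := sqrt_le_kap rC.
have r0 : 0 <= r%:R :> R by [].
have hr : 4 * r%:R * Num.sqrt (r%:R * L) <= 4 * r%:R * (kap * s).
  by rewrite ler_wpM2l // mulr_ge0.
have : \sum_(v in X) (xs - zeta * s - (if v \in Few then 4 * s else 0)) <=
       \sum_(v in X) (degree H v)%:R.
  apply: ler_sum => v _; rewrite inE; case: ifP => h.
    have := deg_lb v; have : 0 <= zeta * s by rewrite mulr_ge0 // ltW.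
    by have := xs_le; lra.
  by move/negbT: h; rewrite -ltNge; lra.
rewrite sumrB sumr_const Xr -[_ *+ r]mulr_natl -big_mkcondr /=.
have : \sum_(v in X | v \in Few) 4 * s <= zeta * s * (4 * s).
  rewrite (eq_bigl (mem (X :&: Few))); last by move=> v; rewrite /= in_setI.
  rewrite sumr_const -[X in X <= _]mulr_natl ler_wpM2r //; first by rewrite mulr_ge0 ?ltW.
  apply: le_trans Few_le; rewrite ler_nat; apply: subset_leq_card; exact: subsetIr.
have : f r + (inner_pairs H X)%:R = 2 * \sum_(v in X) (degree H v)%:R.
  by rewrite /f -natrD EX natrM natr_sum.
have : 8 * zeta * s * s <= 8 * zeta / c * r%:R * s.
  rewrite ler_pM2r //; have -> : 8 * zeta * s = 8 * zeta / c * (c * s) by field; rewrite gt_eqF.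
  by rewrite ler_wpM2l // divr_ge0 ?mulr_ge0 // ltW.
have : 0 <= p * r%:R by rewrite mulr_ge0 // ltW.
rewrite /E; move: hX hr; rewrite expr2; lra.
Qed.

(** Any [r] vertices of [Low] are good enough as the deleted set. *)
Lemma cost_mid_ub (r : nat) : r%:R <= 3 * C * s ->
  f r <= 2 * r%:R * xs - p * r%:R ^+ 2 + 5 * kap * r%:R * s.
Proof.
move=> rC; have rL : (r <= #|Low|)%N by rewrite -(ler_nat R); apply: le_trans Low_ge.
have [X XL Xr] := subset_of_card rL.
have := cost_le_degrees H X; rewrite Xr -(ler_nat R) natrD natrM natr_sum -/(f r).
have := inner_lb X; rewrite Xr /D.
have : \sum_(v in X) (degree H v)%:R <= r%:R * xs.
  rewrite mulr_natl -Xr -sumr_const; apply: ler_sum => v vX.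
  by have := subsetP XL v vX; rewrite inE.
have sq : Num.sqrt (r%:R * L) <= kap * s.
  by apply: sqrt_le_kap; have : 0 < C * s; [rewrite mulr_gt0|lra].
have r0 : 0 <= r%:R :> R by [].
have : 4 * r%:R * Num.sqrt (r%:R * L) <= 4 * r%:R * (kap * s).
  by rewrite ler_wpM2l // mulr_ge0.
have : p * r%:R <= kap * s * r%:R by rewrite ler_wpM2r.
rewrite expr2; lra.
Qed.

(** The quadratic term gains 2 p x y, which is at least p c s (x + y) because both sizes are at
    least c s, and [E_small] keeps the errors below that. *)
Lemma cost_subadd_mid (x y : nat) : c * s <= x%:R -> c * s <= y%:R ->
  x%:R <= C * s -> y%:R <= C * s -> (x + y <= n)%N -> f (x + y) < f x + f y.
Proof.
move=> cx cy xC yC xyn; have Cs : 0 < C * s by rewrite mulr_gt0.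
have xn : (x <= n)%N := leq_trans (leq_addr y x) xyn.
have yn : (y <= n)%N := leq_trans (leq_addl x y) xyn.
have xC4 : x%:R <= 4 * C * s by lra.
have yC4 : y%:R <= 4 * C * s by lra.
have xyC : (x + y)%:R <= 3 * C * s by rewrite natrD; lra.
have hx := cost_mid_lb xn cx xC4; have hy := cost_mid_lb yn cy yC4.
have := cost_mid_ub xyC.
have cs0 : 0 < c * s by rewrite mulr_gt0.
have x0 : 0 < x%:R :> R by lra.
have y0 : 0 < y%:R :> R by lra.
have h1 : 0 <= p * x%:R * (y%:R - c * s) by rewrite mulr_ge0 ?subr_ge0 // mulr_ge0 // ltW.
have h2 : 0 <= p * y%:R * (x%:R - c * s) by rewrite mulr_ge0 ?subr_ge0 // mulr_ge0 // ltW.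
have h3 : 0 < (x%:R + y%:R) * s * (p * c - (E + 20 * kap)).
  by rewrite mulr_gt0 ?subr_gt0 ?E_small // mulr_gt0 //; lra.
have h4 : 0 <= kap * (x%:R + y%:R) * s.
  by rewrite mulr_ge0 ?(ltW s0) // mulr_ge0 ?(ltW kap0) //; lra.
rewrite natrD !expr2; lra.
Qed.

(** Comparing [f x <= x * delta] with the lower bound shows that [delta] is at least about 2 xs - p
    x, whereas a further low vertex with a typical number of neighbours in [X] costs only about 2 xs
    - 2 p x. Concentration controls averages only, so such a vertex is sought among [w] low ones
    outside [X], with [w] at least [x]. *)
Lemma cost_incr_mid (x : nat) : c * s <= x%:R -> x%:R <= C * s -> (x < n)%N ->
  f x <= x%:R * delta -> f x.+1 < f x + delta.
Proof.
move=> cx xC xn flin; have Cs : 0 < C * s by rewrite mulr_gt0.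
have xC4 : x%:R <= 4 * C * s by lra.
have hx := cost_mid_lb (ltnW xn) cx xC4.
have cs0 : 0 < c * s by rewrite mulr_gt0.
have x0 : 0 < x%:R :> R by lra.
have [X Xx [_ EX]] := @cost_ex _ H x (ltnW xn).
have hd : (w <= #|Low :\: X|)%N.
  have : (w + x <= #|Low|)%N.
    by rewrite -(ler_nat R) natrD; apply: le_trans Low_ge; have := wu; lra.
  move=> h; rewrite -(leq_add2r x); apply: leq_trans h _.
  by rewrite -(cardsID X Low) addnC leq_add2l -Xx subset_leq_card ?subsetIr.
have [W WL Ww] := subset_of_card hd.
have dXW : [disjoint X & W].
  rewrite disjoint_sym; apply: (disjointWl WL).
  by rewrite -setI_eq0 setDE -setIA [~: X :&: X]setIC setICr setI0.
have w0 : 0 < w%:R :> R by have := wl; lra.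
have W0 : (0 < #|W|)%N by rewrite Ww -(ltr_nat R).
have [v vW le] := avg_le (fun v => (pairs_between H [set v] (~: X))%:R : R) W0.
rewrite sum_deg_in Ww in le.
have EW : (pairs_between H W (~: X))%:R + (pairs_between H X W)%:R =
    \sum_(v in W) (degree H v)%:R :> R.
  rewrite -natr_sum -natrD; congr _%:R; rewrite addnC [pairs_between H X W]pairs_betweenC.
  rewrite -pairs_betweenUr ?setUCr; last by rewrite -setI_eq0 setICr.
  by rewrite pairs_between_sum.
have sW : \sum_(v in W) (degree H v)%:R <= w%:R * xs.
  rewrite mulr_natl -Ww -sumr_const; apply: ler_sum => u uW.
  by have := subsetP WL u uW; rewrite !inE => /andP[].
have := inner_pairsU H dXW => /(congr1 (fun k : nat => k%:R : R)).
rewrite natrD natrD mulnC natrM -/(D _) -/(D X) -/(D W) => DU.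
have cU : #|X :|: W| = (x + w)%N 
  by rewrite cardsU (eqP (_ : X :&: W == set0)) ?setI_eq0 // cards0 subn0 Xx Ww.
have := inner_lb (X :|: W); have := inner_ub X; have := inner_ub W; rewrite cU Xx Ww natrD => b1 b2 b3.
have wC4 : w%:R <= 4 * C * s by have := wu; lra.
have xwC4 : (x + w)%:R <= 4 * C * s by rewrite natrD; have := wu; lra.
have sw := sqrt_le_kap wC4; have sx := sqrt_le_kap xC4.
have sxw := sqrt_le_kap xwC4; rewrite natrD in sxw.
have q1 : w%:R * Num.sqrt (w%:R * L) <= w%:R * (kap * s) by rewrite ler_pM2l.
have q2 : x%:R * Num.sqrt (x%:R * L) <= x%:R * (kap * s) by rewrite ler_pM2l.
have q3 : (x%:R + w%:R) * Num.sqrt ((x%:R + w%:R) * L) <= (x%:R + w%:R) * (kap * s).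
  by rewrite ler_pM2l //; lra.
have q4 : x%:R * (kap * s) <= w%:R * (kap * s).
  rewrite ler_wpM2r //; first by rewrite mulr_ge0 // ltW.
  by have := wl; lra.
have : w%:R * (pairs_between H [set v] (~: X))%:R <= w%:R * (xs - p * x%:R + 8 * kap * s).
  by lra.
rewrite ler_pM2l // => dv.
have vX : v \notin X by have := subsetP WL v vW; rewrite inE => /andP[].
have := cost_extend H vX; rewrite Xx -EX -(ler_nat R) !natrD !natrM -/(f x.+1) -/(f x) => hf.
have h5 : x%:R * (2 * xs - p * x%:R - E * s) <= x%:R * delta by move: hx; rewrite expr2; lra.
rewrite ler_pM2l // in h5.
have h3 : 0 < s * (p * c - (E + 20 * kap)) by rewrite mulr_gt0 ?subr_gt0 ?E_small.
have h6 : p * (c * s) <= p * x%:R by rewrite ler_pM2l.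
have h7 : 0 < kap * s by rewrite mulr_gt0.
lra.
Qed.

End LowDegrees.

(* A vertex of smallest degree is isolated from the other low degrees, so that
   saving the edges inside a small set costs more than it gains. *)
Lemma cost_gt_linear (c : R) (u : 'I_n) (K0 k : nat) :
  (forall v, v != u -> (degree H u + K0 <= degree H v)%N) ->
  (0 < K0)%N -> (#|[set v | ((degree H v)%:R <= (degree H u)%:R + 2 * c * s :> R)%R]| <= K0)%N ->
  (2 <= k)%N -> (k <= n)%N -> k%:R <= c * s -> k%:R * delta < f k.
Proof.
move=> gap K00; set N := [set v | _] => NK k2 kn kc.
have [X Xk [EX _]] := @cost_ex _ H k kn.
have dle : delta <= 2 * (degree H u)%:R.
  by rewrite /delta /f -natrM ler_nat cost1_le.
set J := X :&: N; set M := X :\: N.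
have cJM : (#|J| + #|M| = k)%N by rewrite cardsID.
have JK : (#|J| <= K0)%N by apply: leq_trans NK; apply/subset_leq_card/subsetIr.
have XE : X = J :|: M by rewrite setID.
have dJM : [disjoint J & M].
  by rewrite -setI_eq0 /J /M setIDA setIAC setDE -setIA setICr setI0.
have DX : (inner_pairs H X <= #|J| * (#|J| - 1) + 2 * (#|M| * k))%N.
  rewrite {1}XE inner_pairsU //.
  have h1 : (inner_pairs H J <= #|J| * (#|J| - 1))%N.
    rewrite /inner_pairs pairs_between_sum -sum_nat_const; apply: leq_sum => v vJ.
    rewrite -(setD1K vJ) pairs_betweenUr ?disjoints1 ?inE ?eqxx //.
    have := inner_pairs1 H v; rewrite /inner_pairs => ->; rewrite add0n setD1K //.
    by apply: leq_trans (pairs_between_le _ _ _) _; rewrite cards1 mul1n (cardsD1 v J) vJ; lia.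
  have h2 := pairs_between_le H J M; have h3 := pairs_between_le H M M.
  rewrite -/(inner_pairs H M) in h3.
  have : (inner_pairs H M <= 2 * (#|M| * #|M|))%N by lia.
  move: cJM h1 h2; nia.
have sumJ : (#|J| * degree H u + (#|J| - 1) * K0 <= \sum_(v in J) degree H v)%N.
  case: (boolP (u \in J)) => uJ.
    rewrite (bigD1 u) //=.
    have : (\sum_(v in J | v != u) (degree H u + K0) <= \sum_(v in J | v != u) degree H v)%N.
      by apply: leq_sum => v /andP[_ vu]; apply: gap.
    rewrite sum_nat_const; have -> : #|[pred v in J | v != u]| = (#|J| - 1)%N.
      rewrite (cardsD1 u J) uJ addKn; apply: eq_card => v; rewrite !inE andbC //.
    have J0 : (0 < #|J|)%N by apply/card_gt0P; exists u.
    move=> h; have hj : #|J| = (#|J| - 1).+1 by rewrite subn1 prednK.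
    by rewrite {1}hj mulSn -addnA leq_add2l -mulnDr.
  have : (\sum_(v in J) (degree H u + K0) <= \sum_(v in J) degree H v)%N.
    by apply: leq_sum => v vJ; apply: gap; apply: contraNneq uJ => <-.
  rewrite sum_nat_const mulnDr; apply: leq_trans.
  by rewrite leq_add2l leq_mul2r leq_subr orbT.
have sumM : #|M|%:R * ((degree H u)%:R + 2 * k%:R) <= \sum_(v in M) (degree H v)%:R :> R.
  rewrite mulr_natl -sumr_const; apply: ler_sum => v; rewrite !inE => /andP[h _].
  by move: h; rewrite -ltNge => h; lra.
have sumM' : (#|M| * (degree H u + 2 * k) <= \sum_(v in M) degree H v)%N.
  by rewrite -(ler_nat R) natrM natrD natrM natr_sum.
have sumX : (\sum_(v in X) degree H v = \sum_(v in J) degree H v + \sum_(v in M) degree H v)%N.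
  by rewrite {1}XE; apply: sum_setU.
have fin : (k * (2 * degree H u) < cost H k)%N.
  exact: (isolated_arith cJM k2 K00 JK DX sumJ sumM' sumX EX).
apply: le_lt_trans (_ : k%:R * (2 * (degree H u)%:R) < _); first by rewrite ler_wpM2l.
by rewrite -!natrM ltr_nat.
Qed.

End Pseudorandom.

(** * Strict superadditivity of the densest-set function *)

Section Superadditivity.
Variables (R : rcfType) (n : nat) (H : sgraph 'I_n) (p s L : R).
Hypotheses (p0 : 0 < p) (p1 : p < 1) (s0 : 0 < s) (L0 : 0 < L).
Hypothesis sL : s ^+ 2 = n%:R * L.
Hypothesis degA : forall v, `|(degree H v)%:R - p * n%:R| <= 4 * s.
Hypothesis densB : forall Z : {set 'I_n},
  `|(inner_pairs H Z)%:R - p * #|Z|%:R * (#|Z|%:R - 1)| <=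
  4 * #|Z|%:R * Num.sqrt (#|Z|%:R * L).
Hypothesis s_small : (4 + 20 / p) * s <= p / 100 * n%:R.

Let M (k : nat) : R := (dens H k)%:R.

Lemma dens_step (k : nat) : (k < n)%N -> exists A : {set 'I_n},
  [/\ #|A| = k, #|~: A| = (n - k)%N, M k = (inner_pairs H A)%:R &
      (pairs_between H (~: A) A)%:R * 2 <= (n - k)%:R * (M k.+1 - M k)].
Proof.
move=> kn; have [A Ak EA] := @dens_ex _ H k ltac:(by rewrite card_ord ltnW).
have cZ : #|~: A| = (n - k)%N by have := cardsC A; rewrite Ak card_ord; lia.
exists A; split=> //; first by rewrite /M EA.
have Z0 : (0 < #|~: A|)%N by rewrite cZ subn_gt0.
have [v vZ le] := avg_le (fun v => - (pairs_between H [set v] A)%:R : R) Z0.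
rewrite sumrN sum_deg_in mulrN lerN2 cZ in le.
have vA : v \notin A by rewrite inE in vZ.
have := dens_extend H vA; rewrite Ak EA -(ler_nat R) natrD natrM -/(M k) -/(M k.+1) => h.
have : (n - k)%:R * ((pairs_between H [set v] A)%:R * 2) <= (n - k)%:R * (M k.+1 - M k).
  by rewrite ler_wpM2l //; lra.
lra.
Qed.

Lemma dens_step_large (k : nat) : (k < n)%N -> M k + 2 * (p * k%:R - 8 * s) <= M k.+1.
Proof.
move=> kn; have [A [Ak cZ EA le]] := dens_step kn.
have z0 : 0 < (n - k)%:R :> R by rewrite ltr0n subn_gt0.
have zE : (n - k)%:R = n%:R - k%:R :> R by rewrite natrB // ltnW.
suff : (n - k)%:R * (2 * (p * k%:R - 8 * s)) <= (n - k)%:R * (M k.+1 - M k).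
  by rewrite ler_pM2l //; lra.
apply: le_trans le.
have E : (pairs_between H (~: A) A)%:R + (inner_pairs H (~: A))%:R =
    \sum_(v in ~: A) (degree H v)%:R :> R.
  by rewrite -natrD -natr_sum; congr _%:R; rewrite sum_degree setCK.
have lb : (n - k)%:R * (p * n%:R - 4 * s) <= \sum_(v in ~: A) (degree H v)%:R.
  by rewrite mulr_natl -cZ -sumr_const; apply: ler_sum => v _; apply: (deg_lb degA).
have := inner_ub densB (~: A); rewrite /= cZ => ub.
have sq := sqrt_le_s s0 L0 sL (leq_subr k n).
have q : (n - k)%:R * Num.sqrt ((n - k)%:R * L) <= (n - k)%:R * s by rewrite ler_pM2l.
have pz : 0 <= p * (n - k)%:R by rewrite mulr_ge0 // ltW.
have kE : (n - k)%:R * (p * (n - k)%:R) = (n - k)%:R * (p * n%:R - p * k%:R) :> R.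
  by rewrite {2}zE mulrBr.
lra.
Qed.

(** For small [k] the error 8 s of the previous bound exceeds p k. Counting from inside [A] is
    better: each of its [k] vertices has all but at most [k] of its neighbours outside, and k + 4 s
    is at most one percent of p n. *)
Lemma dens_step_small (k : nat) : (0 < k)%N -> (k < n)%N -> 4 * s + k%:R <= p / 100 * n%:R ->
  M k + 2 * (99 / 100 * p) * k%:R <= M k.+1.
Proof.
move=> k0 kn ks; have [A [Ak cZ EA le]] := dens_step kn.
have z0 : 0 < (n - k)%:R :> R by rewrite ltr0n subn_gt0.
suff : (n - k)%:R * (2 * (99 / 100 * p) * k%:R) <= (n - k)%:R * (M k.+1 - M k).
  by rewrite ler_pM2l //; lra.
apply: le_trans le.
have E : (pairs_between H (~: A) A)%:R + (inner_pairs H A)%:R =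
    \sum_(v in A) (degree H v)%:R :> R.
  by rewrite -natrD -natr_sum; congr _%:R; rewrite sum_degree pairs_betweenC.
have lb : k%:R * (p * n%:R - 4 * s) <= \sum_(v in A) (degree H v)%:R.
  by rewrite mulr_natl -Ak -sumr_const; apply: ler_sum => v _; apply: (deg_lb degA).
have ub : (inner_pairs H A)%:R <= k%:R * k%:R :> R.
  by rewrite -natrM ler_nat -{1}Ak -Ak; apply: pairs_between_le.
have kp : 0 < k%:R :> R by rewrite ltr0n.
have h1 : k%:R * (4 * s + k%:R) <= k%:R * (p / 100 * n%:R) by rewrite ler_pM2l.
have zn : (n - k)%:R <= n%:R :> R by rewrite ler_nat leq_subr.
have h2 : (99 / 100 * p) * k%:R * (n - k)%:R <= (99 / 100 * p) * k%:R * n%:R.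
  by rewrite ler_wpM2l //; have := mulr_gt0 p0 kp; lra.
lra.
Qed.

Lemma dens_steps_large (a b : nat) : (a + b <= n)%N ->
  M a + 2 * p * a%:R * b%:R + p * b%:R * (b%:R - 1) - 16 * b%:R * s <= M (a + b).
Proof.
elim: b => [|b IH] abn; first by rewrite addn0; lra.
have {}IH := IH ltac:(lia); rewrite addnS.
have := @dens_step_large (a + b) ltac:(lia); rewrite natrD -natr1; lra.
Qed.

Lemma dens_steps_small (a b : nat) : (0 < a)%N -> (a + b <= n)%N ->
  4 * s + (a + b)%:R <= p / 100 * n%:R ->
  M a + (99 / 100 * p) * (2 * a%:R * b%:R + b%:R * (b%:R - 1)) <= M (a + b).
Proof.
move=> a0; elim: b => [|b IH] abn sm; first by rewrite addn0; lra.
have sm' : 4 * s + (a + b)%:R <= p / 100 * n%:R.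
  by apply: le_trans sm; rewrite lerD2l ler_nat addnS.
rewrite addnS in abn; have {}IH := IH (ltnW abn) sm'; rewrite addnS.
have := dens_step_small (ltn_addr b a0) abn sm'; rewrite natrD -natr1; lra.
Qed.

Lemma dens_ub (b : nat) : (b <= n)%N ->
  M b <= p * b%:R * (b%:R - 1) + 4 * b%:R * Num.sqrt (b%:R * L).
Proof.
move=> bn; have [B Bb EB] := @dens_ex _ H b ltac:(by rewrite card_ord).
by have := inner_ub densB B; rewrite /= Bb EB.
Qed.

Hypothesis small_ext : forall (A : {set 'I_n}) (b : nat), (2 <= b)%N -> (b <= #|A|)%N ->
  p ^+ 2 * #|A|%:R <= 5 * L -> 12 / 5 * p * b%:R ^+ 2 <= M b ->
  exists W : {set 'I_n}, [/\ #|W| = b, [disjoint A & W] &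
    forall w, w \in W -> (dens H b < 2 * b * pairs_between H [set w] A)%N].

(** When [a] is at least of order [s], or [M b] is not unusually large, averaging suffices.
    Otherwise [a] is O(L), and [small_ext] gives [b] vertices, each with more than M b / (2 b)
    neighbours in [A]; counted twice, these edges exceed [M b]. *)
Lemma dens_superadd (a b : nat) : (0 < b)%N -> (b <= a)%N -> (a + b <= n)%N ->
  (dens H a + dens H b < dens H (a + b))%N.
Proof.
move=> b0 ba abn; rewrite -(ltr_nat R) natrD -/(M a) -/(M b) -/(M (a + b)).
have bn : (b <= n)%N := leq_trans (leq_addl a b) abn.
have an : (a <= n)%N := leq_trans (leq_addr b a) abn.
have ub := dens_ub bn; have b0' : 0 < b%:R :> R by rewrite ltr0n.
have ba' : b%:R <= a%:R :> R by rewrite ler_nat.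
case: (ltrP (10 * s) (p * a%:R)) => [big|small].
  have := dens_steps_large abn.
  have q : b%:R * Num.sqrt (b%:R * L) <= b%:R * s by rewrite ler_pM2l // (sqrt_le_s s0 L0 sL).
  have : b%:R * (10 * s) < b%:R * (p * a%:R) by rewrite ltr_pM2l.
  lra.
have small' : a%:R <= 10 / p * s.
  have -> : a%:R = p * a%:R / p by field; rewrite gt_eqF.
  have -> : 10 / p * s = 10 * s / p by field; rewrite gt_eqF.
  by rewrite ler_pM2r // invr_gt0.
have sm : 4 * s + (a + b)%:R <= p / 100 * n%:R.
  apply: le_trans s_small; rewrite natrD.
  by have -> : (4 + 20 / p) * s = 4 * s + 2 * (10 / p * s); [ring|lra].
have low := dens_steps_small (leq_trans b0 ba) abn sm.
rewrite real_ltNge ?num_real //; apply/negP => bad.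
have a0' : 0 < a%:R :> R by lra.
have pab : p * b%:R * b%:R <= p * b%:R * a%:R by rewrite ler_pM2l // mulr_gt0.
have b2 : (2 <= b)%N.
  rewrite ltn_neqAle b0 andbT; apply/eqP => b1.
  have M1 : M b = 0.
    have [B /eqP Bb EB] := @dens_ex _ H b ltac:(by rewrite card_ord).
    have /cards1P[x Bx] : #|B| == 1%N by rewrite b1.
    by rewrite /M -EB Bx inner_pairs1.
  have b1' : b%:R = 1 :> R by rewrite -b1.
  have : 0 < p * a%:R by rewrite mulr_gt0.
  by move: low bad; rewrite M1 b1'; lra.
have b2' : 2 <= b%:R :> R by rewrite ler_nat.
have pb2 : p * b%:R * 2 <= p * b%:R * b%:R by rewrite ler_pM2l // mulr_gt0.
(* A failure makes [M b] at least 0.99 p (2 a b + b (b - 1)), which for a >= b >= 2 is more than 2.4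
   p b^2. *)
have Mb : 12 / 5 * p * b%:R ^+ 2 <= M b.
  have : 0 < p * b%:R * b%:R by rewrite !mulr_gt0.
  rewrite expr2; lra.
have sqa : Num.sqrt (b%:R * L) <= Num.sqrt (a%:R * L).
  by rewrite ler_wsqrtr // ler_pM2r.
(* Against the upper bound for [M b], a failure leaves only this inequality, which confines [a] to
   O(L). *)
have key : 197 / 100 * (p * a%:R) <= 4 * Num.sqrt (a%:R * L).
  have : b%:R * (197 / 100 * (p * a%:R)) <= b%:R * (4 * Num.sqrt (a%:R * L)).
    have : b%:R * Num.sqrt (b%:R * L) <= b%:R * Num.sqrt (a%:R * L) by rewrite ler_pM2l.
    have : 0 < p * b%:R by rewrite mulr_gt0.
    lra.
  by rewrite ler_pM2l.
have key2 : p ^+ 2 * a%:R <= 5 * L.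
  have pa : 0 <= p * a%:R by rewrite mulr_ge0 // ltW.
  have : (197 / 100 * (p * a%:R)) ^+ 2 <= (4 * Num.sqrt (a%:R * L)) ^+ 2.
    have k1 : 0 <= 197 / 100 * (p * a%:R) by lra.
    have k2 : 0 <= 4 * Num.sqrt (a%:R * L) by rewrite mulr_ge0 ?sqrtr_ge0.
    by rewrite ler_sqr.
  have aL : 0 < a%:R * L by rewrite mulr_gt0.
  rewrite [X in _ <= X]exprMn sqr_sqrtr ?(ltW aL) // => h.
  have : a%:R * (p ^+ 2 * a%:R) <= a%:R * (5 * L) by rewrite expr2 in h *; lra.
  by rewrite ler_pM2l.
have [A Aa EA] := @dens_ex _ H a ltac:(by rewrite card_ord).
have [W [Wb dAW hW]] := @small_ext A b b2 ltac:(by rewrite Aa) ltac:(by rewrite Aa) Mb.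
have : (dens H a + dens H b < dens H (a + b))%N.
  have cU : #|A :|: W| = (a + b)%N.
    by rewrite cardsU (eqP (_ : A :&: W == set0)) ?setI_eq0 // cards0 subn0 Aa Wb.
  have := dens_ge H (A :|: W); rewrite cU inner_pairsU // EA pairs_betweenC pairs_between_sum => h.
  have : (\sum_(w in W) (dens H b).+1 <= \sum_(w in W) 2 * b * pairs_between H [set w] A)%N.
    by apply: leq_sum => w; apply: hW.
  rewrite sum_nat_const Wb -big_distrr /= -mulnA.
  rewrite [(2 * (b * _))%N]mulnCA leq_pmul2l // => h2.
  by apply: leq_trans h; rewrite -addnS -[X in (_ <= X)%N]addnA leq_add2l; apply: leq_trans h2 (leq_addr _ _).
by rewrite -(ltr_nat R) natrD => /lt_le_trans/(_ bad); rewrite ltxx.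
Qed.

End Superadditivity.

(** * The profile of a pseudorandom graph *)

Section Assembly.

(** Substituting a = n - x and b = n - y turns superadditivity of [dens] into the last condition of
    [profile]. *)
Lemma cost_supermod (n : nat) (H : sgraph 'I_n) :
  (forall a b, (0 < b)%N -> (b <= a)%N -> (a + b <= n)%N ->
    (dens H a + dens H b < dens H (a + b))%N) ->
  forall x y, (x < n)%N -> (y < n)%N -> (n <= x + y)%N ->
    (cost H n + cost H (x + y - n) < cost H x + cost H y)%N.
Proof.
move=> sup x y xn yn xyn.
have dc z : (z <= n)%N -> (cost H z + dens H (n - z) = dens H n)%N.
  by move=> zn; have := @dens_cost _ H z; rewrite card_ord; apply.
have sup' a b : (0 < a)%N -> (0 < b)%N -> (a + b <= n)%N ->
    (dens H a + dens H b < dens H (a + b))%N.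
  move=> a0 b0 abn; case: (leqP b a) => [ba|/ltnW ab]; first exact: sup.
  by rewrite addnC [(a + b)%N]addnC; apply: sup; rewrite // addnC.
have := sup' (n - x)%N (n - y)%N; rewrite !subn_gt0 => /(_ xn yn).
have -> : (n - x + (n - y) = n - (x + y - n))%N by lia.
move=> /(_ (leq_subr _ _)).
have := dc _ (ltnW xn); have := dc _ (ltnW yn); have := dc n (leqnn n).
have := dc (x + y - n)%N ltac:(lia).
move: (cost H) (dens H) => f d; lia.
Qed.

(** [gamma.+1] is the least m >= 2 with f m <= m * f 1. It exceeds c s because the minimum degree is
    isolated, and is at most [r0] by the crude bound. The constant 12 / p only has to exceed the
    threshold 10 / p of crude subadditivity; 24 / p, 36 / p and 48 / p are its multiples. *)
Lemma pseudorandom_profile (R : rcfType) (n : nat) (H : sgraph 'I_n)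
  (p s L c xs zeta kap : R) (u : 'I_n) (K0 w r0 : nat) :
  0 < p -> p < 1 -> 1 <= s -> 0 < L -> s ^+ 2 = n%:R * L ->
  (forall v, `|(degree H v)%:R - p * n%:R| <= 4 * s) ->
  (forall Z : {set 'I_n},
    `|(inner_pairs H Z)%:R - p * #|Z|%:R * (#|Z|%:R - 1)| <=
    4 * #|Z|%:R * Num.sqrt (#|Z|%:R * L)) ->
  (4 + 20 / p) * s <= p / 100 * n%:R ->
  (forall (A : {set 'I_n}) (b : nat), (2 <= b)%N -> (b <= #|A|)%N ->
    p ^+ 2 * #|A|%:R <= 5 * L -> 12 / 5 * p * b%:R ^+ 2 <= (dens H b)%:R ->
    exists W : {set 'I_n}, [/\ #|W| = b, [disjoint A & W] &
      forall v, v \in W -> (dens H b < 2 * b * pairs_between H [set v] A)%N]) ->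
  4 <= c * s ->
  (forall v, v != u -> (degree H u + K0 <= degree H v)%N) -> (0 < K0)%N ->
  (#|[set v | ((degree H v)%:R <= (degree H u)%:R + 2 * c * s :> R)%R]| <= K0)%N ->
  0 < c -> 0 <= zeta -> 0 < kap -> xs <= p * n%:R ->
  36 / p * s <= #|[set v | (degree H v)%:R <= xs]|%:R ->
  #|[set v | (degree H v)%:R <= xs - zeta * s]|%:R <= zeta * s ->
  48 / p * L <= kap ^+ 2 * s ->
  2 * zeta * c + 8 * zeta <= p * c ^+ 2 / 2 ->
  50 * kap <= p * c -> p <= kap * s ->
  12 / p * s <= w%:R -> w%:R <= 24 / p * s ->
  16 * s <= p * (r0%:R - 1) -> p * r0%:R <= 18 * s ->
  exists gamma : nat, profile n gamma (cost H) /\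
    c / 2 * s <= gamma%:R /\ gamma%:R <= 18 / p * s.
Proof.
move=> p0 p1 s1 L0 sL degA densB s_small small_ext cs4 gap K00 near c0 z0 kap0 xs_le
  Low_ge Few_le kapC zs ks ps wl wu r0l r0u.
have s0 : 0 < s by apply: lt_le_trans s1.
have n0 : (0 < n)%N := leq_ltn_trans (leq0n _) (ltn_ord u).
have C0 : 0 < 12 / p by rewrite divr_gt0.
have lowge : 3 * (12 / p) * s <= #|[set v | (degree H v)%:R <= xs]|%:R by clear -Low_ge; lra.
have kapC' : 4 * (12 / p) * L <= kap ^+ 2 * s by clear -kapC; lra.
have wu' : w%:R <= 2 * (12 / p) * s by clear -wu; lra.
have ip : 1 < p^-1 by rewrite invf_gt1.
have r0u' : r0%:R <= 18 / p * s.
  have -> : r0%:R = p * r0%:R / p by field; rewrite gt_eqF.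
  have -> : 18 / p * s = 18 * s / p by field; rewrite gt_eqF.
  by rewrite ler_pM2r // invr_gt0.
have ps0 : 0 < p * s by rewrite mulr_gt0.
have isp : s < s / p by rewrite ltr_pMr.
have pn : (4 + 20 / p) * s <= n%:R / 100.
  apply: le_trans s_small _; have : p * n%:R <= 1 * n%:R by rewrite ler_wpM2r // ltW.
  by clear; lra.
have big : 2 * (18 / p * s) + 2 <= n%:R by clear -pn s1 isp s0; lra.
have r0n : (r0 <= n)%N by rewrite -(ler_nat R); clear -r0u' big s1 isp s0; lra.
have r02 : (2 <= r0)%N.
  have h0 : 0 < r0%:R - 1 :> R by rewrite -(pmulr_rgt0 _ p0); clear -r0l s0; lra.
  have h1 : p * (r0%:R - 1) < 1 * (r0%:R - 1) by rewrite ltr_pM2r.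
  by rewrite -(ler_nat R); clear -h1 r0l s1; lra.
set f := cost H.
pose P r := (2 <= r)%N && (f r <= r * f 1)%N.
have exP : exists r, P r.
  exists r0; rewrite /P r02 -(ler_nat R) natrM.
  exact: (cost_le_linear_large p0 p1 s0 L0 sL degA densB r0n (ltnW r02) r0l).
case: (ex_minnP exP) => m /andP[m2 fm] mmin.
have mr0 : (m <= r0)%N.
  apply: mmin; rewrite /P r02 -(ler_nat R) natrM.
  exact: (cost_le_linear_large p0 p1 s0 L0 sL degA densB r0n (ltnW r02) r0l).
have small k : (2 <= k)%N -> (k <= n)%N -> k%:R <= c * s -> (k * f 1 < f k)%N.
  move=> k2 kn kc; rewrite -(ltr_nat R) natrM.
  exact: (cost_gt_linear p0 p1 s0 L0 gap K00 near k2 kn kc).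
have mn : (m <= n)%N := leq_trans mr0 r0n.
have cm : c * s < m%:R.
  rewrite real_ltNge ?num_real //; apply/negP => h.
  by have := small m m2 mn h; rewrite ltnNge fm.
have [g mg] : exists g, m = g.+1 by exists m.-1; rewrite prednK // (ltn_trans _ m2).
subst m.
have gR : g.+1%:R = g%:R + 1 :> R by rewrite -natr1.
have g2 : (2 <= g)%N by rewrite -ltnS -(ltr_nat R); clear -cm cs4 gR; lra.
have cg x : (g < x)%N -> c * s <= x%:R.
  by move=> gx; apply: ltW; apply: lt_le_trans cm _; rewrite ler_nat.
have C10 x : 12 / p * s < x%:R -> 10 * s < p * x%:R.
  move=> h; have : p * (12 / p * s) < p * x%:R by rewrite ltr_pM2l.
  have -> : p * (12 / p * s) = 12 * s by field; rewrite gt_eqF.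
  lra.
have large x y : 12 / p * s < x%:R -> (0 < y)%N -> (x + y <= n)%N -> (f (x + y) < f x + f y)%N.
  move=> hx y0 xyn; rewrite -(ltr_nat R) natrD.
  exact: (cost_subadd_large p0 p1 s0 L0 sL degA densB (C10 _ hx) y0 xyn).
(* The increment bound needs [f x <= x * f 1], which it reproduces at [x.+1]; the induction [lin]
   starts at the switch. *)
have linS x : (g < x)%N -> (x < n)%N -> (f x <= x * f 1)%N -> (f x.+1 < f x + f 1)%N.
  move=> gx xn fx; case: (ltrP (12 / p * s) x%:R) => [hx|hx].
    by have := large x 1%N hx isT; rewrite addn1; apply.
  rewrite -(ltr_nat R) natrD.
  apply: (cost_incr_mid p0 s0 L0 degA densB c0 C0 z0 kap0 xs_le lowge Few_le kapC' zs ks wl wu' (cg _ gx) hx xn).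
  by rewrite -natrM ler_nat.
have lin x : (g < x)%N -> (x <= n)%N -> (f x <= x * f 1)%N.
  elim: x => // x IH; rewrite ltnS leq_eqVlt => /orP[/eqP<- //|gx] xn.
  have fx := IH gx (ltnW xn); apply: leq_trans (ltnW (linS x gx xn fx)) _.
  by rewrite mulSn addnC leq_add2l.
exists g; split; last first.
  split; first by clear -cm gR cs4; lra.
  by apply: le_trans r0u'; rewrite ler_nat; apply: ltnW.
split=> //.
- have : g%:R <= r0%:R :> R by rewrite ler_nat; apply: ltnW.
  by rewrite -(ler_nat R) natrD natrM; clear -big r0u'; lra.
- exact: cost0.
- move=> x /andP[x2 xg]; rewrite ltnNge; apply/negP => h.
  by have := mmin x; rewrite /P x2 h => /(_ isT); rewrite leqNgt ltnS xg.
- by move=> x /andP[gx xn]; apply: linS => //; apply: lin => //; apply: ltnW.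
- move=> x y gx gy xyn; case: (ltrP (12 / p * s) x%:R) => [hx|hx].
    by apply: large; rewrite // (leq_ltn_trans _ gy).
  case: (ltrP (12 / p * s) y%:R) => [hy|hy].
    by rewrite addnC [(f x + _)%N]addnC; apply: large; rewrite // ?(leq_ltn_trans _ gx) // addnC.
  rewrite -(ltr_nat R) natrD.
  exact: (cost_subadd_mid p0 s0 L0 degA densB c0 C0 z0 kap0 xs_le lowge Few_le kapC' zs ks ps (cg _ gx) (cg _ gy) hx hy xyn).
- apply: cost_supermod => a b.
  exact: (dens_superadd p0 p1 s0 L0 sL degA densB s_small small_ext).
Qed.

End Assembly.

(** * Random subsets and random graphs *)

Lemma set_rect_U1 (T : finType) (P : {set T} -> Prop) : P set0 ->
  (forall x (D : {set T}), x \notin D -> P D -> P (x |: D)) -> forall D, P D.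
Proof.
move=> h0 hU D; have [m] := ubnP #|D|; elim: m D => // m IH D Dm.
have [->//|[x xD]] := set_0Vmem D.
rewrite -(setD1K xD); apply: hU; first by rewrite !inE eqxx.
by apply: IH; rewrite (cardsD1 x D) xD in Dm; lia.
Qed.

Section RandomSubset.
Variables (R : realFieldType) (p : R).
Hypotheses (p0 : 0 < p) (p1 : p < 1).
Local Notation q := (1 - p).

(** The expectation of [F] over a random subset of [D], as a finite sum. Keeping [D] as a parameter
    makes independence a matter of disjoint sets. *)
Definition bern (T : finType) (D : {set T}) (F : {set T} -> R) : R :=
  \sum_(S : {set T} | S \subset D) p ^+ #|S| * q ^+ #|D :\: S| * F S.

Definition binpmf (N k : nat) : R := p ^+ k * q ^+ (N - k) *+ 'C(N, k).

Section Calculus.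
Variable T : finType.
Implicit Types (D S A B : {set T}) (F G : {set T} -> R).

Lemma eq_bern D F G : (forall S, S \subset D -> F S = G S) -> bern D F = bern D G.
Proof. by move=> h; apply: eq_bigr => S SD; rewrite h. Qed.

Lemma bern0 F : bern set0 F = F set0.
Proof.
rewrite /bern (big_pred1 set0) => [|S /=]; last by rewrite subset0.
by rewrite setD0 cards0 !expr0 !mul1r.
Qed.

Lemma weight_ge0 D S : 0 <= p ^+ #|S| * q ^+ #|D :\: S|.
Proof. by rewrite mulr_ge0 // exprn_ge0 // ?subr_ge0 ltW. Qed.

Lemma ler_bern D F G : (forall S, S \subset D -> F S <= G S) -> bern D F <= bern D G.
Proof. by move=> h; apply: ler_sum => S SD; rewrite ler_wpM2l ?weight_ge0 ?h. Qed.

Lemma bernD D F G : bern D (fun S => F S + G S) = bern D F + bern D G.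
Proof. by rewrite /bern -big_split; apply: eq_bigr => S _; rewrite mulrDr. Qed.

Lemma bernZ D F (c : R) : bern D (fun S => c * F S) = c * bern D F.
Proof. by rewrite /bern mulr_sumr; apply: eq_bigr => S _; rewrite mulrCA. Qed.

Lemma bern_sum D (I : Type) (r : seq I) (P : pred I) (F : I -> {set T} -> R) :
  bern D (fun S => \sum_(i <- r | P i) F i S) = \sum_(i <- r | P i) bern D (F i).
Proof. by rewrite /bern exchange_big; apply: eq_bigr => S _; rewrite mulr_sumr. Qed.

(** Conditioning on whether [x] is chosen; most rules below follow from this one by induction on the
    set. *)
Lemma bernU1 x D F : x \notin D ->
  bern (x |: D) F = p * bern D (fun S => F (x |: S)) + q * bern D F.
Proof.
move=> xD; rewrite /bern (bigID (fun S : {set T} => x \in S)) /=; congr (_ + _).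
  rewrite (reindex_onto (fun S : {set T} => x |: S) (fun S => S :\ x)) /=; last first.
    by move=> S /andP[_ xS]; rewrite setD1K.
  rewrite mulr_sumr; apply: eq_big => S.
    rewrite !inE eqxx /= andbT; apply/andP/idP => [[h /eqP E]|SD].
      by rewrite -E; apply/subsetP => y; rewrite !inE => /andP[yx] /orP[/eqP/eqP|yS];
        [rewrite (negbTE yx)|have := subsetP h y; rewrite !inE yS orbT (negbTE yx); apply].
    have xS : x \notin S by apply: contra xD; apply: (subsetP SD).
    by rewrite setUS // setU1K.
  move=> /andP[/andP[h _] /eqP E]; have xS : x \notin S by rewrite -E !inE eqxx.
  rewrite cardsU1 xS exprS -!mulrA; do 3 congr (_ * _); congr (_ ^+ _).
  apply: eq_card => y; rewrite !inE; case: (eqVneq y x) => //= ->.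
  by rewrite (negbTE xD) andbF.
rewrite mulr_sumr; apply: eq_big => S.
  apply/andP/idP => [[h xS]|SD].
    apply/subsetP => y yS; have := subsetP h y yS; rewrite !inE => /orP[/eqP E|//].
    by rewrite -E yS in xS.
  split; last by apply: contra xD; apply: (subsetP SD).
  exact: subset_trans SD (subsetUr _ _).
move=> /andP[h xS]; have -> : (x |: D) :\: S = x |: (D :\: S).
  by apply/setP => y; rewrite !inE; case: (eqVneq y x) => //= ->; rewrite xS.
by rewrite cardsU1 !inE (negbTE xD) andbF /= exprS; rewrite !mulrA [q * _]mulrC.
Qed.

Lemma bern_cst D (c : R) : bern D (fun=> c) = c.
Proof.
elim/set_rect_U1: D => [|x D xD IH]; first by rewrite bern0.
by rewrite bernU1 // IH -mulrDl addrCA subrr addr0 mul1r.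
Qed.

Lemma bern_ge0 D F : (forall S, 0 <= F S) -> 0 <= bern D F.
Proof. by move=> h; rewrite -(bern_cst D 0); apply: ler_bern. Qed.

Lemma bernU D1 D2 F : [disjoint D1 & D2] ->
  bern (D1 :|: D2) F = bern D1 (fun S1 => bern D2 (fun S2 => F (S1 :|: S2))).
Proof.
elim/set_rect_U1: D1 F => [|x D xD IH] F dis.
  by rewrite bern0 set0U; apply: eq_bern => S _; rewrite set0U.
have dD : [disjoint D & D2] by apply: disjointWl dis; apply: subsetUr.
have xD2 : x \notin D2.
  by have /pred0P/(_ x) := dis; rewrite /= !inE eqxx /= => /negbT.
rewrite -setUA bernU1; last by rewrite !inE negb_or xD.
rewrite !IH // bernU1 //; congr (_ * _ + _).
by apply: eq_bern => S1 _; apply: eq_bern => S2 _; rewrite setUA.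
Qed.

Lemma bern_indep A B D F G : [disjoint A & B] -> A \subset D -> B \subset D ->
  bern D (fun S => F (S :&: A) * G (S :&: B)) = bern A F * bern B G.
Proof.
move=> dAB AD BD.
have E : D = A :|: (B :|: D :\: (A :|: B)).
  by rewrite setUA -{1}(setID D (A :|: B)) (setIidPr _) // subUset AD.
have d1 : [disjoint A & B :|: D :\: (A :|: B)].
  apply/pred0P => x /=; rewrite !inE; case xA: (x \in A) => //=.
  by have /pred0P/(_ x) /= := dAB; rewrite xA /= => ->.
have d2 : [disjoint B & D :\: (A :|: B)].
  by apply/pred0P => x /=; rewrite !inE; case xB: (x \in B); rewrite //= orbT.
rewrite {1}E bernU //.
transitivity (bern A (fun S1 => F S1 * bern B G)); last first.
  by rewrite -[RHS]mulrC -bernZ; apply: eq_bern => S _; rewrite mulrC.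
apply: eq_bern => S1 S1A; rewrite bernU //.
transitivity (bern B (fun S2 => F S1 * G S2)); last by rewrite bernZ.
apply: eq_bern => S2 S2B; rewrite -[RHS](bern_cst (D :\: (A :|: B))).
apply: eq_bern => S3 S3D; congr (F _ * G _); apply/setP => x; rewrite !inE.
- case xA: (x \in A); last first.
    by rewrite andbF; apply/esym/negbTE/negP => /(subsetP S1A); rewrite xA.
  rewrite andbT; case xS2: (x \in S2).
    by have /pred0P/(_ x) /= := dAB; rewrite xA (subsetP S2B).
  case xS3: (x \in S3); rewrite ?orbF //.
  by have := subsetP S3D x xS3; rewrite !inE xA.
- case xB: (x \in B); last first.
    by rewrite andbF; apply/esym/negbTE/negP => /(subsetP S2B); rewrite xB.
  rewrite andbT; case xS1: (x \in S1).
    by have /pred0P/(_ x) /= := dAB; rewrite xB (subsetP S1A).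
  case xS3: (x \in S3); rewrite ?orbF //.
  by have := subsetP S3D x xS3; rewrite !inE xB orbT.
Qed.

Lemma bern_marginal A D F : A \subset D -> bern D (fun S => F (S :&: A)) = bern A F.
Proof.
move=> AD; have := @bern_indep A set0 D F (fun=> 1) _ AD (sub0set D).
rewrite bern0 mulr1 => <-; last by rewrite -setI_eq0 setI0.
by apply: eq_bern => S _; rewrite mulr1.
Qed.

Lemma bern_prod (I : finType) (W : {set I}) (A : I -> {set T}) D
    (F : I -> {set T} -> R) :
  {in W &, forall i j, i != j -> [disjoint A i & A j]} ->
  (forall i, i \in W -> A i \subset D) ->
  bern D (fun S => \prod_(i in W) F i (S :&: A i)) = \prod_(i in W) bern (A i) (F i).
Proof.
elim/set_rect_U1: W => [|i W iW IH] dis sub.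
  by rewrite big_set0 -[RHS](bern_cst D); apply: eq_bern => S _; rewrite big_set0.
rewrite big_setU1 //= -IH; first last.
- by move=> j jW; apply: sub; rewrite !inE jW orbT.
- by move=> j k jW kW; apply: dis; rewrite !inE ?jW ?kW orbT.
pose B := \bigcup_(j in W) A j.
have sB j : j \in W -> A j \subset B by move=> jW; apply: bigcup_sup.
have BD : B \subset D by apply/bigcupsP => j jW; apply: sub; rewrite !inE jW orbT.
pose G (S : {set T}) := \prod_(j in W) F j (S :&: A j).
have EG S : G S = G (S :&: B).
  by apply: eq_bigr => j jW; rewrite -setIA (setIidPr (sB j jW)).
have -> : bern D G = bern B G.
  by rewrite -(bern_marginal G BD); apply: eq_bern => S _; rewrite EG.
rewrite -(@bern_indep (A i) B D).
- by apply: eq_bern => S _; rewrite big_setU1 //= -EG.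
- rewrite disjoint_sym; apply/pred0P => x /=; apply/negP => /andP[/bigcupP[j jW xj] xi].
  have ij : i != j by apply: contraNneq iW => ->.
  by have /pred0P/(_ x) /= := dis i j (setU11 _ _) (setU1r _ jW) ij; rewrite xi xj.
- by apply: sub; rewrite !inE eqxx.
- exact: BD.
Qed.

Lemma bern_pow D (z : R) : bern D (fun S => z ^+ #|S|) = (p * z + q) ^+ #|D|.
Proof.
elim/set_rect_U1: D => [|x D xD IH]; first by rewrite bern0 cards0 !expr0.
rewrite bernU1 // [#|x |: D|]cardsU1 xD add1n exprS -IH [RHS]mulrDl; congr (_ + _).
rewrite -[RHS]mulrA; congr (p * _); rewrite -bernZ; apply: eq_bern => S SD.
by rewrite cardsU1 (contra (subsetP SD x) xD) add1n exprS.
Qed.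

Lemma bern_card D (g : nat -> R) :
  bern D (fun S => g #|S|) = \sum_(k < #|D|.+1) binpmf #|D| k * g k.
Proof.
rewrite /bern (partition_big (fun S : {set T} => inord #|S| : 'I_#|D|.+1) predT) //=.
apply: eq_bigr => k _.
transitivity (\sum_(S : {set T} | (S \subset D) && (#|S| == k)) p ^+ k * q ^+ (#|D| - k) * g k).
  apply: eq_big => S.
    case: (boolP (S \subset D)) => //= SD.
    by rewrite -val_eqE /= inordK // ltnS subset_leq_card.
  move=> /andP[SD /eqP <-]; rewrite inordK ?ltnS ?subset_leq_card //.
  by rewrite cardsD (setIidPr SD).
rewrite /binpmf mulrnAl -(cards_draws D k) -sumr_const.
by apply: eq_bigl => S; rewrite inE.
Qed.

End Calculus.

Lemma binpmf_ge0 N k : 0 <= binpmf N k.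
Proof. by rewrite mulrn_wge0 // mulr_ge0 // exprn_ge0 // ?subr_ge0 ltW. Qed.

Lemma binpmf_sum_pow N (z : R) : \sum_(k < N.+1) binpmf N k * z ^+ k = (p * z + q) ^+ N.
Proof.
rewrite addrC exprDn; apply: eq_bigr => k _.
by rewrite /binpmf mulrnAl exprMn; congr (_ *+ _); rewrite [p ^+ k * _]mulrC mulrA.
Qed.

Lemma binpmf_sum1 N : \sum_(k < N.+1) binpmf N k = 1.
Proof.
have := binpmf_sum_pow N 1; rewrite mulr1 addrC subrK expr1n => <-.
by apply: eq_bigr => k _; rewrite expr1n mulr1.
Qed.

Lemma binpmfE N k : binpmf N k = 'C(N, k)%:R * (p ^+ k * q ^+ (N - k)).
Proof. by rewrite /binpmf mulr_natl. Qed.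

Lemma binpmf_succ N k : (k < N)%N ->
  binpmf N k.+1 * (k.+1%:R * q) = binpmf N k * ((N - k)%:R * p).
Proof.
move=> kN; rewrite !binpmfE; have -> : (N - k = (N - k.+1).+1)%N by lia.
rewrite exprS [q ^+ (N - k.+1).+1]exprS.
have : 'C(N, k.+1)%:R * k.+1%:R = 'C(N, k)%:R * (N - k.+1).+1%:R :> R.
  by rewrite -!natrM mulnC mul_bin_left mulnC; congr (_ * _)%:R; lia.
move: (q ^+ (N - k.+1)) (p ^+ k) ('C(N, k.+1)%:R) ('C(N, k)%:R) (k.+1%:R) ((N - k.+1).+1%:R)
  => X Y a b c d E.
transitivity (a * c * (p * Y * X * q)); first by ring.
by rewrite E; ring.
Qed.

End RandomSubset.

(** * The random graph as a random set of pairs *)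

Section RandomGraph.
Variables (n : nat).
Implicit Types (B Z : {set 'I_n}) (S : {set {set 'I_n}}) (G : sgraph 'I_n).

Definition all_pairs : {set {set 'I_n}} := [set e : {set 'I_n} | #|e| == 2%N].
Definition star_to (v : 'I_n) B : {set {set 'I_n}} := [set [set v; x] | x in B].
Definition pairs_in Z : {set {set 'I_n}} := [set e in all_pairs | e \subset Z].

Lemma edges_sub G : edges G \subset all_pairs.
Proof. by apply/subsetP => e eG; rewrite inE; apply: (forall_inP (edges_card2 G)). Qed.

Lemma set2_inj (v : 'I_n) : {in ~: [set v] &, injective (fun x => [set v; x])}.
Proof.
move=> x y; rewrite !inE => xv yv E; have : x \in [set v; y] by rewrite -E !inE eqxx orbT.
by rewrite !inE (negbTE xv) => /eqP.
Qed.

Lemma in_pairs_in Z e : (e \in pairs_in Z) = (#|e| == 2%N) && (e \subset Z).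
Proof. by rewrite !inE. Qed.

Lemma card_star_to v B : v \notin B -> #|star_to v B| = #|B|.
Proof.
move=> vB; apply: card_in_imset => x y xB yB; apply: set2_inj; rewrite !inE.
  by apply: contraNneq vB => <-.
by apply: contraNneq vB => <-.
Qed.

Lemma star_to_sub v B : v \notin B -> star_to v B \subset all_pairs.
Proof.
move=> vB; apply/subsetP => e /imsetP[x xB ->]; rewrite inE cards2.
by have -> : v != x by apply: contraNneq vB => ->.
Qed.

Lemma pairs_between_star G v B : v \notin B ->
  pairs_between G [set v] B = #|edges G :&: star_to v B|.
Proof.
move=> vB; rewrite pairs_between1l.
have vne x : x \in B -> x \in ~: [set v].
  by move=> xB; rewrite !inE; apply: contraNneq vB => <-.
have -> : edges G :&: star_to v B = [set [set v; x] | x in [set x in B | adj G v x]].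
  apply/setP => e; rewrite inE; apply/andP/imsetP => [[eG /imsetP[x xB E]]|[x]].
    by exists x; rewrite // inE xB /adj -E.
  by rewrite inE => /andP[xB h] ->; split; [exact: h|apply: imset_f].
rewrite card_in_imset; last first.
  by move=> x y; rewrite !inE => /andP[/vne xv _] /andP[/vne yv _]; apply: set2_inj.
rewrite -sum1_card big_mkcond [RHS]big_mkcond; apply: eq_bigr => x _.
by rewrite inE; case: (x \in B) => //=; case: adj.
Qed.

Lemma degree_star G v : degree G v = #|edges G :&: star_to v (~: [set v])|.
Proof.
rewrite -pairs_between_star ?inE ?eqxx // /degree -[in LHS](setUCr [set v]).
rewrite pairs_betweenUr; last by rewrite -setI_eq0 setICr.
by have := inner_pairs1 G v; rewrite /inner_pairs => ->.
Qed.

Lemma pairs_inU1 x Z : x \notin Z ->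
  pairs_in (x |: Z) = pairs_in Z :|: star_to x Z /\ [disjoint pairs_in Z & star_to x Z].
Proof.
move=> xZ; split; last first.
  apply/pred0P => e /=; apply/negP => /andP[]; rewrite in_pairs_in => /andP[_ eZ] /imsetP[y _ E].
  by move: eZ; rewrite E => /subsetP/(_ x); rewrite !inE eqxx (negbTE xZ) => /(_ isT).
apply/setP => e; rewrite in_setU !in_pairs_in; apply/andP/orP => [[e2 eZ]|[/andP[-> eZ]|/imsetP[y yZ ->]]].
- case: (boolP (x \in e)) => xe; last first.
    left; rewrite e2; apply/subsetP => y ye; have := subsetP eZ y ye.
    by rewrite !inE => /orP[/eqP yx|//]; rewrite -yx ye in xe.
  right; have /cards1P[y ye] : #|e :\ x| == 1%N by have := cardsD1 x e; rewrite xe (eqP e2); case: #|_| => [|[|]].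
  have ey : e = [set x; y] by rewrite -(setD1K xe) ye.
  rewrite ey; apply/imsetP; exists y => //.
  have : y \in e :\ x by rewrite ye inE.
  by rewrite !inE => /andP[yx /(subsetP eZ)]; rewrite !inE (negbTE yx).
- by split=> //; apply: subset_trans eZ (subsetUr _ _).
- have xy : x != y by apply: contraNneq xZ => ->.
  by rewrite cards2 xy; split=> //; rewrite setUS // sub1set.
Qed.

Lemma card_pairs_in Z : #|pairs_in Z| = 'C(#|Z|, 2).
Proof.
elim/set_rect_U1: Z => [|x Z xZ IH].
  rewrite cards0 bin0n; apply/eqP; rewrite cards_eq0; apply/eqP/setP => e; rewrite !inE subset0.
  by apply/negP => /andP[/eqP e2 /eqP e0]; rewrite e0 cards0 in e2.
have [-> d] := pairs_inU1 xZ.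
rewrite cardsU (eqP (_ : _ :&: _ == set0)) ?setI_eq0 // cards0 subn0 IH card_star_to //.
by rewrite cardsU1 xZ add1n binS bin1 addnC.
Qed.

Lemma inner_pairs_in G Z : inner_pairs G Z = (#|edges G :&: pairs_in Z| * 2)%N.
Proof.
elim/set_rect_U1: Z => [|x Z xZ IH].
  rewrite inner_pairs0; have := card_pairs_in set0; rewrite cards0 => /eqP.
  by rewrite cards_eq0 => /eqP->; rewrite setI0 cards0.
have [-> d] := pairs_inU1 xZ.
rewrite inner_pairsU ?disjoints1 // inner_pairs1 IH pairs_between_star // setIUr.
have d' : [disjoint edges G :&: pairs_in Z & edges G :&: star_to x Z].
  by apply: disjointWl (subsetIr _ _) (disjointWr (subsetIr _ _) d).
rewrite cardsU (disjoint_setI0 d') cards0 subn0; lia.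
Qed.

Lemma pairs_in_sub Z : pairs_in Z \subset all_pairs.
Proof. by apply/subsetP => e; rewrite !inE => /andP[]. Qed.

Lemma star_to_disjoint v w (A B : {set 'I_n}) : v != w -> v \notin B ->
  [disjoint star_to v A & star_to w B].
Proof.
move=> vw vB; apply/pred0P => e /=; apply/negP => /andP[/imsetP[x xA ->] /imsetP[y yB E]].
have : v \in [set w; y] by rewrite -E !inE eqxx.
by rewrite !inE (negbTE vw) => /eqP vy; rewrite vy yB in vB.
Qed.

Lemma star_toU v (A B : {set 'I_n}) : star_to v (A :|: B) = star_to v A :|: star_to v B.
Proof. exact: imsetU. Qed.

Section Law.
Variables (R : realFieldType) (p : R).
Hypotheses (p0 : 0 < p) (p1 : p < 1).

(** Events are predicates on edge sets; [sum_sgraph] transfers them to graphs. *)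
Definition gprob (E : pred {set {set 'I_n}}) : R := bern p all_pairs (fun S => (E S)%:R).

Lemma gprob_le (E F : pred {set {set 'I_n}}) :
  (forall S, S \subset all_pairs -> E S -> F S) -> gprob E <= gprob F.
Proof.
move=> h; apply: (ler_bern p0 p1) => S SD; have := h S SD; case: (E S) => [->//|_].
by rewrite ler0n.
Qed.

Lemma gprob_ge0 E : 0 <= gprob E.
Proof. by apply: (bern_ge0 p0 p1). Qed.

Lemma gprob_exists (I : finType) (P : pred I) (E : I -> pred {set {set 'I_n}}) :
  gprob (fun S => [exists i, P i && E i S]) <= \sum_(i | P i) gprob (E i).
Proof.
rewrite -bern_sum; apply: (ler_bern p0 p1) => S _.
case: existsP => [[i /andP[Pi ES]]|_]; last by apply: sumr_ge0 => i _; rewrite ler0n.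
by rewrite (bigD1 i) //= ES lerDl sumr_ge0 // => j _; rewrite ler0n.
Qed.

Lemma gprobU (E F : pred {set {set 'I_n}}) :
  gprob (fun S => E S || F S) <= gprob E + gprob F.
Proof.
rewrite -bernD; apply: (ler_bern p0 p1) => S _.
by case: (E S); case: (F S); rewrite /= ?addr0 ?add0r // lerDl.
Qed.

Lemma gprob_markov (F : {set {set 'I_n}} -> R) (t : R) (E : pred {set {set 'I_n}}) :
  0 < t -> (forall S, S \subset all_pairs -> 0 <= F S) ->
  (forall S, S \subset all_pairs -> E S -> t <= F S) ->
  gprob E <= bern p all_pairs F / t.
Proof.
move=> t0 F0 h; rewrite ler_pdivlMr // mulrC /gprob -bernZ.
apply: (ler_bern p0 p1) => S SD; case ES: (E S); rewrite ?mulr1 ?mulr0; first exact: h.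
exact: F0.
Qed.

Lemma sum_sgraph (F : {set {set 'I_n}} -> R) :
  \sum_(G : sgraph 'I_n) F (edges G) = \sum_(S : {set {set 'I_n}} | S \subset all_pairs) F S.
Proof.
(* The empty graph is only the default value of [insubd]. *)
have h0 : [forall e in (set0 : {set {set 'I_n}}), #|e| == 2%N] by apply/forall_inP => e; rewrite inE.
rewrite [RHS](reindex_onto (@edges 'I_n) (insubd (SGraph h0))) /=.
  by apply: eq_bigl => G; rewrite edges_sub; apply/esym/eqP; exact: (valKd (SGraph h0)).
move=> S SD; have h : [forall e in S, #|e| == 2%N].
  by apply/forall_inP => e eS; have := subsetP SD e eS; rewrite inE.
exact: (insubdK (SGraph h0) h).
Qed.

Lemma Gnp_weightE (G : sgraph 'I_n) :
  \prod_(e : {set 'I_n} | #|e| == 2%N) (if e \in edges G then p else 1 - p) =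
  p ^+ #|edges G| * (1 - p) ^+ #|all_pairs :\: edges G|.
Proof.
rewrite (bigID (fun e => e \in edges G)) /=; congr (_ * _).
  rewrite -prodr_const; apply: eq_big => [e|e /andP[_ ->]//].
  by rewrite andbC; case: (boolP (e \in edges G)) => //= /(subsetP (edges_sub G)); rewrite inE.
rewrite -prodr_const; apply: eq_big => [e|e /andP[_ /negbTE->]//].
by rewrite !inE andbC.
Qed.

End Law.
End RandomGraph.

From mathcomp Require Import all_classical all_reals all_analysis.

Import numFieldNormedType.Exports.

(** * Concentration *)

Section Hoeffding.
Variables (R : realType) (p : R).
Hypotheses (p0 : 0 < p) (p1 : p < 1).
Local Notation q := (1 - p).

(** From 1 - x/2 <= exp(-x/2) it follows that exp x times (1 - x/2)^2 is at most 1, and (1 - x/2)^2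
    (1 + x + x^2) = 1 + x^2 (1 - 3 x + x^2) / 4. Negative [x] of any size are allowed. *)
Lemma expR_le_quadratic (x : R) : x <= 1 / 3 -> expR x <= 1 + x + x ^+ 2.
Proof.
move=> x3; have h : 1 - x / 2 <= expR (- (x / 2)) by apply: expR_ge1Dx.
have h0 : 0 < 1 - x / 2 by lra.
have q0 : 0 < 1 + x + x ^+ 2.
  have : 0 <= (x + 1 / 2) ^+ 2 by apply: sqr_ge0.
  rewrite !expr2; lra.
have key : 1 <= (1 - x / 2) ^+ 2 * (1 + x + x ^+ 2).
  have : 0 <= x ^+ 2 * (1 - 3 * x + x ^+ 2).
    by rewrite mulr_ge0 ?sqr_ge0 //; have := sqr_ge0 x; lra.
  rewrite !expr2; lra.
have E : expR x * expR (- (x / 2)) ^+ 2 = 1.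
  by rewrite expr2 -!expRD (_ : x + _ = 0) ?expR0 //; lra.
have le : expR x * (1 - x / 2) ^+ 2 <= 1.
  by rewrite -[leRHS]E ler_wpM2l ?expR_ge0 // ler_sqr ?nnegrE ?expR_ge0 // ltW.
have s0 : 0 < (1 - x / 2) ^+ 2 by rewrite exprn_gt0.
suff : expR x * (1 - x / 2) ^+ 2 <= (1 + x + x ^+ 2) * (1 - x / 2) ^+ 2 by rewrite ler_pM2r.
by apply: le_trans le _; rewrite [leRHS]mulrC.
Qed.

Lemma centered_mgf_le (lam : R) : `|lam| <= 1 / 3 ->
  p * expR (lam * q) + q * expR (- (lam * p)) <= expR (lam ^+ 2).
Proof.
rewrite ler_norml => /andP[l1 l2]; have pp0 := p0; have pp1 := p1.
have q0 : 0 < q by rewrite subr_gt0.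
have b1 : lam * q <= 1 / 3.
  have [h|h] := lerP 0 lam.
    by have : lam * q <= lam * 1; [rewrite ler_wpM2l //|]; lra.
  by have : lam * q <= 0; [rewrite pmulr_lle0 // ltW|lra].
have b2 : - (lam * p) <= 1 / 3.
  rewrite -mulNr; have [h|h] := lerP 0 (- lam).
    by have : - lam * p <= - lam * 1; [rewrite ler_wpM2l // ltW|]; lra.
  by have : - lam * p <= 0; [rewrite pmulr_lle0 // ltW|lra].
have := expR_le_quadratic b1; have := expR_le_quadratic b2 => e2 e1.
have f1 : p * expR (lam * q) <= p * (1 + lam * q + (lam * q) ^+ 2) by rewrite ler_pM2l.
have f2 : q * expR (- (lam * p)) <= q * (1 + - (lam * p) + (- (lam * p)) ^+ 2) by rewrite ler_pM2l.
apply: le_trans (expR_ge1Dx _).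
apply: le_trans (lerD f1 f2) _.
have pq : p * q <= 1 by rewrite mulr_ile1 // ltW // ?subr_gt0 // gtrBl.
have : lam ^+ 2 * (p * q) <= lam ^+ 2 * 1 by rewrite ler_wpM2l ?sqr_ge0.
rewrite !expr2; lra.
Qed.

Lemma bern_mgf_le (T : finType) (D : {set T}) (lam : R) : `|lam| <= 1 / 3 ->
  bern p D (fun S => expR (lam * (#|S|%:R - p * #|D|%:R))) <= expR (lam ^+ 2 * #|D|%:R).
Proof.
move=> l3; have -> : bern p D (fun S => expR (lam * (#|S|%:R - p * #|D|%:R))) =
    (p * expR (lam * q) + q * expR (- (lam * p))) ^+ #|D|.
  transitivity (bern p D (fun S => expR (- (lam * p)) ^+ #|D| * expR lam ^+ #|S|)).
    apply: eq_bern => S _; rewrite -!expRM_natl -expRD; congr expR; ring.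
  rewrite bernZ bern_pow -exprMn; congr (_ ^+ _).
  have -> : expR (lam * q) = expR (- (lam * p)) * expR lam by rewrite -expRD; congr expR; ring.
  by ring.
rewrite [leRHS](_ : _ = expR (lam ^+ 2) ^+ #|D|); last by rewrite -expRM_natr.
rewrite lerXn2r ?nnegrE ?expR_ge0 ?centered_mgf_le //.
by rewrite addr_ge0 // mulr_ge0 ?expR_ge0 // ltW // subr_gt0.
Qed.

(** The exponential moment is controlled only for parameters up to 1/3, so [lam] is
    [t / (3 * #|D|)], which yields 2/9 in the exponent instead of the optimal 2. For [t] beyond
    [#|D|] the event is empty. *)
Lemma hoeffding (T : finType) (D : {set T}) (t : R) : (0 < #|D|)%N -> 0 <= t ->
  bern p D (fun S => (t < `|#|S|%:R - p * #|D|%:R|)%R%:R) <=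
  2 * expR (- (2 / 9 * t ^+ 2 / #|D|%:R)).
Proof.
move=> D0 t0; have M0 : 0 < #|D|%:R :> R by rewrite ltr0n.
have [tM|Mt] := lerP t #|D|%:R; last first.
  rewrite (_ : bern _ _ _ = 0); first by rewrite mulr_ge0 ?expR_ge0.
  rewrite -[RHS](bern_cst p D 0); apply: eq_bern => S SD.
  apply/eqP; rewrite pnatr_eq0 eqb0 -leNgt ler_norml.
  have SM : #|S|%:R <= #|D|%:R :> R by rewrite ler_nat subset_leq_card.
  have S0 : 0 <= #|S|%:R :> R by [].
  have : p * #|D|%:R <= 1 * #|D|%:R by rewrite ler_wpM2r // ltW.
  have : 0 < p * #|D|%:R by rewrite mulr_gt0.
  by move=> ? ?; apply/andP; split; lra.
pose lam := t / (3 * #|D|%:R).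
have lam0 : 0 <= lam by rewrite divr_ge0 // mulr_ge0.
have lam3 : lam <= 1 / 3 by rewrite /lam ler_pdivrMr ?mulr_gt0 //; lra.
have h1 : `|lam| <= 1 / 3 by rewrite ger0_norm.
have h2 : `|- lam| <= 1 / 3 by rewrite normrN.
have b1 := bern_mgf_le D h1; have b2 := bern_mgf_le D h2; rewrite sqrrN in b2.
have -> : - (2 / 9 * t ^+ 2 / #|D|%:R) = lam ^+ 2 * #|D|%:R - lam * t.
  by rewrite /lam; field; rewrite gt_eqF.
rewrite expRD mulrA.
apply: (@le_trans _ _ ((bern p D (fun S => expR (lam * (#|S|%:R - p * #|D|%:R))) +
   bern p D (fun S => expR (- lam * (#|S|%:R - p * #|D|%:R)))) * expR (- (lam * t)))); last first.
  by rewrite ler_pM2r ?expR_gt0 //; lra.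
rewrite -bernD [leRHS]mulrC -bernZ; apply: (ler_bern p0 p1) => S _.
case: ltrP => h; last by rewrite mulr_ge0 ?addr_ge0 ?expR_ge0.
have [x0|x0] := lerP 0 (#|S|%:R - p * #|D|%:R).
  rewrite ger0_norm // in h; rewrite mulrDr -!expRD.
  apply: ler_wpDr; first exact: expR_ge0.
  apply: (@le_trans _ _ (expR 0)); [by rewrite expR0|rewrite ler_expR].
  have : 0 <= lam * ((#|S|%:R - p * #|D|%:R) - t) by rewrite mulr_ge0 // subr_ge0 ltW.
  lra.
rewrite ltr0_norm // in h; rewrite mulrDr -!expRD.
apply: ler_wpDl; first exact: expR_ge0.
apply: (@le_trans _ _ (expR 0)); [by rewrite expR0|rewrite ler_expR].
have : 0 <= lam * (- (#|S|%:R - p * #|D|%:R) - t) by rewrite mulr_ge0 // subr_ge0 ltW.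
lra.
Qed.

End Hoeffding.

Lemma ler_bool (R : numDomainType) (a b : bool) : (a -> b) -> a%:R <= b%:R :> R.
Proof. by case: a; case: b => h; rewrite ?lexx ?ler01 //; have := h isT. Qed.

Section Concentration.
Variables (R : realType) (p : R) (n : nat) (s L : R).
Hypotheses (p0 : 0 < p) (p1 : p < 1) (n2 : (2 <= n)%N).
Hypotheses (s1 : 1 <= s) (L0 : 0 < L) (sL : s ^+ 2 = n%:R * L) (nL : n%:R = expR L).
Local Notation star v := (star_to v (~: [set v])).

Lemma gprob_marginal (A : {set {set 'I_n}}) (F : pred {set {set 'I_n}}) :
  A \subset all_pairs n -> gprob p (fun S => F (S :&: A)) = bern p A (fun S => (F S)%:R).
Proof. by move=> AD; rewrite /gprob (bern_marginal p (fun S => (F S)%:R) AD). Qed.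

Lemma card_star (v : 'I_n) : #|star v| = n.-1.
Proof.
by rewrite card_star_to ?cardsC1 ?card_ord // !inE eqxx.
Qed.

Lemma star_sub (v : 'I_n) : star v \subset all_pairs n.
Proof. by apply: star_to_sub; rewrite !inE eqxx. Qed.

(** The degree is binomial with n - 1 trials. Passing from p n to p (n - 1) costs less than s, so a
    deviation of 3 s remains, of probability at most 2 n^(-2) for each vertex. *)
Lemma prob_degrees_bad :
  gprob p (fun S => [exists v : 'I_n, 4 * s < `|#|S :&: star v|%:R - p * n%:R|]) <=
  2 * expR (- L).
Proof.
have pp0 := p0; have pp1 := p1; have ss1 := s1; have LL := L0.
apply: (@le_trans _ _ (\sum_(v : 'I_n) gprob p (fun S => 4 * s < `|#|S :&: star v|%:R - p * n%:R|))).
  exact: (gprob_exists p0 p1 predT (fun v S => 4 * s < `|#|S :&: star v|%:R - p * n%:R|)).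
have n0 : 0 < n%:R :> R by rewrite nL expR_gt0.
apply: (@le_trans _ _ (\sum_(v : 'I_n) 2 * expR (- (2 * L)))); last first.
  rewrite sumr_const card_ord -[leLHS]mulr_natr nL -mulrA -expRD.
  by rewrite (_ : - (2 * L) + L = - L) //; lra.
apply: ler_sum => v _.
rewrite (gprob_marginal (fun S => 4 * s < `|#|S|%:R - p * n%:R|) (star_sub v)).
have cs : #|star v|%:R = n%:R - 1 :> R by rewrite card_star -subn1 natrB //; lia.
have n1 : 1 <= n%:R - 1 :> R by rewrite -cs ler1n card_star; lia.
apply: (@le_trans _ _ (bern p (star v) (fun S => (3 * s < `|#|S|%:R - p * #|star v|%:R|)%R%:R))).
  apply: (ler_bern p0 p1) => S _; apply: ler_bool => h.
  rewrite cs (_ : _ - p * (n%:R - 1) = (#|S|%:R - p * n%:R) - (- p)); last by ring.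
  by have := lerB_dist (#|S|%:R - p * n%:R) (- p); rewrite normrN (gtr0_norm p0); lra.
have D0 : (0 < #|star v|)%N by rewrite card_star; lia.
apply: le_trans (hoeffding p0 p1 D0 _) _; first by lra.
rewrite ler_pM2l // ler_expR lerN2 cs exprMn sL.
rewrite ler_pdivlMr; last lra.
have : 0 < L * n%:R by rewrite mulr_gt0.
lra.
Qed.

End Concentration.

Section InnerConcentration.
Variables (R : realType) (p : R) (n : nat) (s L : R).
Hypotheses (p0 : 0 < p) (p1 : p < 1) (L3 : 3 <= L) (nL : n%:R = expR L).

Lemma sum_pow_card (T : finType) (a : R) :
  \sum_(Z : {set T}) a ^+ #|Z| = (1 + a) ^+ #|T|.
Proof.
rewrite exprDn (partition_big (fun Z : {set T} => inord #|Z| : 'I_#|T|.+1) predT) //=.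
apply: eq_bigr => k _; rewrite expr1n mul1r.
have -> : 'C(#|T|, k) = #|[set A : {set T} | A \subset [set: T] & #|A| == k]|.
  by rewrite cards_draws cardsT.
rewrite -sumr_const.
apply: eq_big => Z.
  rewrite inE finset.subsetT /=; apply/eqP/eqP => [<-|E]; last by apply: val_inj; rewrite /= inordK E.
  by rewrite inordK // ltnS max_card.
by move=> /eqP <-; rewrite inordK // ltnS max_card.
Qed.

(** The exponent for a set of size z is at least 16/9 z L, so the union bound over all sets becomes
    the binomial sum (1 + n^(-16/9))^n - 1, of order n^(-7/9). *)
Lemma prob_inner_bad :
  gprob p (fun S => [exists Z : {set 'I_n}, 4 * #|Z|%:R * Num.sqrt (#|Z|%:R * L) <
     `|(#|S :&: pairs_in Z| * 2)%:R - p * #|Z|%:R * (#|Z|%:R - 1)|]) <=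
  4 * expR (- (7 / 9 * L)).
Proof.
have LL := L3; have L0 : 0 < L by lra.
pose a := expR (- (16 / 9 * L)).
pose E (Z : {set 'I_n}) (S : {set {set 'I_n}}) := 4 * #|Z|%:R * Num.sqrt (#|Z|%:R * L) <
  `|(#|S :&: pairs_in Z| * 2)%:R - p * #|Z|%:R * (#|Z|%:R - 1)|.
apply: (@le_trans _ _ (\sum_(Z : {set 'I_n}) gprob p (E Z))).
  exact: (gprob_exists p0 p1 predT E).
(* The empty set is subtracted, as its term alone would be 2. *)
apply: (@le_trans _ _ (\sum_(Z : {set 'I_n}) 2 * (a ^+ #|Z| - (#|Z| == 0)%N%:R))).
  apply: ler_sum => Z _; rewrite /E.
  rewrite (gprob_marginal p (fun S => 4 * #|Z|%:R * Num.sqrt (#|Z|%:R * L) <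
     `|(#|S| * 2)%:R - p * #|Z|%:R * (#|Z|%:R - 1)|) (pairs_in_sub Z)).
  have cC : (2 * #|pairs_in Z| = #|Z|.-1 * #|Z|)%N.
    by rewrite card_pairs_in mul_bin_left bin1 subn1.
  have [z2|z2] := ltnP #|Z| 2.
    have D0 : #|pairs_in Z| = 0%N.
      by apply/eqP; rewrite -(eqn_pmul2l (isT : (0 < 2)%N)) cC muln0; case: #|Z| z2 => [|[|]].
    rewrite (_ : bern _ _ _ = 0); last first.
      rewrite (cards0_eq D0) bern0 cards0 mul0n.
      have -> : p * #|Z|%:R * (#|Z|%:R - 1) = 0 :> R.
        by case: #|Z| z2 => [|[|]] // _; rewrite ?mulr0 ?mul0r // subrr mulr0.
      rewrite subr0 normr0 ltNge mulr_ge0 ?sqrtr_ge0 // mulr_ge0 //.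
    rewrite mulr_ge0 // subr_ge0; case: eqP => [->|_]; first by rewrite expr0.
    by rewrite exprn_ge0 ?expR_ge0.
  have -> : (#|Z| == 0)%N = false by case: #|Z| z2.
  rewrite subr0; set z : R := #|Z|%:R.
  have z2' : 2 <= z by rewrite ler_nat.
  have zE : 2 * #|pairs_in Z|%:R = (z - 1) * z :> R.
    by rewrite -natrM cC natrM -subn1 natrB // ltnW.
  have D0 : (0 < #|pairs_in Z|)%N.
    by rewrite -(ltr_nat R) -(ltr_pM2l (ltr0n R 2)) mulr0 zE mulr_gt0 //; lra.
  have sq0 := sqrtr_ge0 (z * L).
  have t0 : 0 <= 2 * z * Num.sqrt (z * L) by rewrite mulr_ge0 //; lra.
  apply: (@le_trans _ _ (bern p (pairs_in Z) (fun S =>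
     (2 * z * Num.sqrt (z * L) < `|#|S|%:R - p * #|pairs_in Z|%:R|)%R%:R))).
    apply: (ler_bern p0 p1) => S _; apply: ler_bool => h.
    rewrite -(ltr_pM2l (ltr0n R 2)) -[X in _ < X * _]ger0_norm // -normrM.
    have -> : 2 * (#|S|%:R - p * #|pairs_in Z|%:R) = (#|S| * 2)%:R - p * z * (z - 1).
      by rewrite natrM mulrBr [2 * (p * _)]mulrCA zE; ring.
    by apply: le_lt_trans h; rewrite /z; lra.
  apply: le_trans (hoeffding p0 p1 D0 t0) _.
  rewrite ler_pM2l // /a -expRM_natr ler_expR -/z mulNr lerN2.
  have D0' : 0 < #|pairs_in Z|%:R :> R by rewrite ltr0n.
  rewrite ler_pdivlMr // exprMn sqr_sqrtr; last by rewrite mulr_ge0 //; lra.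
  have e : 16 / 9 * L * z * #|pairs_in Z|%:R = 8 / 9 * L * z * ((z - 1) * z).
    by rewrite -zE; ring.
  rewrite e expr2; have : 0 <= L * z * z by rewrite !mulr_ge0 //; lra.
  lra.
rewrite -mulr_sumr sumrB sum_pow_card card_ord.
have -> : \sum_(Z : {set 'I_n}) (#|Z| == 0)%N%:R = 1 :> R.
  rewrite (bigD1 finset.set0) //= cards0 eqxx big1 ?addr0 // => Z.
  by rewrite -cards_eq0 => /negbTE->.
have h1 : (1 + a) ^+ n <= expR (expR (- (7 / 9 * L))).
  have -> : - (7 / 9 * L) = - (16 / 9 * L) + L by lra.
  rewrite expRD -nL -/a expRM_natr lerXn2r ?nnegrE ?expR_ge0 ?expR_ge1Dx //.
  by rewrite addr_ge0 // expR_ge0.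
have x3 : expR (- (7 / 9 * L)) <= 1 / 3.
  rewrite expRN div1r lef_pV2 ?posrE ?expR_gt0 //.
  by have := expR_ge1Dx (7 / 9 * L); lra.
have h2 := expR_le_quadratic x3.
have x0 := expR_ge0 (- (7 / 9 * L)).
set x := expR (- (7 / 9 * L)) in h1 x3 h2 x0 *.
have : x * x <= x * (1 / 3) by rewrite ler_wpM2l.
rewrite expr2 in h2; lra.
Qed.
End InnerConcentration.

(** * Dense small sets *)

Section Tilting.
Variables (R : realType) (p : R).
Hypotheses (p0 : 0 < p) (p1 : p < 1).
Local Notation q := (1 - p).

Section Mode.
Variables (b sg : nat).
Hypotheses (sg0 : (0 < sg)%N) (sgb : (sg < b)%N).

(* The exponential tilt under which Bin(b, p) has mean sg. *)
Definition tilt : R := sg%:R * q / ((b - sg)%:R * p).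

Let q0 : 0 < q. Proof. by rewrite subr_gt0. Qed.
Let S0 : 0 < sg%:R :> R. Proof. by rewrite ltr0n. Qed.
Let D0 : 0 < (b - sg)%:R :> R. Proof. by rewrite ltr0n subn_gt0. Qed.

Lemma tilt_gt0 : 0 < tilt.
Proof. by rewrite divr_gt0 ?mulr_gt0. Qed.

Let a (k : nat) : R := binpmf p b k * tilt ^+ k.

Lemma tilt_step (k : nat) : (k < b)%N ->
  a k.+1 * (k.+1 * (b - sg))%:R = a k * ((b - k) * sg)%:R.
Proof.
move=> kb; have := binpmf_succ p0 p1 kb; rewrite /a exprS !natrM.
have e : p * tilt * (b - sg)%:R = sg%:R * q.
  by rewrite /tilt; field; rewrite !gt_eqF.
move: tilt (binpmf p b k) (binpmf p b k.+1) (k.+1%:R : R) ((b - k)%:R : R) e.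
move=> t u v c d e E.
apply: (mulIf (lt0r_neq0 q0)).
transitivity (v * (c * q) * (t ^+ k * t * (b - sg)%:R)); first by ring.
rewrite E; transitivity (u * d * t ^+ k * (p * t * (b - sg)%:R)); first by ring.
by rewrite e; ring.
Qed.

Let a_ge0 k : 0 <= a k.
Proof. by rewrite mulr_ge0 ?binpmf_ge0 // exprn_ge0 // ltW // tilt_gt0. Qed.

(** By [tilt_step], consecutive weights do not decrease up to [sg] and do not increase from there
    on. *)
Lemma tilt_mode (k : nat) : (k <= b)%N -> a k <= a sg.
Proof.
have up d : (d <= sg)%N -> a (sg - d)%N <= a sg.
  elim: d => [|d IH] ds; first by rewrite subn0.
  apply: le_trans (IH (ltnW ds)); have -> : (sg - d = (sg - d.+1).+1)%N by lia.
  have kb : (sg - d.+1 < b)%N by lia.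
  have E := tilt_step kb; set k' := (sg - d.+1)%N in E kb *.
  have c0 : 0 < ((b - k') * sg)%:R :> R by rewrite ltr0n muln_gt0 sg0 subn_gt0 kb.
  rewrite -(ler_pM2r c0) -E ler_wpM2l // ler_nat mulnC leq_mul //; rewrite /k'; lia.
have down d : (sg + d <= b)%N -> a (sg + d)%N <= a sg.
  elim: d => [|d IH] ds; first by rewrite addn0.
  apply: le_trans (IH _); last lia; rewrite addnS.
  have kb : (sg + d < b)%N by lia.
  have E := tilt_step kb; set k' := (sg + d)%N in E kb *.
  have c0 : 0 < (k'.+1 * (b - sg))%:R :> R by rewrite ltr0n muln_gt0 subn_gt0 sgb.
  rewrite -(ler_pM2r c0) E ler_wpM2l // ler_nat mulnC leq_mul //; rewrite /k'; lia.
case: (leqP k sg) => [ks|/ltnW ks] kb.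
  by rewrite -(subKn ks) up // leq_subr.
by rewrite -(subnKC ks) down // subnKC.
Qed.

(** A sum of [b + 1] terms is at most [b + 1] times the largest. Chernoff's bound at this tilt thus
    loses only that factor against the point probability at [sg]. *)
Lemma tilt_pow_le : (p * tilt + q) ^+ b <= b.+1%:R * (binpmf p b sg * tilt ^+ sg).
Proof.
rewrite -binpmf_sum_pow mulr_natl -[X in _ *+ X]card_ord -sumr_const.
by apply: ler_sum => k _; apply: tilt_mode; rewrite -ltnS.
Qed.

Lemma tilt_base : p * tilt + q = q * b%:R / (b - sg)%:R.
Proof. by rewrite /tilt natrB ?(ltnW sgb) //; field; rewrite -natrB ?(ltnW sgb) // !gt_eqF. Qed.

(** A density above the mean by a constant factor gives a gain exponential in [b], which pays for
    the losses of the dense set estimate unless [b] is too small. *)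
Lemma tilt_base_ge : 6 / 5 * p * b%:R <= sg%:R -> 1 + p / 5 <= p * tilt + q.
Proof.
move=> h; have pp0 := p0; have pp1 := p1.
rewrite tilt_base ler_pdivlMr // natrB ?(ltnW sgb) //.
have : 0 <= p * p * b%:R by rewrite !mulr_ge0 // ltW.
have : p * sg%:R >= p * (6 / 5 * p * b%:R) by rewrite ler_pM2l.
lra.
Qed.

Lemma tilt_ge1 : p * b%:R <= sg%:R -> 1 <= tilt.
Proof.
move=> h; rewrite /tilt ler_pdivlMr ?mulr_gt0 // mul1r natrB ?(ltnW sgb) //; lra.
Qed.

Lemma tilt_le : (2 <= b)%N -> (2 * sg <= b + 1)%N -> tilt <= 3 / p.
Proof.
move=> b2 sb; rewrite /tilt invfM mulrA ler_pM2r ?invr_gt0 // ler_pdivrMr //.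
have h : sg%:R <= 3 * (b - sg)%:R :> R by rewrite -natrM ler_nat; lia.
by apply: le_trans h; rewrite ler_piMr // ?gerBl ltW.
Qed.

End Mode.

Lemma binpmf_ge_pow (b k : nat) (mu : R) : (k <= b)%N -> 0 <= mu -> mu <= p -> mu <= q ->
  mu ^+ b <= binpmf p b k.
Proof.
move=> kb m0 mp mq; rewrite binpmfE.
apply: (@le_trans _ _ (p ^+ k * q ^+ (b - k))).
  rewrite -{1}(subnKC kb) exprD ler_pM ?exprn_ge0 // lerXn2r ?nnegrE //; apply: le_trans m0 _ => //.
rewrite ler_peMl ?ler1n ?bin_gt0 // mulr_ge0 // exprn_ge0 //.
  exact: ltW.
by rewrite subr_ge0 ltW.
Qed.

Lemma chernoff_ge (T : finType) (D : {set T}) (z : R) (t : nat) : 1 <= z ->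
  bern p D (fun S => (t <= #|S|)%:R) <= (p * z + q) ^+ #|D| / z ^+ t.
Proof.
move=> z1; have z0 : 0 < z by apply: lt_le_trans z1.
rewrite ler_pdivlMr ?exprn_gt0 // -bern_pow mulrC -bernZ.
apply: (ler_bern p0 p1) => S _; case: leqP => h; last by rewrite mulr0 exprn_ge0 // ltW.
by rewrite mulr1; apply: ler_weXn2l.
Qed.

End Tilting.

Section SmallSets.

Lemma expnM_swap (k b : nat) : (k * 2 * b = 2 * (b * k))%N.
Proof. by lia. Qed.

Variables (R : realType) (p : R) (n : nat).
Hypotheses (p0 : 0 < p) (p1 : p < 1).
Local Notation q := (1 - p).
Implicit Types (B : {set 'I_n}) (S : {set {set 'I_n}}).

Definition hits B (sg : nat) S : {set 'I_n} :=
  [set w in finset.setC B | (sg <= #|S :&: star_to w B|)%N].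

(** The stars from different vertices to [B] are disjoint, so the expectation of 2^(-hits) factors,
    each factor being at most 1 - tau/2. Markov's inequality does the rest. *)
Lemma few_hits B (sg h : nat) (tau : R) : (sg <= #|B|)%N ->
  0 <= tau -> tau <= binpmf p #|B| sg ->
  gprob p (fun S => (#|hits B sg S| < h)%N) <=
  2 ^+ h * expR (- (tau / 2)) ^+ (n - #|B|).
Proof.
move=> sB t0 tau_le.
pose g (k : nat) : R := if (sg <= k)%N then 1 / 2 else 1.
have g0 k : 0 <= g k by rewrite /g; case: ifP => _ //; lra.
apply: (@le_trans _ _ (bern p (all_pairs n) (fun S => 2 ^+ h *
   \prod_(w in finset.setC B) g #|S :&: star_to w B|))).
  apply: (ler_bern p0 p1) => S _; case: ltnP => hh; last first.
    by rewrite mulr_ge0 ?exprn_ge0 // prodr_ge0.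
  have -> : \prod_(w in finset.setC B) g #|S :&: star_to w B| = (1 / 2) ^+ #|hits B sg S|.
    rewrite -prodr_const [RHS]big_mkcond [LHS]big_mkcond; apply: eq_bigr => w _.
    by rewrite /hits !inE /g; case: (w \in B).
  rewrite div1r exprVn -expfB ?pnatr_eq0 //; apply: exprn_ege1; lra.
rewrite bernZ ler_pM2l ?exprn_gt0 //.
rewrite (@bern_prod _ p _ _ (finset.setC B) (fun w => star_to w B) _ (fun _ S => g #|S|)).
- have cB : #|finset.setC B| = (n - #|B|)%N by apply/eqP; rewrite -(eqn_add2l #|B|) cardsC card_ord subnKC // -[leqRHS]card_ord max_card.
  rewrite -cB -prodr_const; apply: ler_prod => w; rewrite inE => wB.
  rewrite (bern_card p) card_star_to // sumr_ge0 /=; last by move=> k _; rewrite mulr_ge0 ?binpmf_ge0.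
  have -> : \sum_(k < #|B|.+1) binpmf p #|B| k * g k =
      \sum_(k < #|B|.+1) binpmf p #|B| k - \sum_(k < #|B|.+1) binpmf p #|B| k * (sg <= k)%N%:R / 2.
    rewrite -sumrB; apply: eq_bigr => k _; rewrite /g.
    move: (binpmf _ _ _) => x; case: (sg <= k)%N.
      by rewrite (_ : true%:R = 1 :> R) //; lra.
    by rewrite (_ : false%:R = 0 :> R) //; lra.
  rewrite binpmf_sum1 //.
  have : binpmf p #|B| sg / 2 <= \sum_(k < #|B|.+1) binpmf p #|B| k * (sg <= k)%N%:R / 2.
    have sB' : (sg < #|B|.+1)%N by rewrite ltnS.
    rewrite (bigD1 (Ordinal sB')) //= leqnn mulr1 lerDl sumr_ge0 // => k _.
    by rewrite !mulr_ge0 ?binpmf_ge0.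
  have := expR_ge1Dx (- (tau / 2)); lra.
- by move=> w w' wB w'B ww'; apply: star_to_disjoint => //; move: wB; rewrite inE.
- by move=> w; rewrite inE; apply: star_to_sub.
Qed.

(* With y = e^{-eta L} z (b + 1), Chernoff at the tilt z of sg gives y^b up to
   squaring, because the b(b-1)/2 pairs inside B are about half of b stars. *)
Lemma dense_small_set B (sg : nat) (tau y : R) :
  (2 <= #|B|)%N -> (2 * sg <= #|B| + 1)%N -> 6 / 5 * p * #|B|%:R <= sg%:R ->
  binpmf p #|B| sg <= tau -> 0 <= y -> y <= 1 ->
  (n%:R * tau * (#|B|.+1%:R * (3 / p))) ^+ 2 <= y ^+ 2 * (1 + p / 5) ^+ #|B| ->
  n%:R ^+ #|B| * gprob p (fun S => (#|B| * (sg - 1) <= #|S :&: pairs_in B|)%N) <= y.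
Proof.
move=> b2 sb sp pmf y0 y1 key; set b := #|B| in b2 sb sp pmf key *.
have pp0 := p0; have pp1 := p1.
have b0 : 0 < b%:R :> R by rewrite ltr0n; lia.
have pb0 : 0 < p * b%:R by rewrite mulr_gt0.
have sg0 : (0 < sg)%N by rewrite -(ltr_nat R); lra.
have sgb : (sg < b)%N by lia.
set z := tilt p b sg; have z0 : 0 < z := tilt_gt0 p0 p1 sg0 sgb.
have z1 : 1 <= z by apply: tilt_ge1 => //; lra.
have z3 : z <= 3 / p := tilt_le p0 p1 sg0 sgb b2 sb.
set phi := p * z + q; have phi1 : 1 + p / 5 <= phi := tilt_base_ge p0 p1 sgb sp.
have phi0 : 0 < phi by lra.
have phige1 : 1 <= phi by lra.
rewrite (gprob_marginal p (fun S => (b * (sg - 1) <= #|S|)%N) (pairs_in_sub B)).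
set P := bern _ _ _.
have P0 : 0 <= P by apply: (bern_ge0 p0 p1).
have PC : P <= phi ^+ #|pairs_in B| / z ^+ (b * (sg - 1)) := chernoff_ge p0 p1 _ _ z1.
have M2 : (2 * #|pairs_in B| <= b * b)%N.
  by rewrite card_pairs_in mul_bin_left bin1 leq_mul // leq_subr.
have pm0 : 0 <= binpmf p b sg by apply: binpmf_ge0.
have tp : phi ^+ b <= b.+1%:R * (binpmf p b sg * z ^+ sg) := tilt_pow_le p0 p1 sg0 sgb.
have tau0 : 0 <= tau by apply: le_trans pmf.
have n0 : 0 <= n%:R :> R by [].
have zs0 : 0 < z ^+ (sg - 1) by rewrite exprn_gt0.
(* one factor per vertex of B *)
have one : n%:R ^+ 2 * phi ^+ b / z ^+ (sg - 1) ^+ 2 <= y ^+ 2.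
  have pb : 0 < phi ^+ b by rewrite exprn_gt0.
  have e1 : phi ^+ b / z ^+ (sg - 1) <= b.+1%:R * tau * (3 / p).
    rewrite ler_pdivrMr //; apply: le_trans tp _.
    have -> : z ^+ sg = z * z ^+ (sg - 1) by rewrite -exprS subn1 prednK.
    rewrite [leRHS](_ : _ = b.+1%:R * (tau * (3 / p * z ^+ (sg - 1)))); last by ring.
    apply: ler_wpM2l => //; apply: ler_pM => //; first by rewrite mulr_ge0 ?ltW.
    by rewrite ler_pM2r.
  have e1' : (n%:R * (phi ^+ b / z ^+ (sg - 1))) ^+ 2 <= (n%:R * tau * (b.+1%:R * (3 / p))) ^+ 2.
    have i1 : 0 <= n%:R * (phi ^+ b / z ^+ (sg - 1)) by rewrite mulr_ge0 // divr_ge0 // ltW.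
    have i2 : n%:R * (phi ^+ b / z ^+ (sg - 1)) <= n%:R * tau * (b.+1%:R * (3 / p)).
      by rewrite -mulrA ler_wpM2l // [leRHS]mulrA [tau * _]mulrC.
    by rewrite lerXn2r ?nnegrE // (le_trans i1).
  have e2 : (1 + p / 5) ^+ b <= phi ^+ b by rewrite lerXn2r ?nnegrE ?(ltW phi0) // addr_ge0 // divr_ge0 // ltW.
  have e3 := le_trans e1' key.
  have : (n%:R * (phi ^+ b / z ^+ (sg - 1))) ^+ 2 <= y ^+ 2 * phi ^+ b.
    by apply: le_trans e3 _; rewrite ler_wpM2l // sqr_ge0.
  have -> : (n%:R * (phi ^+ b / z ^+ (sg - 1))) ^+ 2 =
     n%:R ^+ 2 * phi ^+ b / z ^+ (sg - 1) ^+ 2 * phi ^+ b.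
    by move: (phi ^+ b) (z ^+ (sg - 1)) => u v; rewrite -exprVn; ring.
  by rewrite ler_pM2r.
clearbody z.
(* Squares avoid the half in the number of pairs: twice that number is at most [b * b]. *)
have sq : (n%:R ^+ b * P) ^+ 2 <= y ^+ 2.
  apply: (@le_trans _ _ ((n%:R ^+ 2 * phi ^+ b / z ^+ (sg - 1) ^+ 2) ^+ b)).
    pose Q := phi ^+ #|pairs_in B| / z ^+ (b * (sg - 1)).
    have r1 : (n%:R ^+ b * P) ^+ 2 <= (n%:R ^+ b * Q) ^+ 2.
      have i1 : 0 <= n%:R ^+ b * P by rewrite mulr_ge0 // exprn_ge0.
      have i2 : n%:R ^+ b * P <= n%:R ^+ b * Q by rewrite ler_wpM2l // exprn_ge0.
      by rewrite lerXn2r ?nnegrE // (le_trans i1).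
    apply: le_trans r1 _; rewrite [(_ * Q) ^+ 2]exprMn [Q ^+ 2]expr_div_n [leRHS]expr_div_n.
    rewrite [(n%:R ^+ 2 * _) ^+ b]exprMn -!exprM expnM_swap -[leRHS]mulrA [(b * 2)%N]mulnC.
    rewrite ler_wpM2l ?exprn_ge0 // [(b * _ * 2)%N]mulnC ler_pM2r ?invr_gt0 ?exprn_gt0 //.
    by apply: ler_weXn2l => //; rewrite mulnC.
  apply: (@le_trans _ _ ((y ^+ 2) ^+ b)).
    by rewrite lerXn2r ?nnegrE ?sqr_ge0 // divr_ge0 ?mulr_ge0 ?exprn_ge0 // ltW.
  rewrite -[leRHS]expr1; apply: ler_wiXn2l; rewrite ?sqr_ge0 ?(ltnW b2) //.
  by rewrite expr_le1.
by rewrite -ler_sqr ?nnegrE // mulr_ge0 // exprn_ge0.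
Qed.

End SmallSets.

Section SmallEvent.
Variables (R : realType) (p : R).
Hypotheses (p0 : 0 < p) (p1 : p < 1).
Local Notation q := (1 - p).

Lemma polyexp_le (k : nat) (a C : R) : 0 < a ->
  \forall L \near +oo%R, C * L ^+ k <= expR (a * L).
Proof.
move=> a0; pose d := a / k.+1%:R; have d0 : 0 < d by rewrite divr_gt0.
near=> L; have L0 : 0 < L by near: L; apply: nbhs_pinfty_gt; rewrite num_real.
have LC : C / d ^+ k.+1 <= L by near: L; apply: nbhs_pinfty_ge; rewrite num_real.
have -> : a * L = k.+1%:R * (d * L) by rewrite /d; field.
rewrite expRM_natl; apply: (@le_trans _ _ ((d * L) ^+ k.+1)); last first.
  rewrite lerXn2r ?nnegrE ?expR_ge0 ?(ltW (mulr_gt0 d0 L0)) //.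
  by apply: le_trans (expR_ge1Dx _); rewrite lerDr.
have dk : 0 < d ^+ k.+1 by rewrite exprn_gt0.
rewrite exprMn [L ^+ k.+1]exprS mulrA ler_wpM2r ?exprn_ge0 ?(ltW L0) //.
by rewrite mulrC -ler_pdivrMr.
Unshelve. all: by end_near. Qed.

Lemma bin_le_expn (n k : nat) : ('C(n, k) <= n ^ k)%N.
Proof.
elim: k => [|k IH]; first by rewrite bin0.
apply: (@leq_trans (k.+1 * 'C(n, k.+1))%N); first by rewrite leq_pmull.
by rewrite mul_bin_left expnS leq_mul // leq_subr.
Qed.

(** There are at most n^k sets of size k, so a weight X n^(-k) for each of them leaves X per
    size. *)
Lemma sum_small_sets (n m : nat) (F : {set 'I_n} -> R) (P : pred {set 'I_n}) (X : R) :
  (0 < n)%N -> (forall B, P B -> (#|B| <= m)%N) -> (forall B, P B -> n%:R ^+ #|B| * F B <= X) ->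
  0 <= X -> \sum_(B | P B) F B <= m.+1%:R * X.
Proof.
move=> n0 Pm h X0.
rewrite (partition_big (fun B : {set 'I_n} => inord #|B| : 'I_m.+1) predT) //=.
rewrite mulr_natl -[X in _ *+ X]card_ord -sumr_const; apply: ler_sum => k _.
have nk : 0 < n%:R ^+ k :> R by rewrite exprn_gt0 // ltr0n.
apply: (@le_trans _ _ (\sum_(B : {set 'I_n} | #|B| == k) X / n%:R ^+ k)).
  rewrite [leRHS]big_mkcond [leLHS]big_mkcond; apply: ler_sum => B _.
  case: ifP => [/andP[PB /eqP Bk]|_]; last by case: ifP => // _; rewrite divr_ge0 // ltW.
  have {}Bk : #|B| = k by rewrite -Bk inordK // ltnS; apply: Pm.
  by rewrite Bk eqxx ler_pdivlMr // mulrC -Bk h.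
rewrite sumr_const -[leLHS]mulr_natr.
have -> : #|[pred B : {set 'I_n} | #|B| == k]| = 'C(n, k).
  have := cards_draws (finset.setT : {set 'I_n}) k; rewrite cardsT card_ord => <-.
  by apply: eq_card => B; rewrite !inE finset.subsetT.
rewrite mulrAC ler_pdivrMr // ler_wpM2l // -natrX ler_nat; exact: bin_le_expn.
Qed.

Lemma sq_cancel (u v w : R) : u * v = 1 -> (u * w) ^+ 2 * v ^+ 4 = (v * w) ^+ 2.
Proof.
move=> uv; transitivity ((u * v) ^+ 2 * (v * w) ^+ 2); first by ring.
by rewrite uv expr1n mul1r.
Qed.

Lemma cube_le (x y c : R) : 0 <= x -> x <= y -> 0 <= c -> x * x * (x * c) <= y ^+ 3 * c.
Proof.
move=> x0 xy c0; rewrite mulrA ler_wpM2r // (_ : x * x * x = x ^+ 3); last by ring.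
by rewrite lerXn2r ?nnegrE // (le_trans x0).
Qed.

Section Event.
Variables (n m : nat) (tau : R).

(* Either sg neighbours in B are likely, and then many vertices should have them,
   or they are unlikely, and then B should not be that dense. *)
Definition small_bad_at (i : 'I_m.+1 * {set 'I_n}) (S : {set {set 'I_n}}) : bool :=
  let: (sg, B) := i in
  (tau <= binpmf p #|B| sg) && (#|hits B sg S| < 2 * m)%N ||
  [&& binpmf p #|B| sg < tau, (2 * sg <= #|B| + 1)%N, 6 / 5 * p * #|B|%:R <= sg%:R &
      (#|B| * (sg - 1) <= #|S :&: pairs_in B|)%N].

Definition small_range (i : 'I_m.+1 * {set 'I_n}) : bool :=
  [&& (2 <= #|i.2|)%N, (#|i.2| <= m)%N & (i.1 <= #|i.2|)%N].

Definition small_bad (S : {set {set 'I_n}}) : bool :=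
  [exists i, small_range i && small_bad_at i S].

Lemma prob_small_bad (y : R) : (0 < n)%N -> 0 <= tau -> 0 <= y -> y <= 1 -> (m <= n)%N ->
  (forall b sg : nat, (2 <= b)%N -> (b <= m)%N -> (sg <= b)%N -> binpmf p b sg < tau ->
    (n%:R * tau * (b.+1%:R * (3 / p))) ^+ 2 <= y ^+ 2 * (1 + p / 5) ^+ b) ->
  gprob p small_bad <= m.+1%:R * (m.+1%:R *
    (n%:R ^+ m * (2 ^+ (2 * m) * expR (- (tau / 2)) ^+ (n - m)) + y)).
Proof.
move=> n0 t0 y0 y1 mn key.
have n1 : 1 <= n%:R :> R by rewrite ler1n.
set X1 := n%:R ^+ m * _; have X10 : 0 <= X1 by rewrite !mulr_ge0 ?exprn_ge0 ?expR_ge0.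
apply: le_trans (gprob_exists p0 p1 small_range small_bad_at) _.
have -> : \sum_(i | small_range i) gprob p (small_bad_at i) =
    \sum_(sg < m.+1) \sum_(B | small_range (sg, B)) gprob p (small_bad_at (sg, B)).
  by rewrite [RHS]pair_big_dep /=; apply: eq_big => -[].
rewrite mulr_natl -[X in _ *+ X]card_ord -sumr_const; apply: ler_sum => sg _.
apply: sum_small_sets => //; last by rewrite addr_ge0.
  by move=> B /and3P[].
move=> B /and3P[/= B2 Bm sB].
have e1 : expR (- (tau / 2)) <= 1 by rewrite -[leRHS]expR0 ler_expR oppr_le0 divr_ge0.
have nB : n%:R ^+ #|B| <= n%:R ^+ m :> R by apply: ler_weXn2l.
have nB0 : 0 <= n%:R ^+ #|B| :> R by rewrite exprn_ge0.
have [tp|tp] := lerP tau (binpmf p #|B| sg).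
  apply: (@le_trans _ _ X1); last by rewrite lerDl.
  apply: ler_pM => //; first exact: gprob_ge0.
  apply: le_trans (_ : gprob p (fun S => (#|hits B sg S| < 2 * m)%N) <= _).
    apply: (gprob_le p0 p1) => S _; rewrite /small_bad_at tp /= => /orP[//|].
    by move=> /and4P[h _ _ _]; rewrite ltNge tp in h.
  apply: le_trans (few_hits p0 p1 _ sB t0 tp) _.
  rewrite ler_wpM2l ?exprn_ge0 //; apply: ler_wiXn2l; rewrite ?expR_ge0 //.
  exact: leq_sub2l.
apply: (@le_trans _ _ y); last by rewrite lerDr.
have [/andP[sg2 sgp]|bad] := boolP ((2 * sg <= #|B| + 1)%N && (6 / 5 * p * #|B|%:R <= sg%:R)).
  apply: le_trans (dense_small_set p0 p1 B2 sg2 sgp (ltW tp) y0 y1 (key _ _ B2 Bm sB tp)).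
  rewrite ler_wpM2l //; apply: (gprob_le p0 p1) => S _.
  rewrite /small_bad_at => /orP[/andP[h _]|/and4P[_ _ _ //]].
  by rewrite leNgt tp in h.
rewrite (_ : gprob _ _ = 0) ?mulr0 //; apply/eqP.
rewrite eq_le (gprob_ge0 p0 p1) andbT -(bern_cst p (all_pairs n) 0).
apply: (ler_bern p0 p1) => S _; rewrite (_ : small_bad_at _ _ = false) //.
apply/negbTE; rewrite /small_bad_at negb_or leNgt tp /=.
by rewrite andbA (negbTE bad).
Qed.

End Event.

(** The threshold is n^(-(1 - eta)). A value of at least that probability is expected at about n^eta
    vertices, far more than 2 m; a less likely one makes the expected number of dense sets at most
    n^(-eta), up to powers of L. *)
Lemma small_bad_vanish : exists2 eta : R, 0 < eta & forall eps : R, 0 < eps ->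
  \forall L \near +oo%R, forall n m : nat, n%:R = expR L -> m%:R <= 5 * L / p ^+ 2 ->
    gprob p (@small_bad n m (expR (- ((1 - eta) * L)))) <= eps.
Proof.
have pp0 := p0; have pp1 := p1.
pose mu := Num.min p q; have mu0 : 0 < mu by rewrite lt_min p0 subr_gt0.
have mup : mu <= p by rewrite ge_min lexx.
have muq : mu <= q by rewrite ge_min lexx orbT.
have mu1 : mu < 1 by apply: le_lt_trans mup p1.
pose lm := - ln mu; have lm0 : 0 < lm by rewrite oppr_gt0 ln_lt0 // mu0.
pose lf := ln (1 + p / 5); have lf0 : 0 < lf by apply: ln_gt0; lra.
(* Chosen so that 4 eta lm = (1 - eta) lf. Either (1 + p/5)^b reaches n^(4 eta), as the moment bound
   requires, or b is so small that every value has probability at least mu^b >= n^(-(1 - eta)). *)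
pose eta := (1 + 4 * lm / lf)^-1.
have k0 : 0 < 4 * lm / lf by rewrite divr_gt0 // mulr_gt0.
have eta0 : 0 < eta by rewrite invr_gt0; lra.
have eta1 : eta < 1 by rewrite invf_lt1; lra.
have etaE : 4 * eta * lm = (1 - eta) * lf.
  by rewrite /eta; field; rewrite !gt_eqF //; lra.
exists eta => // eps eps0.
pose c5 := 5 / p ^+ 2; have c50 : 0 < c5 by rewrite divr_gt0 // exprn_gt0.
near=> L; move=> n m nL mL.
have L1 : 1 <= L by near: L; apply: nbhs_pinfty_ge; rewrite num_real.
have L0 : 0 < L by lra.
have P1 : (4 * (c5 + 4 * c5 + 1)) * L ^+ 2 <= expR (eta * L).
  by near: L; apply: polyexp_le.
have P2 : ((c5 + 1) * (3 / p)) * L ^+ 1 <= expR (eta * L) by near: L; apply: polyexp_le.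
have P3 : (2 / eps * ((c5 + 1) ^+ 3 * (3 / p))) * L ^+ 3 <= expR (eta * L).
  by near: L; apply: polyexp_le.
have P4 : (2 * c5) * L ^+ 1 <= expR (1 * L) by near: L; apply: polyexp_le.
have P5 : (2 / eps) * L ^+ 0 <= expR (1 * L) by near: L; apply: polyexp_le.
rewrite mul1r expr1 in P4; rewrite mul1r expr0 mulr1 in P5; rewrite expr1 in P2.
have mL' : m%:R <= c5 * L by apply: le_trans mL _; rewrite /c5 mulrAC.
have m1L : m.+1%:R <= (c5 + 1) * L by rewrite -natr1; lra.
have n0 : (0 < n)%N by rewrite -(ltr_nat R) nL expR_gt0.
have mn2 : 2 * m%:R <= n%:R :> R by rewrite nL; lra.
have mn : (m <= n)%N by rewrite -(ler_nat R); have : 0 <= m%:R :> R by []; lra.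
set tau := expR _; pose y := expR (- (eta * L)) * (m.+1%:R * (3 / p)).
have ip : 0 < 3 / p by rewrite divr_gt0.
have ip0 := ltW ip.
have y0 : 0 <= y by rewrite mulr_ge0 ?expR_ge0 // mulr_ge0.
have E0 : 0 < expR (eta * L) by apply: expR_gt0.
have y1 : y <= 1.
  rewrite /y expRN mulrC ler_pdivrMr // mul1r; apply: le_trans P2.
  by rewrite mulrAC ler_pM2r.
have ntau : n%:R * tau = expR (eta * L) by rewrite nL -expRD; congr expR; ring.
apply: le_trans (prob_small_bad n0 (expR_ge0 _) y0 y1 mn _) _.
  move=> b sg b2 bm sb pmf.
  have [big|small] := lerP (expR (4 * eta * L)) ((1 + p / 5) ^+ b).
    rewrite ntau; apply: (@le_trans _ _ (y ^+ 2 * expR (4 * eta * L))); last first.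
      by rewrite ler_wpM2l // sqr_ge0.
    have -> : y ^+ 2 * expR (4 * eta * L) = (expR (eta * L) * (m.+1%:R * (3 / p))) ^+ 2.
      have -> : expR (4 * eta * L) = expR (eta * L) ^+ 4 by rewrite -expRM_natl mulrA.
      by apply: sq_cancel; rewrite -expRD addNr expR0.
    have i1 : 0 <= expR (eta * L) * (b.+1%:R * (3 / p)).
      by rewrite mulr_ge0 ?(ltW E0) // mulr_ge0.
    have i2 : expR (eta * L) * (b.+1%:R * (3 / p)) <= expR (eta * L) * (m.+1%:R * (3 / p)).
      by rewrite ler_pM2l // ler_pM2r // ler_nat ltnS.
    by rewrite lerXn2r ?nnegrE // (le_trans i1).
  have /negP[] : ~~ (binpmf p b sg < tau); last exact: pmf.
  rewrite -leNgt; apply: le_trans _ (binpmf_ge_pow p0 p1 sb (ltW mu0) mup muq).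
  have phi0 : 0 < 1 + p / 5 by lra.
  have h1 : b%:R * lf < 4 * eta * L.
    by rewrite -ltr_expR expRM_natl /lf lnK // posrE.
  have -> : mu ^+ b = expR (- (b%:R * lm)).
    by rewrite -mulrN /lm opprK expRM_natl lnK // posrE.
  rewrite ler_expR lerN2 -(ler_pM2r lf0).
  have -> : (1 - eta) * L * lf = 4 * eta * L * lm by rewrite mulrAC -etaE; ring.
  by rewrite mulrAC ler_pM2r // ltW.
rewrite mulrA mulrDr.
have half : eps = eps / 2 + eps / 2 by lra.
rewrite half; apply: lerD.
- have b1 : m.+1%:R <= expR m%:R :> R by apply: le_trans (expR_ge1Dx _); rewrite -natr1 addrC.
  have b2 : n%:R ^+ m = expR (m%:R * L) :> R by rewrite nL expRM_natl.
  have b3 : 2 ^+ (2 * m) <= expR (2 * m%:R) :> R.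
    rewrite -[2 * m%:R]mulr1 -natrM expRM_natl lerXn2r ?nnegrE ?expR_ge0 //.
    by apply: le_trans (expR_ge1Dx _); rewrite -natr1.
  have b4 : expR (- (tau / 2)) ^+ (n - m) <= expR (- (expR (eta * L) / 4)).
    rewrite -expRM_natl ler_expR mulrN lerN2 natrB // -ntau.
    have : 0 < tau by apply: expR_gt0.
    by move=> tp; have : tau * (2 * m%:R) <= tau * n%:R; [rewrite ler_pM2l|lra].
  apply: (@le_trans _ _ (expR (m%:R * 2) * (expR (m%:R * L) * (expR (2 * m%:R) * expR (- (expR (eta * L) / 4)))))).
    rewrite b2; apply: ler_pM; rewrite ?mulr_ge0 ?expR_ge0 ?exprn_ge0 ?expR_ge0 //.
      by rewrite [m%:R * 2]mulrC expRM_natl expr2 ler_pM.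
    by rewrite ler_pM2l ?expR_gt0 // ler_pM ?exprn_ge0 ?expR_ge0.
  rewrite -!expRD; apply: (@le_trans _ _ (expR (- L))).
    rewrite ler_expR.
    have h1 : m%:R * L <= c5 * L * L by rewrite ler_pM2r.
    have h2 : L <= L * L by rewrite ler_peMl // ltW.
    have h3 : c5 * L <= c5 * (L * L) by rewrite ler_pM2l.
    rewrite expr2 in P1; lra.
  rewrite expRN -[eps / 2]invrK lef_pV2 ?posrE ?expR_gt0 ?invr_gt0 ?divr_gt0 //.
  by rewrite invf_div.
- rewrite /y mulrCA expRN mulrC ler_pdivrMr //.
  have m0 : 0 <= m.+1%:R :> R by [].
  have cube : m.+1%:R * m.+1%:R * (m.+1%:R * (3 / p)) <= (c5 + 1) ^+ 3 * (3 / p) * L ^+ 3.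
    by have := cube_le m0 m1L ip0; rewrite exprMn [_ * L ^+ 3 * _]mulrAC.
  apply: le_trans cube _.
  have -> : (c5 + 1) ^+ 3 * (3 / p) * L ^+ 3 =
      eps / 2 * (2 / eps * ((c5 + 1) ^+ 3 * (3 / p)) * L ^+ 3).
    by move: ((c5 + 1) ^+ 3 * (3 / p)) (L ^+ 3) => u v; field; rewrite gt_eqF.
  by rewrite ler_pM2l // divr_gt0.
Unshelve. all: by end_near. Qed.

End SmallEvent.

(** For a densest [b]-set with [e] edges, [sg] is one more than [e %/ b]. The set has at least
    [b * (sg - 1)] edges, so [sg] is not an unlikely value. Then at least 2 m vertices have [sg]
    neighbours in a [b]-subset of [A], and at most m of them lie in [A]; finally [e < sg * b]. *)
Lemma small_ext_of_good (R : realType) (p : R) (n m : nat) (tau : R) (H : sgraph 'I_n) :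
  0 < p -> ~~ small_bad p m tau (edges H) ->
  forall (A : {set 'I_n}) (b : nat), (2 <= b)%N -> (b <= #|A|)%N -> (#|A| <= m)%N ->
    12 / 5 * p * b%:R ^+ 2 <= (dens H b)%:R ->
    exists W : {set 'I_n}, [/\ #|W| = b, [disjoint A & W] &
      forall w, w \in W -> (dens H b < 2 * b * pairs_between H [set w] A)%N].
Proof.
move=> p0 good A b b2 bA Am hd.
have b0 : (0 < b)%N := ltnW b2.
have bn : (b <= #|'I_n|)%N by apply: leq_trans bA _; apply: max_card.
have [B0 B0b E0] := dens_ex H bn.
rewrite inner_pairs_in in E0; set e := #|_| in E0.
have ee : (e * 2 <= b.-1 * b)%N.
  apply: (@leq_trans ('C(b, 2) * 2)); last by rewrite mulnC mul_bin_left bin1 subn1.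
  by rewrite leq_mul2r -B0b -card_pairs_in subset_leq_card ?subsetIr.
pose sg := (e %/ b).+1.
have sg1 : (e %/ b * b <= e)%N := leq_trunc_div e b.
have sg2 : (e < sg * b)%N := ltn_ceil e b0.
have sgb : (2 * sg <= b + 1)%N.
  have h : (2 * (e %/ b) * b <= b.-1 * b)%N by apply: leq_trans ee; rewrite -mulnA mulnC leq_mul2r sg1.
  by rewrite leq_pmul2r // in h; rewrite /sg; lia.
have sm : (sg < m.+1)%N by rewrite ltnS; apply: leq_trans (leq_trans bA Am); lia.
have b0R : 0 < b%:R :> R by rewrite ltr0n.
have sp : 6 / 5 * p * b%:R <= sg%:R.
  have h1 : e%:R * 2 <= sg%:R * b%:R * 2 :> R by rewrite ler_pM2r // -natrM ler_nat ltnW.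
  rewrite -E0 natrM expr2 in hd.
  by rewrite -(ler_pM2r b0R); lra.
have good_at (B : {set 'I_n}) : #|B| = b -> ~~ small_bad_at p tau (Ordinal sm, B) (edges H).
  move=> Bb; apply: contra good => bad; apply/existsP; exists (Ordinal sm, B).
  rewrite bad andbT /small_range /= Bb b2 (leq_trans bA Am) /=; lia.
have taule : tau <= binpmf p b sg.
  have := good_at _ B0b; rewrite /small_bad_at negb_or => /andP[_].
  rewrite B0b [tau <= _]leNgt; apply: contra => h; rewrite h sgb sp /=.
  by rewrite /sg subn1 mulnC.
have [B BA Bb] := subset_of_card bA.
have := good_at _ Bb; rewrite /small_bad_at negb_or Bb taule /= -leqNgt => /andP[hh _].
have cW : (b <= #|finset.setD (hits B sg (edges H)) A|)%N.
  have h1 := cardsID A (hits B sg (edges H)).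
  have h2 : (#|finset.setI (hits B sg (edges H)) A| <= m)%N.
    by apply: leq_trans Am; apply/subset_leq_card/subsetIr.
  rewrite -(leq_add2l m); apply: leq_trans (_ : (2 * m <= _)%N); first by rewrite mul2n -addnn leq_add2l (leq_trans bA).
  by apply: leq_trans hh _; rewrite -h1 leq_add2r.
have [W WH Wb] := subset_of_card cW.
exists W; split=> //.
  apply/pred0P => x /=; apply/negP => /andP[xA /(fintype.subsetP WH)].
  by rewrite inE xA.
move=> w /(fintype.subsetP WH); rewrite !inE => /andP[wA /andP[wB hw]].
have wB' : w \notin B by [].
have h1 : (sg <= pairs_between H [set w] A)%N.
  apply: leq_trans hw _; rewrite -pairs_between_star //.
  by apply: leq_pairs_between.
rewrite -E0 mulnC -mulnA ltn_pmul2l // (leq_trans sg2) // mulnC leq_mul2l h1 orbT //.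
Qed.

(** * Low degrees *)

Section BinomialCdf.
Variables (R : realType) (p : R) (N : nat).
Hypotheses (p0 : 0 < p) (p1 : p < 1).
Local Notation q := (1 - p).
Local Notation b := (binpmf p N).

Definition cdf (x : nat) : R := \sum_(k < x.+1) b k.

Lemma cdfS x : cdf x.+1 = cdf x + b x.+1.
Proof. by rewrite /cdf big_ord_recr. Qed.

Lemma cdf0 : cdf 0 = b 0.
Proof. by rewrite /cdf big_ord1. Qed.

Lemma cdf_ge0 x : 0 <= cdf x.
Proof. by apply: sumr_ge0 => k _; apply: binpmf_ge0. Qed.

Lemma cdf_le x y : (x <= y)%N -> cdf x <= cdf y.
Proof.
elim: y => [|y IH]; first by rewrite leqn0 => /eqP->.
rewrite leq_eqVlt => /orP[/eqP->//|xy]; apply: le_trans (IH xy) _.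
by rewrite cdfS lerDl binpmf_ge0.
Qed.

Lemma binpmf_out k : (N < k)%N -> b k = 0.
Proof. by move=> Nk; rewrite /binpmf bin_small. Qed.

Definition binomial_mean (g : nat -> R) : R := \sum_(k < N.+1) b k * g k.
Local Notation binexp := binomial_mean.

Lemma binomial_mean_point (y : nat) : binexp (fun k => (k == y)%:R) = b y.
Proof.
have [yN|Ny] := ltnP y N.+1.
  rewrite /binomial_mean (bigD1 (Ordinal yN)) //= eqxx mulr1 big1 ?addr0 // => k.
  by rewrite -val_eqE /= => /negbTE->; rewrite mulr0.
rewrite binpmf_out // /binomial_mean big1 // => k _.
by rewrite (_ : (k == y :> nat) = false) ?mulr0 //; apply/negbTE; rewrite neq_ltn (leq_trans (ltn_ord k) Ny).
Qed.

Lemma binomial_mean_le (y : nat) : binexp (fun k => (k <= y)%N%:R) = cdf y.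
Proof.
elim: y => [|y IH].
  by rewrite cdf0 -binomial_mean_point; apply: eq_bigr => k _; rewrite leqn0.
rewrite cdfS -IH -binomial_mean_point -big_split; apply: eq_bigr => k _ /=; rewrite -mulrDr -natrD.
by congr (_ * _%:R); rewrite [in LHS]leq_eqVlt ltnS; case: eqVneq => [->|_] /=; rewrite ?ltnn ?addn0.
Qed.

Lemma bern_cdf (T : finType) (D : {set T}) x : #|D| = N ->
  bern p D (fun S => (#|S| <= x)%N%:R) = cdf x.
Proof.
by move=> DN; rewrite (bern_card p D (fun k => (k <= x)%N%:R)) DN -binomial_mean_le.
Qed.

Lemma cdf_N : cdf N = 1.
Proof. exact: binpmf_sum1. Qed.

Lemma quantile_exists (tau : R) : 0 < tau -> tau <= 1 -> exists a : nat,
  tau <= cdf a /\ (forall x, (x < a)%N -> cdf x < tau).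
Proof.
move=> t0 t1; have ex : exists x, tau <= cdf x by exists N; rewrite cdf_N.
case: (ex_minnP ex) => a ta amin; exists a; split=> // x xa.
by rewrite ltNge; apply/negP => h; have := amin x h; rewrite leqNgt xa.
Qed.

Section Growth.
Variables (kap : R) (t0 : nat).
Hypotheses (kap0 : 0 <= kap).
Hypothesis ratio : forall k, (t0 <= k)%N -> b k.+1 <= (1 + kap) * b k.

(** The sum is shifted by one index: beyond [t0] a term exceeds its predecessor by a factor at most
    [1 + kap], and the terms up to [t0] are absorbed by [cdf t0]. *)
Lemma cdf_step x : cdf x.+1 <= cdf t0 + (1 + kap) * cdf x.
Proof.
have k1 : 0 <= 1 + kap by rewrite addr_ge0.
have [xt|tx] := ltnP x t0.
  by apply: le_trans (cdf_le xt) _; rewrite lerDl mulr_ge0 ?cdf_ge0.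
elim: x tx => [|x IH].
  rewrite leqn0 => /eqP t00; rewrite cdfS cdf0 t00 cdf0 lerD2l.
  by apply: ratio; rewrite t00.
rewrite leq_eqVlt => /orP[/eqP tx|tx].
  rewrite cdfS tx lerD2l; apply: le_trans (ratio _) _; first by rewrite tx.
  by rewrite ler_wpM2l // cdfS lerDr cdf_ge0.
rewrite cdfS [in leRHS]cdfS mulrDr addrA lerD ?IH //.
by apply: ratio; apply: ltnW.
Qed.

(** A single probability is a difference of consecutive values of [cdf], hence a small share of the
    tail. *)
Lemma binpmf_le_cdf x : b x <= kap * cdf x + cdf t0.
Proof.
have kc y : 0 <= kap * cdf y by rewrite mulr_ge0 ?cdf_ge0.
case: x => [|x].
  by rewrite -cdf0; apply: le_trans (cdf_le (leq0n t0)) _; rewrite lerDr.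
have := cdf_step x; have : kap * cdf x <= kap * cdf x.+1 by rewrite ler_wpM2l // cdf_le.
rewrite cdfS; lra.
Qed.

Lemma cdf_steps x j : cdf (x + j) <= (1 + kap) ^+ j * (cdf x + j%:R * cdf t0).
Proof.
have k1 : 1 <= 1 + kap by rewrite lerDl.
elim: j => [|j IH]; first by rewrite addn0 expr0 mul1r mul0r addr0.
rewrite addnS; apply: le_trans (cdf_step _) _; rewrite exprS.
have h : (1 + kap) * cdf (x + j) <= (1 + kap) * ((1 + kap) ^+ j * (cdf x + j%:R * cdf t0)).
  by rewrite ler_wpM2l //; apply: le_trans k1.
have h2 : cdf t0 <= (1 + kap) * (1 + kap) ^+ j * cdf t0.
  by rewrite ler_peMl ?cdf_ge0 // -exprS exprn_ege1.
rewrite -natr1 !mulrDl !mulrDr mul1r; rewrite mulrDr in h.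
move: h h2; rewrite !mulrA !mulrDl !mulrDr !mul1r; lra.
Qed.

Lemma cdf_steps_exp x j : cdf (x + j) <= expR (kap * j%:R) * (cdf x + j%:R * cdf t0).
Proof.
apply: le_trans (cdf_steps x j) _; rewrite ler_wpM2r //.
  by rewrite addr_ge0 ?mulr_ge0 ?cdf_ge0.
by rewrite expRM_natr lerXn2r ?nnegrE ?expR_ge0 ?expR_ge1Dx // addr_ge0.
Qed.
End Growth.

Section Decay.
Variables (kap : R) (t1 : nat).
Hypothesis kap1 : kap <= 1.
Hypothesis ratio : forall k, (k < t1)%N -> b k <= (1 - kap) * b k.+1.

Lemma cdf_decay_step x : (x < t1)%N -> cdf x <= (1 - kap) * cdf x.+1.
Proof.
have k0 : 0 <= 1 - kap by rewrite subr_ge0.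
elim: x => [|x IH] xt.
  rewrite cdfS mulrDr cdf0; apply: le_trans (ratio xt) _.
  by rewrite lerDr mulr_ge0 ?binpmf_ge0.
by rewrite [cdf x.+2]cdfS mulrDr [in leLHS]cdfS lerD ?ratio // IH // ltnW.
Qed.

Lemma cdf_decay x j : (x + j <= t1)%N -> cdf x <= expR (- (kap * j%:R)) * cdf (x + j).
Proof.
have k0 : 0 <= 1 - kap by rewrite subr_ge0.
elim: j => [|j IH] xj; first by rewrite addn0 mulr0 oppr0 expR0 mul1r.
rewrite addnS in xj *; apply: le_trans (IH (ltnW xj)) _.
rewrite -natr1 mulrDr opprD expRD mulr1 -mulrA ler_wpM2l ?expR_ge0 //.
apply: le_trans (cdf_decay_step xj) _; rewrite ler_wpM2r ?cdf_ge0 //.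
exact: expR_ge1Dx.
Qed.
End Decay.

Section Ratios.
Variables (s : R).
Hypotheses (s0 : 0 < s) (N0 : (0 < N)%N).
Let N0' : 0 < N%:R :> R. Proof. by rewrite ltr0n. Qed.
Let q0 : 0 < q. Proof. by rewrite subr_gt0. Qed.

Lemma ratio_upper (k : nat) : 8 * s <= p * q * N%:R -> p * N%:R - 4 * s <= k%:R ->
  b k.+1 <= (1 + 8 * s / (p * q * N%:R)) * b k.
Proof.
move=> sN hk; set kap := 8 * s / _.
have M0 : 0 < p * q * N%:R by rewrite !mulr_gt0.
have kap0 : 0 <= kap by rewrite divr_ge0 ?mulr_ge0 // ltW.
have kapE : kap * (p * q * N%:R) = 8 * s by rewrite /kap divfK // gt_eqF.
have kap1 : kap <= 1 by rewrite ler_pdivrMr // mul1r.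
have [kN|Nk] := ltnP k N; last by rewrite binpmf_out // mulr_ge0 ?binpmf_ge0 // addr_ge0.
have kq : 0 < k.+1%:R * q by rewrite mulr_gt0.
rewrite -(ler_pM2r kq) (binpmf_succ p0 p1 kN).
rewrite [(1 + kap) * b k]mulrC -[leRHS]mulrA ler_wpM2l ?binpmf_ge0 //.
rewrite natrB ?(ltnW kN) // -natr1; set K := k%:R in hk *.
have pp0 := p0; have pp1 := p1; have ss0 := s0; have qq0 := q0.
have kq0 : 0 <= kap * q by rewrite mulr_ge0 // ltW.
have kq1 : kap * q <= 1 by rewrite mulr_ile1 // ?ltW // gtrBl.
have [y0|y0] := lerP 0 (p * N%:R - K).
  have : (kap * q) * (p * N%:R - K) <= 1 * (p * N%:R - K) by rewrite ler_wpM2r.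
  lra.
have : 0 <= (kap * q) * (K - p * N%:R) by rewrite mulr_ge0 // subr_ge0; lra.
lra.
Qed.

Lemma ratio_lower (c0 : R) (k : nat) : 0 < c0 -> k.+1%:R <= p * N%:R - c0 * s ->
  b k <= (1 - c0 * s / N%:R) * b k.+1.
Proof.
move=> c00 hk; set kap := c0 * s / _.
have cs0 : 0 < c0 * s by rewrite mulr_gt0.
have pp0 := p0; have pp1 := p1; have qq0 := q0; have NN0 := N0'.
have pN : p * N%:R <= N%:R by rewrite ler_piMl // ltW.
have kN : (k < N)%N by rewrite -(ler_nat R); lra.
have kapE : kap * N%:R = c0 * s by rewrite /kap divfK // gt_eqF.
have kap0 : 0 <= kap by rewrite divr_ge0 // ltW.
have NkP : 0 < (N - k)%:R * p by rewrite mulr_gt0 // ltr0n subn_gt0.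
rewrite -(ler_pM2r NkP) -(binpmf_succ p0 p1 kN).
rewrite [(1 - kap) * _]mulrC -[leRHS]mulrA ler_wpM2l ?binpmf_ge0 //.
rewrite natrB ?(ltnW kN) //; rewrite -natr1 in hk *; set K := k%:R in hk *.
have kap1 : kap <= 1 by rewrite ler_pdivrMr // mul1r; have : 0 <= K by []; lra.
have y1 : p * N%:R - (K + 1) <= p * N%:R by have : 0 <= K by []; lra.
have K0 : 0 <= K by [].
have NK : 0 <= N%:R - K by rewrite subr_ge0 ler_nat ltnW.
have h1 : kap * ((N%:R - K) * p) <= kap * N%:R.
  by rewrite ler_wpM2l // -[leRHS]mulr1; apply: ler_pM; rewrite ?(ltW pp0) ?(ltW pp1) // gerBl.
have -> : (1 - kap) * ((N%:R - K) * p) = (N%:R - K) * p - kap * ((N%:R - K) * p) by ring.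
lra.
Qed.
End Ratios.

Lemma cdf_left (t : R) (x : nat) : (0 < N)%N -> 0 <= t -> x%:R < p * N%:R - t ->
  cdf x <= 2 * expR (- (2 / 9 * t ^+ 2 / N%:R)).
Proof.
move=> N0 t0 hx.
have cD : #|(finset.setT : {set 'I_N})| = N by rewrite cardsT card_ord.
rewrite -(bern_cdf x cD) -[N in leRHS]cD.
apply: le_trans (hoeffding p0 p1 _ t0); last by rewrite cD.
apply: (ler_bern p0 p1) => S _; apply: ler_bool => Sx; rewrite cD.
have : #|S|%:R <= x%:R :> R by rewrite ler_nat.
by move=> h; rewrite ltr0_norm; lra.
Qed.

Lemma cdf_right (t : R) (x : nat) : (0 < N)%N -> 0 <= t -> p * N%:R + t <= x%:R ->
  1 - 2 * expR (- (2 / 9 * t ^+ 2 / N%:R)) <= cdf x.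
Proof.
move=> N0 t0 hx.
have cD : #|(finset.setT : {set 'I_N})| = N by rewrite cardsT card_ord.
rewrite -(bern_cdf x cD) -[N in leLHS]cD lerBlDr.
apply: (@le_trans _ _ (bern p finset.setT (fun S : {set 'I_N} => (#|S| <= x)%N%:R) +
    bern p finset.setT (fun S : {set 'I_N} => (t < `|#|S|%:R - p * #|(finset.setT : {set 'I_N})|%:R|)%R%:R))).
  rewrite -bernD -[leLHS](bern_cst p (finset.setT : {set 'I_N})).
  apply: (ler_bern p0 p1) => S _; case: leqP => h; first by rewrite lerDl.
  rewrite add0r (_ : (_ < _) = true) // cD.
  have : x%:R < #|S|%:R :> R by rewrite ltr_nat.
  by move=> h2; rewrite gtr0_norm; lra.
by rewrite lerD2l; apply: hoeffding => //; rewrite cD.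
Qed.

End BinomialCdf.

(** * The joint law of two degrees and the number of low vertices *)

Section Degrees.
Variables (R : realType) (p : R) (N : nat).
Hypotheses (p0 : 0 < p) (p1 : p < 1).
Local Notation q := (1 - p).
Local Notation n := N.+2.
Local Notation b := (binpmf p N).
Local Notation binexp := (binomial_mean p N).
Implicit Types (S : {set {set 'I_n}}) (u v : 'I_n) (g : nat -> R).

(** The graph has [N.+2] vertices because two given ones then have [N] further possible neighbours
    each: given the indicator of their pair, the degrees are independent and binomial with [N]
    trials, up to a shift by it. *)
Definition deg_in (S : {set {set 'I_n}}) (v : 'I_n) : nat :=
  #|S :&: star_to v (finset.setC (finset.set1 v))|.

Lemma binomial_mean_cst (c : R) : binexp (fun=> c) = c.
Proof. by rewrite /binomial_mean -mulr_suml binpmf_sum1 mul1r. Qed.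

Lemma binomial_mean_lt (y : nat) : binexp (fun k => (k < y)%N%:R) = cdf p N y - b y.
Proof.
case: y => [|y]; first by rewrite cdf0 subrr /binomial_mean big1 // => k _; rewrite ltn0 mulr0.
by rewrite cdfS addrK -binomial_mean_le.
Qed.

Lemma bern_binomial_mean (T : finType) (D : {set T}) g : #|D| = N ->
  bern p D (fun Z => g #|Z|) = binexp g.
Proof. by move=> DN; rewrite (bern_card p D g) DN. Qed.

(* The two degrees share only the indicator of the pair uv. *)
Lemma joint_degrees u v g1 g2 : u != v ->
  bern p (all_pairs n) (fun S => g1 (deg_in S u) * g2 (deg_in S v)) =
  p * (binexp (fun k => g1 k.+1) * binexp (fun k => g2 k.+1)) +
  q * (binexp g1 * binexp g2).
Proof.
move=> uv; pose C : {set 'I_n} := finset.setC [set u; v]%SET.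
have uC : u \notin C by rewrite !inE eqxx.
have vC : v \notin C by rewrite !inE eqxx orbT.
have CN : #|C| = N by have := cardsC [set u; v]%SET; rewrite cards2 uv card_ord => /addnI.
pose e : {set 'I_n} := [set u; v]%SET.
pose A := star_to u C; pose B := star_to v C.
have eA : e \notin A.
  apply/negP => /imsetP[x xC E]; have : v \in [set u; x]%SET by rewrite -E !inE eqxx orbT.
  by rewrite !inE eq_sym (negbTE uv) /= => /eqP vx; rewrite vx xC in vC.
have eB : e \notin B.
  apply/negP => /imsetP[x xC E]; have : u \in [set v; x]%SET by rewrite -E !inE eqxx.
  by rewrite !inE (negbTE uv) /= => /eqP vx; rewrite vx xC in uC.
have AB : [disjoint A & B] by apply: star_to_disjoint.
have star_u : star_to u (finset.setC (finset.set1 u)) = (e |: A)%SET.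
  rewrite /A /e -[([set u; v] |: _)%SET]/([set [set u; v]]%SET :|: _)%SET -(imset_set1 (fun x => [set u; x]%SET)).
  rewrite -[LHS]/(star_to u _) -/(star_to u (finset.set1 v)) -star_toU; congr star_to.
  by apply/setP => x; rewrite !inE negb_or; case: (eqVneq x v) => [->|_] /=; rewrite ?andbT // eq_sym uv.
have star_v : star_to v (finset.setC (finset.set1 v)) = (e |: B)%SET.
  rewrite /B /e [in RHS](finset.setUC (finset.set1 u)) -[([set v; u] |: _)%SET]/([set [set v; u]]%SET :|: _)%SET -(imset_set1 (fun x => [set v; x]%SET)).
  rewrite -[LHS]/(star_to v _) -/(star_to v (finset.set1 u)) -star_toU; congr star_to.
  by apply/setP => x; rewrite !inE negb_or; case: (eqVneq x u) => [->|_] /=; rewrite ?uv.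
pose F S := g1 (deg_in S u) * g2 (deg_in S v).
have AP : A \subset all_pairs n by apply: star_to_sub.
have BP : B \subset all_pairs n by apply: star_to_sub.
have DP : (e |: (A :|: B))%SET \subset all_pairs n.
  by rewrite !finset.subUset AP BP finset.sub1set inE cards2 uv.
have loc S : F S = F (S :&: (e |: (A :|: B)))%SET.
  rewrite /F /deg_in star_u star_v; congr (g1 _ * g2 _); apply: eq_card => x; rewrite !inE;
    by case: (x \in S) => //=; case: (x == e) => //=; case: (x \in A) => //=; case: (x \in B).
rewrite (eq_bern p (G := fun S => F (S :&: (e |: (A :|: B)))%SET)); last by move=> S _; rewrite -loc.
rewrite (bern_marginal p F DP) bernU1; last by rewrite inE negb_or eA eB.
have dA S : S \subset (A :|: B)%SET -> #|S :&: (e |: A)|%SET = #|S :&: A|%SET.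
  move=> /fintype.subsetP SAB; apply: eq_card => x; rewrite !inE; case: eqVneq => [->|] //=.
  by rewrite (negbTE eA) andbF; apply: contraNF eA => /andP[/SAB]; rewrite inE (negbTE eB) orbF.
have dB S : S \subset (A :|: B)%SET -> #|S :&: (e |: B)|%SET = #|S :&: B|%SET.
  move=> /fintype.subsetP SAB; apply: eq_card => x; rewrite !inE; case: eqVneq => [->|] //=.
  by rewrite (negbTE eB) andbF; apply: contraNF eB => /andP[/SAB]; rewrite inE (negbTE eA).
have dAe S : S \subset (A :|: B)%SET -> #|(e |: S) :&: (e |: A)|%SET = #|S :&: A|%SET.+1.
  move=> SAB; rewrite -finset.setUIr cardsU1 inE (negbTE eA) andbF //.
have dBe S : S \subset (A :|: B)%SET -> #|(e |: S) :&: (e |: B)|%SET = #|S :&: B|%SET.+1.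
  move=> SAB; rewrite -finset.setUIr cardsU1 inE (negbTE eB) andbF //.
have cA : #|A| = N by rewrite card_star_to.
have cB : #|B| = N by rewrite card_star_to.
have sA := finset.subsetUl A B; have sB := finset.subsetUr A B.
congr (p * _ + q * _).
  rewrite (eq_bern p (G := fun S => g1 #|S :&: A|%SET.+1 * g2 #|S :&: B|%SET.+1)); last first.
    by move=> S SAB; rewrite /F /deg_in star_u star_v dAe ?dBe.
  rewrite (bern_indep p (fun S => g1 #|S|.+1) (fun S => g2 #|S|.+1) AB sA sB).
  by rewrite (bern_binomial_mean (fun k => g1 k.+1) cA) (bern_binomial_mean (fun k => g2 k.+1) cB).
rewrite (eq_bern p (G := fun S => g1 #|S :&: A|%SET * g2 #|S :&: B|%SET)); last first.
  by move=> S SAB; rewrite /F /deg_in star_u star_v dA ?dB.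
rewrite (bern_indep p (fun S => g1 #|S|) (fun S => g2 #|S|) AB sA sB).
by rewrite !bern_binomial_mean.
Qed.

Lemma degree_law u g :
  bern p (all_pairs n) (fun S => g (deg_in S u)) =
  p * binexp (fun k => g k.+1) + q * binexp g.
Proof.
have [v uv] : exists v, u != v.
  by exists (if u == ord0 then ord_max else ord0); case: (eqVneq u ord0) => [->|].
have := joint_degrees g (fun=> 1) uv; rewrite !binomial_mean_cst !mulr1 => <-.
by apply: eq_bern => S _; rewrite mulr1.
Qed.

Definition low_count (a : nat) (S : {set {set 'I_n}}) : nat :=
  #|[set v | (deg_in S v <= a)%N]%SET|.

Lemma low_countE a S : (low_count a S)%:R = \sum_v (deg_in S v <= a)%N%:R :> R.
Proof.
rewrite /low_count -sum1_card natr_sum big_mkcond; apply: eq_bigr => v _.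
by rewrite inE; case: ifP.
Qed.

Local Notation mu a := (cdf p N a - p * b a).

Lemma mean_low u a : bern p (all_pairs n) (fun S => (deg_in S u <= a)%N%:R) = mu a.
Proof. rewrite (degree_law u (fun k => (k <= a)%N%:R)) binomial_mean_lt binomial_mean_le; ring. Qed.

Lemma mean_low_count a : bern p (all_pairs n) (fun S => (low_count a S)%:R) = n%:R * mu a.
Proof.
rewrite (eq_bern p (G := fun S => \sum_v (deg_in S v <= a)%N%:R)); last by move=> S _; rewrite low_countE.
rewrite bern_sum (eq_bigr (fun=> mu a)); last by move=> v _; apply: mean_low.
by rewrite sumr_const card_ord mulr_natl.
Qed.

Lemma prob_many_low a (t : R) : 0 < t ->
  gprob p (fun S => t <= (low_count a S)%:R) <= n%:R * cdf p N a / t.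
Proof.
move=> t0; apply: le_trans (gprob_markov p0 p1 (F := fun S => (low_count a S)%:R) t0 _ _) _ => //.
rewrite mean_low_count ler_pM2r ?invr_gt0 // ler_pM2l ?ltr0n // gerBl.
by rewrite mulr_ge0 ?binpmf_ge0 // ltW.
Qed.

(** Two degrees are independent given the indicator of their pair, so the covariance comes from it
    alone: p q times the square of the jump [b a] of the distribution function. *)
Lemma second_moment_low_count a :
  bern p (all_pairs n) (fun S => (low_count a S)%:R ^+ 2) <=
  n%:R * mu a + (n%:R * mu a) ^+ 2 + n%:R ^+ 2 * (p * q * b a ^+ 2).
Proof.
rewrite (eq_bern p (G := fun S => \sum_u \sum_v (deg_in S u <= a)%N%:R * (deg_in S v <= a)%N%:R)); last first.
  by move=> S _; rewrite low_countE expr2 mulr_suml; apply: eq_bigr => u _; rewrite mulr_sumr.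
have qq0 : 0 < q by rewrite subr_gt0.
have d0 : 0 <= mu a ^+ 2 + p * q * b a ^+ 2 by rewrite addr_ge0 ?sqr_ge0 // mulr_ge0 ?sqr_ge0 // mulr_ge0 // ltW.
rewrite bern_sum; apply: (@le_trans _ _ (\sum_(u : 'I_n) (mu a + n%:R * (mu a ^+ 2 + p * q * b a ^+ 2)))).
  apply: ler_sum => u _; rewrite bern_sum (bigD1 u) //= lerD //.
    rewrite -(mean_low u); apply: (ler_bern p0 p1) => S _.
    by case: (_ <= _)%N; rewrite ?mulr1 ?mulr0.
  rewrite (eq_bigr (fun=> mu a ^+ 2 + p * q * b a ^+ 2)); last first.
    move=> v vu; rewrite (joint_degrees (fun k => (k <= a)%N%:R) (fun k => (k <= a)%N%:R)) 1?eq_sym //.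
    rewrite !binomial_mean_lt !binomial_mean_le; ring.
  rewrite sumr_const -[leLHS]mulr_natl ler_wpM2r // ler_nat.
  by apply: leq_trans (max_card _) _; rewrite card_ord.
rewrite sumr_const card_ord -[leLHS]mulr_natl; move: (n%:R) (mu a) (b a) => x y z.
by rewrite le_eqVlt; apply/orP; left; apply/eqP; ring.
Qed.

(** Chebyshev's inequality; the mean is at least [n%:R * (q * cdf p N a)] because [b a] is at most
    [cdf p N a]. *)
Lemma prob_few_low a : 0 < cdf p N a ->
  gprob p (fun S => (low_count a S)%:R < n%:R * (q * cdf p N a) / 2) <=
  4 / (n%:R * (q * cdf p N a)) + 4 * p * b a ^+ 2 / (q * cdf p N a ^+ 2).
Proof.
move=> F0; have pp0 := p0; have pp1 := p1; have b0 := binpmf_ge0 p0 p1 N a.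
have q0 : 0 < q by rewrite subr_gt0.
have n0 : 0 < n%:R :> R by rewrite ltr0n.
have baF : b a <= cdf p N a by case: (a) => [|x]; rewrite ?cdf0 // cdfS lerDr cdf_ge0.
have muq : q * cdf p N a <= mu a.
  by have : p * b a <= p * cdf p N a by [rewrite ler_pM2l|]; lra.
have qF0 : 0 < q * cdf p N a by rewrite mulr_gt0.
have mu0 : 0 < mu a := lt_le_trans qF0 muq.
pose V := n%:R * mu a.
have V0 : 0 < V by rewrite mulr_gt0.
apply: (@le_trans _ _ (bern p (all_pairs n) (fun S => ((low_count a S)%:R - V) ^+ 2) / (V ^+ 2 / 4))).
  apply: (gprob_markov p0 p1).
  - by rewrite divr_gt0 // exprn_gt0.
  - by move=> S _; apply: sqr_ge0.
  move=> S _ h.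
  have hV : (low_count a S)%:R < V / 2.
    by apply: lt_le_trans h _; rewrite ler_pM2r ?invr_gt0 // ler_pM2l.
  have -> : V ^+ 2 / 4 = (V / 2) ^+ 2 by field.
  rewrite -[leRHS]sqrrN; apply: lerXn2r; rewrite ?nnegrE; lra.
have -> : bern p (all_pairs n) (fun S => ((low_count a S)%:R - V) ^+ 2) =
    bern p (all_pairs n) (fun S => (low_count a S)%:R ^+ 2) - V ^+ 2.
  rewrite (eq_bern p (G := fun S => (low_count a S)%:R ^+ 2 + ((- (2 * V)) * (low_count a S)%:R + V ^+ 2))); last first.
    by move=> S _; ring.
  rewrite !bernD bernZ bern_cst mean_low_count -/V; ring.
have := second_moment_low_count a; rewrite -/V => h2.
apply: (@le_trans _ _ ((V + n%:R ^+ 2 * (p * q * b a ^+ 2)) / (V ^+ 2 / 4))).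
  by rewrite ler_pM2r ?invr_gt0 ?divr_gt0 ?exprn_gt0 //; lra.
have -> : (V + n%:R ^+ 2 * (p * q * b a ^+ 2)) / (V ^+ 2 / 4) =
    4 / V + 4 * p * q * b a ^+ 2 / mu a ^+ 2.
  rewrite /V; move: mu0 n0; move: (mu a) (n%:R) => m x m0 x0.
  by field; rewrite !gt_eqF.
apply: lerD.
  by rewrite ler_pM2l // lef_pV2 ?posrE ?mulr_gt0 // ler_pM2l.
have -> : 4 * p * b a ^+ 2 / (q * cdf p N a ^+ 2) = 4 * p * q * b a ^+ 2 / (q * cdf p N a) ^+ 2.
  by field; rewrite !gt_eqF.
rewrite ler_wpM2l //; first by rewrite !mulr_ge0 ?sqr_ge0 ?(ltW p0) ?(ltW q0).
rewrite lef_pV2 ?posrE ?exprn_gt0 //.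
by apply: lerXn2r => //; rewrite nnegrE ltW.
Qed.

Definition close_pair (a K0 : nat) (S : {set {set 'I_n}}) : bool :=
  [exists uv : 'I_n * 'I_n, [&& uv.1 != uv.2, (deg_in S uv.1 <= a)%N,
    (deg_in S uv.1 <= deg_in S uv.2)%N & (deg_in S uv.2 < deg_in S uv.1 + K0)%N]].

Lemma binomial_mean_window (M : R) j K0 :
  (forall k, (k < j + K0)%N -> b k <= M) ->
  binexp (fun k => ((j <= k) && (k < j + K0))%N%:R) <= K0%:R * M.
Proof.
move=> hM; have M0 : (0 < K0)%N -> 0 <= M.
  by move=> K00; apply: le_trans (hM 0%N _); rewrite ?binpmf_ge0 // addn_gt0 K00 orbT.
elim: K0 hM M0 => [|K0 IH] hM M0.
  rewrite mul0r /binomial_mean big1 // => k _; rewrite addn0 (_ : (_ && _) = false) ?mulr0 //.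
  by rewrite ltnNge andbN.
have -> : binexp (fun k => ((j <= k) && (k < j + K0.+1))%N%:R) =
    binexp (fun k => ((j <= k) && (k < j + K0))%N%:R) + b (j + K0).
  rewrite -binomial_mean_point -big_split; apply: eq_bigr => k _ /=; rewrite -mulrDr -natrD.
  congr (_ * _%:R); rewrite addnS ltnS [(k <= j + K0)%N]leq_eqVlt; case: eqVneq => [->|_] /=.
    by rewrite leq_addr ltnn andbF.
  by rewrite addn0.
rewrite -natr1 mulrDl mul1r lerD //; last by apply: hM; rewrite addnS.
apply: IH => [k kj|_]; first by apply: hM; rewrite addnS ltnW.
exact: M0.
Qed.

(** The degree [j] of the first vertex is summed over; the second degree then lies in a window of
    [K0] values, each of probability at most [M]. *)
Lemma prob_close_pair a K0 (M : R) :
  (forall k, (k < a + K0)%N -> b k <= M) ->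
  gprob p (close_pair a K0) <= n%:R ^+ 2 * (cdf p N a * (K0%:R * M)).
Proof.
move=> hM; have q0 : 0 <= q by rewrite subr_ge0 ltW.
have ex := gprob_exists p0 p1 (fun uv : 'I_n * 'I_n => uv.1 != uv.2)
  (fun uv S => [&& (deg_in S uv.1 <= a)%N,
    (deg_in S uv.1 <= deg_in S uv.2)%N & (deg_in S uv.2 < deg_in S uv.1 + K0)%N]).
apply: le_trans ex _.
have KM0 : 0 <= K0%:R * M.
  case: K0 hM => [|K0] hM; first by rewrite mul0r.
  by rewrite mulr_ge0 //; apply: le_trans (hM 0%N _); rewrite ?binpmf_ge0 // addnS.
have B0 : 0 <= cdf p N a * (K0%:R * M) by rewrite mulr_ge0 ?cdf_ge0.
apply: (@le_trans _ _ (\sum_(uv : 'I_n * 'I_n | uv.1 != uv.2) cdf p N a * (K0%:R * M))); last first.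
  rewrite sumr_const -[leLHS]mulr_natl ler_wpM2r // -natrX ler_nat.
  by apply: leq_trans (max_card _) _; rewrite card_prod card_ord.
apply: ler_sum => -[u v] /= uv.
apply: (@le_trans _ _ (\sum_(j < a.+1) bern p (all_pairs n) (fun S =>
    (deg_in S u == j)%:R * ((j <= deg_in S v) && (deg_in S v < j + K0))%N%:R))).
  rewrite -bern_sum; apply: (ler_bern p0 p1) => S _.
  have s0 (I : pred 'I_a.+1) : 0 <= \sum_(j < a.+1 | I j) (deg_in S u == j)%:R * ((j <= deg_in S v) && (deg_in S v < j + K0))%N%:R :> R.
    by apply: sumr_ge0 => j _; rewrite mulr_ge0.
  case: (boolP (_ && _)) => [/and3P[ua uv1 uv2]|_] //.
  rewrite (bigD1 (Ordinal (ua : (deg_in S u < a.+1)%N))) //= eqxx uv1 uv2 mulr1 lerDl.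
  exact: s0.
rewrite (eq_bigr (fun j : 'I_a.+1 =>
   p * (binexp (fun k => (k.+1 == j)%:R) * binexp (fun k => ((j <= k.+1) && (k.+1 < j + K0))%N%:R)) +
   q * (binexp (fun k => (k == j)%:R) * binexp (fun k => ((j <= k) && (k < j + K0))%N%:R)))); last first.
  by move=> j _; apply: (joint_degrees (fun k => (k == j)%:R) (fun k => ((j <= k) && (k < j + K0))%N%:R) uv).
have w0 (j : nat) : (j <= a)%N -> binexp (fun k => ((j <= k) && (k < j + K0))%N%:R) <= K0%:R * M.
  move=> ja; apply: binomial_mean_window => k kj; apply: hM; apply: leq_trans kj _.
  by rewrite leq_add2r.
rewrite big_split /= -!mulr_sumr.
have lo : \sum_(j < a.+1) binexp (fun k => (k == j)%:R) * binexp (fun k => ((j <= k) && (k < j + K0))%N%:R)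
    <= cdf p N a * (K0%:R * M).
  rewrite /cdf mulr_suml; apply: ler_sum => j _; rewrite binomial_mean_point ler_wpM2l ?binpmf_ge0 //.
  by apply: w0; rewrite -ltnS.
have hi : \sum_(j < a.+1) binexp (fun k => (k.+1 == j)%:R) * binexp (fun k => ((j <= k.+1) && (k.+1 < j + K0))%N%:R)
    <= cdf p N a * (K0%:R * M).
  rewrite big_ord_recl /= {1}/binomial_mean big1 ?mul0r ?add0r; last by move=> k _; rewrite mulr0.
  apply: (@le_trans _ _ (\sum_(j < a) b j * (K0%:R * M))).
    apply: ler_sum => j _; rewrite (_ : binexp _ = b j); last first.
      by rewrite -binomial_mean_point; apply: eq_bigr => k _.
    rewrite ler_wpM2l ?binpmf_ge0 //.
    rewrite (_ : binexp _ = binexp (fun k => ((j <= k) && (k < j + K0))%N%:R)).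
      by apply: w0; rewrite ltnW.
    by apply: eq_bigr => k _.
  rewrite -mulr_suml ler_wpM2r // /cdf big_ord_recr /= lerDl.
  by apply: binpmf_ge0.
have := ler_wpM2l (ltW p0) hi; have := ler_wpM2l q0 lo; lra.
Qed.

End Degrees.

Section DegreeScale.
Variables (R : realType) (p : R) (N : nat) (s L : R).
Hypotheses (p0 : 0 < p) (p1 : p < 1).
Hypotheses (nL : N.+2%:R = expR L) (s0 : 0 < s) (sL : s ^+ 2 = N.+2%:R * L).
Hypotheses (L3 : 3 <= L) (L_big : 16 * L / (p * (1 - p)) <= expR (L / 10)).
Local Notation q := (1 - p).
Local Notation b := (binpmf p N).
Local Notation F := (cdf p N).

Let q0 : 0 < q. Proof. by rewrite subr_gt0. Qed.
Let pq0 : 0 < p * q. Proof. by rewrite mulr_gt0. Qed.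
Let L0 : 0 < L. Proof. by apply: lt_le_trans L3. Qed.

Lemma scale_n : N.+2%:R = N%:R + 2 :> R.
Proof. by rewrite -addn2 natrD. Qed.

Lemma scale_N : [/\ 2 <= N%:R :> R & N.+2%:R <= 2 * N%:R :> R].
Proof. by have := expR_ge1Dx L; rewrite -nL scale_n; have := L3; split; lra. Qed.

Lemma expR_half : expR L = expR (L / 2) * expR (L / 2).
Proof. by rewrite -expRD; congr expR; field. Qed.

Lemma scale_s_ge : expR (L / 2) <= s.
Proof.
rewrite -(ler_pXn2r (ltn0Sn 1)) ?nnegrE ?expR_ge0 ?(ltW s0) //.
by rewrite sL nL expr2 -expR_half ler_peMr ?expR_ge0 //; have := L3; lra.
Qed.

Lemma scale_s_le : s <= L * expR (L / 2).
Proof.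
rewrite -(ler_pXn2r (ltn0Sn 1)) ?nnegrE ?(ltW s0) //; last by rewrite mulr_ge0 ?expR_ge0 ?ltW.
rewrite sL nL exprMn [expR _ ^+ 2]expr2 -expR_half mulrC ler_wpM2r ?expR_ge0 //.
by rewrite expr2 ler_peMr ?(ltW L0) //; have := L3; lra.
Qed.

Lemma scale_s1 : 5 / 2 <= s.
Proof. by have := scale_s_ge; have := expR_ge1Dx (L / 2); have := L3; lra. Qed.

Lemma scale_sN : 8 * s <= p * q * N%:R.
Proof.
have [N2 nN] := scale_N; have pq := pq0; have e0 := expR_gt0 (L / 2).
have h : 16 * L <= p * q * expR (L / 2).
  have : 16 * L <= p * q * expR (L / 10) by have := L_big; rewrite ler_pdivrMr // [expR _ * _]mulrC.
  move/le_trans; apply; rewrite ler_pM2l // ler_expR; have := L0; lra.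
have h2 : p * q * (expR (L / 2) * expR (L / 2)) <= p * q * (2 * N%:R).
  by rewrite ler_pM2l // -expR_half -nL.
have h3 : 16 * L * expR (L / 2) <= p * q * expR (L / 2) * expR (L / 2) by rewrite ler_pM2r.
have := scale_s_le; lra.
Qed.

Lemma scale_kap : 8 * s / (p * q * N%:R) <= 16 * L / (p * q * s).
Proof.
have [N2 nN] := scale_N; have N0 : 0 < N%:R :> R by lra.
rewrite ler_pdivrMr ?mulr_gt0 // mulrAC ler_pdivlMr ?mulr_gt0 //.
have -> : 8 * s * (p * q * s) = 8 * (p * q) * s ^+ 2 by ring.
have -> : 16 * L * (p * q * N%:R) = 8 * (p * q) * (2 * N%:R * L) by ring.
rewrite ler_pM2l ?mulr_gt0 // sL ler_pM2r //.
Qed.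

Lemma scale_kap_exp : 16 * L / (p * q * s) <= expR (- (2 / 5 * L)).
Proof.
have -> : 16 * L / (p * q * s) = 16 * L / (p * q) * s^-1.
  by field; rewrite !gt_eqF ?s0 ?p0 ?q0.
have -> : - (2 / 5 * L) = L / 10 + - (L / 2) by field.
rewrite expRD expRN; apply: ler_pM => //; last by rewrite lef_pV2 ?posrE ?expR_gt0 // scale_s_ge.
  by rewrite divr_ge0 ?mulr_ge0 // ltW.
by rewrite invr_ge0 ltW.
Qed.

(** The left end of the range where the ratio of consecutive probabilities is controlled; [cdf]
    there is at most 2 n^(-2). *)
Let t0 := (Num.truncn (p * N%:R - 4 * s)).+1.

Let scale_t0 : 0 <= p * N%:R - 4 * s.
Proof.
have [N2 _] := scale_N; have h := scale_sN; have ss := s0; have pp1 := p1.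
have : p * q * N%:R <= p * N%:R; last lra.
by rewrite ler_wpM2r ?ler_piMr ?(ltW p0) ?gerBl ?(ltW p0) //; lra.
Qed.

Let t0_itv : p * N%:R - 4 * s <= t0%:R /\ t0%:R <= p * N%:R - 4 * s + 1.
Proof. by have /andP[h1 h2] := truncn_itv scale_t0; split; [apply: ltW|rewrite /t0 -[leLHS]natr1 lerD2r]. Qed.

Let cdf_t0 : F t0 <= 2 * expR (- (2 * L)).
Proof.
have [N2 nN] := scale_N; have s1 := scale_s1; have [_ t2] := t0_itv.
have N0 : (0 < N)%N by rewrite -(ltr_nat R); lra.
have N0R : 0 < N%:R :> R by rewrite ltr0n.
apply: le_trans (cdf_left p0 p1 (t := 3 * s) N0 _ _) _; [lra|lra|].
rewrite ler_pM2l // ler_expR lerN2 ler_pdivlMr // exprMn sL scale_n.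
have := L0; have : 0 <= N%:R * L by rewrite mulr_ge0 // ltW.
lra.
Qed.

Let ratio k : (t0 <= k)%N -> b k.+1 <= (1 + 8 * s / (p * q * N%:R)) * b k.
Proof.
move=> tk; have [t1 _] := t0_itv.
apply: ratio_upper => //; first by rewrite -(ltr_nat R); have [N2 _] := scale_N; lra.
  exact: scale_sN.
by apply: le_trans t1 _; rewrite ler_nat.
Qed.

Let kap_ge0 : 0 <= 8 * s / (p * q * N%:R).
Proof. by rewrite divr_ge0 ?mulr_ge0 // ltW. Qed.

Lemma cdf_grow x j :
  F (x + j) <= expR (16 * L / (p * q * s) * j%:R) * (F x + j%:R * (2 * expR (- (2 * L)))).
Proof.
apply: le_trans (cdf_steps_exp p0 p1 kap_ge0 ratio x j) _.
apply: ler_pM; rewrite ?expR_ge0 //.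
- by rewrite addr_ge0 ?mulr_ge0 ?cdf_ge0.
- by rewrite ler_expR ler_wpM2r // scale_kap.
- by rewrite lerD2l ler_wpM2l.
Qed.

Lemma pmf_small x : b x <= expR (- (2 / 5 * L)) * F x + 2 * expR (- (2 * L)).
Proof.
apply: le_trans (binpmf_le_cdf p0 p1 kap_ge0 ratio x) _; apply: lerD => //.
by rewrite ler_wpM2r ?cdf_ge0 // (le_trans scale_kap) // scale_kap_exp.
Qed.

(** Just before the quantile the distribution function is below [tau], and one step at most doubles
    it, up to the tail left of [t0]. *)
Lemma quantile_upper (tau : R) a : 2 * expR (- (2 * L)) <= tau ->
  (forall x, (x < a)%N -> F x < tau) -> F a <= 3 * tau.
Proof.
have e0 := expR_gt0 (- (2 * L)).
move=> et; have tt : 0 < tau by lra.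
case: a => [|a] h; first by have := cdf_le N p0 p1 (leq0n t0); have := cdf_t0; lra.
have h1 := cdf_step p0 p1 kap_ge0 ratio a.
have h2 : (1 + 8 * s / (p * q * N%:R)) * F a <= 2 * F a.
  rewrite ler_wpM2r ?cdf_ge0 // -[2]/(1 + 1) lerD2l (le_trans scale_kap) // (le_trans scale_kap_exp) //.
  by rewrite -[leRHS]expR0 ler_expR; have := L0; lra.
have := h a (ltnSn a); have := cdf_t0; lra.
Qed.

(** The variance term is governed by the square of [b a / F a], of order n^(-4/5); this is why [e]
    is at most 4/5. *)
Lemma prob_few_low_exp a (e : R) : 0 < e -> e <= 4 / 5 -> expR (- ((1 - e) * L)) <= F a ->
  gprob p (fun S : {set {set 'I_N.+2}} => (low_count a S)%:R < q / 2 * expR (e * L)) <=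
  40 / q * expR (- (e * L)).
Proof.
move=> e0 e1 hF; have F0 : 0 < F a by apply: lt_le_trans hF; apply: expR_gt0.
have LL := L3; have eLe : expR L * expR (- ((1 - e) * L)) = expR (e * L).
  by rewrite -expRD; congr expR; ring.
have nF : expR (e * L) <= N.+2%:R * F a by rewrite nL -eLe ler_pM2l ?expR_gt0.
apply: (@le_trans _ _ (gprob p (fun S : {set {set 'I_N.+2}} => (low_count a S)%:R < N.+2%:R * (q * F a) / 2))).
  apply: (gprob_le p0 p1) => S _ h; apply: lt_le_trans h _.
  have -> : N.+2%:R * (q * F a) / 2 = q / 2 * (N.+2%:R * F a) by field.
  by rewrite ler_pM2l // divr_gt0.
apply: le_trans (prob_few_low p0 p1 F0) _.
have f1 : 4 / (N.+2%:R * (q * F a)) <= 4 / q * expR (- (e * L)).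
  rewrite expRN -mulrA -invfM ler_pM2l // lef_pV2 ?posrE ?mulr_gt0 ?expR_gt0 //.
  by rewrite mulrCA ler_pM2l.
have f2 : b a <= 3 * expR (- (2 / 5 * L)) * F a.
  apply: le_trans (pmf_small a) _.
  have : 2 * expR (- (2 * L)) <= 2 * (expR (- (2 / 5 * L)) * F a); last lra.
  rewrite ler_pM2l //; apply: (@le_trans _ _ (expR (- (2 / 5 * L)) * expR (- ((1 - e) * L)))); last by rewrite ler_pM2l ?expR_gt0.
  rewrite -expRD ler_expR; have : 0 <= e * L by rewrite mulr_ge0 ?ltW.
  lra.
have f3 : b a ^+ 2 <= 9 * expR (- (e * L)) * F a ^+ 2.
  apply: (@le_trans _ _ ((3 * expR (- (2 / 5 * L)) * F a) ^+ 2)).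
    by apply: lerXn2r => //; rewrite nnegrE ?binpmf_ge0 // !mulr_ge0 ?expR_ge0 ?ltW.
  rewrite !exprMn ler_wpM2r ?sqr_ge0 // -natrX ler_pM2l // -expRM_natr ler_expR.
  have : e * L <= 4 / 5 * L by rewrite ler_pM2r.
  lra.
have f4 : 4 * p * b a ^+ 2 / (q * F a ^+ 2) <= 36 / q * expR (- (e * L)).
  rewrite ler_pdivrMr ?mulr_gt0 ?exprn_gt0 //.
  have -> : 36 / q * expR (- (e * L)) * (q * F a ^+ 2) = 4 * (9 * expR (- (e * L)) * F a ^+ 2).
    by move: (expR _) (F a) => x y; field; rewrite gt_eqF.
  rewrite -mulrA ler_pM2l //; apply: le_trans f3.
  by rewrite ler_piMl ?sqr_ge0 // ltW.
have -> : 40 / q * expR (- (e * L)) = 4 / q * expR (- (e * L)) + 36 / q * expR (- (e * L)).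
  by ring.
exact: lerD.
Qed.
End DegreeScale.

Section DegreeEvents.
Variables (R : realType) (p : R) (N : nat) (s L : R).
Hypotheses (p0 : 0 < p) (p1 : p < 1).
Hypotheses (nL : N.+2%:R = expR L) (s0 : 0 < s) (sL : s ^+ 2 = N.+2%:R * L).
Hypotheses (L200 : 200 <= L) (L_big : 16 * L / (p * (1 - p)) <= expR (L / 10)).
Local Notation q := (1 - p).
Local Notation b := (binpmf p N).
Local Notation F := (cdf p N).

Let q0 : 0 < q. Proof. by rewrite subr_gt0. Qed.
Let L3 : 3 <= L. Proof. by apply: le_trans L200; lra. Qed.
Let L0 : 0 < L. Proof. by apply: lt_le_trans L3. Qed.

Lemma scale_s_n : s <= expR L.
Proof.
have [N2 nN] := scale_N nL L3; have h := scale_sN p0 p1 nL s0 sL L3 L_big.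
have : p * q * N%:R <= 1 * N%:R.
  rewrite ler_wpM2r //; apply: mulr_ile1; rewrite ?ltW //.
  by rewrite gtrBl.
have := scale_n R N; rewrite nL; have := s0; lra.
Qed.

Lemma cdf_shift a j (tau x : R) : F a <= 3 * tau -> expR (- L) <= tau ->
  j%:R <= expR L -> 16 * L / (p * q * s) * j%:R <= x -> F (a + j) <= 5 * (expR x * tau).
Proof.
move=> Fa taue jn jx; have t0 : 0 < tau by apply: lt_le_trans taue; apply: expR_gt0.
apply: le_trans (cdf_grow p0 p1 nL s0 sL L3 L_big a j) _.
rewrite [leRHS]mulrCA; apply: ler_pM; rewrite ?expR_ge0 ?ler_expR //.
  by rewrite addr_ge0 ?mulr_ge0 ?cdf_ge0 ?expR_ge0.
have : j%:R * expR (- (2 * L)) <= expR L * expR (- (2 * L)) by rewrite ler_wpM2r ?expR_ge0.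
rewrite -expRD (_ : L + - (2 * L) = - L); [lra|ring].
Qed.

Lemma quantile_at (e : R) : 0 <= e -> e <= 1 -> exists2 a : nat,
  expR (- ((1 - e) * L)) <= F a & F a <= 3 * expR (- ((1 - e) * L)).
Proof.
move=> e0 e1; have LL := L200.
have h0 : 0 <= (1 - e) * L by rewrite mulr_ge0 ?subr_ge0 // ltW.
have t1 : expR (- ((1 - e) * L)) <= 1 by rewrite -[leRHS]expR0 ler_expR oppr_le0.
have [a [ha amin]] := quantile_exists p N (expR_gt0 _) t1.
exists a => //; apply: (quantile_upper p0 p1 nL s0 sL L3 L_big) => //.
have -> : - ((1 - e) * L) = - (2 * L) + (1 + e) * L by ring.
rewrite [leRHS]expRD mulrC ler_pM2l ?expR_gt0 //; apply: le_trans (expR_ge1Dx _).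
have : 0 <= e * L by rewrite mulr_ge0 // ltW.
lra.
Qed.

(** The complement of this event is what [unique_min_degree] needs: some vertex is low, few are
    nearly low, and no two degrees are close at the low end. *)
Lemma prob_no_gap (c : R) : 0 < c -> 640 * c <= p * q -> exists a K0 : nat,
  (0 < K0)%N /\
  gprob p (fun S : {set {set 'I_N.+2}} =>
    (low_count a S == 0)%N ||
    ((K0 <= low_count (a + Num.truncn (2 * c * s)) S)%N || close_pair a K0 S)) <=
  (40 / q + 47) * expR (- (L / 20)).
Proof.
move=> c0 cpq; have LL := L200; have ss := s0; have pq0 : 0 < p * q by rewrite mulr_gt0.
have [||a aF Fa] := @quantile_at (1 / 20); [lra|lra|].
pose x := expR (3 / 20 * L); have x0 : 0 < x by apply: expR_gt0.
have /andP[Kx xK] := truncn_itv (ltW x0).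
pose K0 := (Num.truncn x).+1; exists a, K0; split => //.
have K2 : K0%:R <= 2 * x.
  by rewrite /K0 -[leLHS]natr1; have : 1 <= x; [rewrite -[leLHS]expR0 ler_expR; lra|lra].
set tau := expR (- ((1 - 1 / 20) * L)) in aF Fa.
have etau : expR (- L) <= tau by rewrite ler_expR; lra.
have xtau : expR (L / 20) * tau = expR (- (9 / 10 * L)) by rewrite -expRD; congr expR; field.
have cs0 : 0 <= 2 * c * s by rewrite !mulr_ge0 // ltW.
have /andP[js _] := truncn_itv cs0.
set j := Num.truncn (2 * c * s) in js *.
have pq1 : p * q <= 1 by apply: mulr_ile1; rewrite ?ltW // gtrBl.
have Fj : F (a + j) <= 5 * expR (- (9 / 10 * L)).
  rewrite -xtau; apply: cdf_shift => //.
    apply: le_trans js _; apply: le_trans (scale_s_n).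
    have : c * s <= 1 / 2 * s by rewrite ler_pM2r //; lra.
    lra.
  apply: (@le_trans _ _ (16 * L / (p * q * s) * (2 * c * s))).
    by rewrite ler_wpM2l // divr_ge0 ?mulr_ge0 // ltW.
  (* The bound [640 * c <= p * q] makes this exponent at most L / 20. *)
  have -> : 16 * L / (p * q * s) * (2 * c * s) = 32 * c * L / (p * q).
    by field; rewrite !gt_eqF ?q0.
  rewrite ler_pdivrMr //; have : 640 * c * L <= p * q * L by rewrite ler_pM2r.
  lra.
have FK : F (a + K0) <= 5 * expR (- (9 / 10 * L)).
  rewrite -xtau; apply: cdf_shift => //.
    apply: le_trans K2 _.
    have -> : L = 3 / 20 * L + 17 / 20 * L by field.
    rewrite [leRHS]expRD -/x mulrC ler_pM2l //; apply: le_trans (expR_ge1Dx _); lra.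
  apply: (@le_trans _ _ (expR (- (2 / 5 * L)) * (2 * x))).
    apply: ler_pM => //; last exact: (scale_kap_exp p0 p1 nL s0 sL L3 L_big).
    by rewrite divr_ge0 ?mulr_ge0 // ltW.
  rewrite mulrCA -expRD; have : expR (- (2 / 5 * L) + 3 / 20 * L) <= 1.
    by rewrite -[leRHS]expR0 ler_expR; lra.
  lra.
have bM k : (k < a + K0)%N -> b k <= 7 * expR (- (13 / 10 * L)).
  move=> kK; apply: le_trans (pmf_small p0 p1 nL s0 sL L3 L_big k) _.
  have h1 : expR (- (2 / 5 * L)) * F k <= expR (- (2 / 5 * L)) * (5 * expR (- (9 / 10 * L))).
    by rewrite ler_pM2l ?expR_gt0 //; apply: le_trans FK; apply: cdf_le => //; apply: ltnW.
  rewrite mulrCA -expRD (_ : - (2 / 5 * L) + _ = - (13 / 10 * L)) in h1; last by field.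
  have : expR (- (2 * L)) <= expR (- (13 / 10 * L)) by rewrite ler_expR; lra.
  lra.
have ev1 : gprob p (fun S : {set {set 'I_N.+2}} => (low_count a S == 0)%N) <= 40 / q * expR (- (L / 20)).
  have -> : L / 20 = 1 / 20 * L by field.
  apply: le_trans (prob_few_low_exp p0 p1 nL s0 sL L3 L_big _ _ aF); [|lra|lra].
  apply: (gprob_le p0 p1) => S _ /eqP ->.
  by rewrite mulr_gt0 ?expR_gt0 // divr_gt0.
have ev2 : gprob p (fun S : {set {set 'I_N.+2}} => (K0 <= low_count (a + j) S)%N) <= 5 * expR (- (L / 20)).
  have xK' : x <= K0%:R by apply: ltW.
  have K0p : 0 < K0%:R :> R by rewrite ltr0n.
  apply: (@le_trans _ _ (N.+2%:R * F (a + j) / K0%:R)).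
    apply: le_trans (prob_many_low N p0 p1 (a + j) K0p).
    by apply: (gprob_le p0 p1) => S _; rewrite ler_nat.
  rewrite ler_pdivrMr // nL; apply: (@le_trans _ _ (5 * expR (- (L / 20)) * x)); last first.
    by rewrite ler_pM2l // mulr_gt0 ?expR_gt0.
  apply: (@le_trans _ _ (expR L * (5 * expR (- (9 / 10 * L))))); first by rewrite ler_pM2l ?expR_gt0.
  by rewrite [leLHS]mulrCA -[leRHS]mulrA ler_pM2l // -!expRD ler_expR; lra.
(* Exponents of n: 2 for the pairs, -19/20 for the low vertex, 3/20 for the window and -13/10 for
   each value in it, in total -1/10. *)
have ev3 : gprob p (@close_pair N a K0) <= 42 * expR (- (L / 20)).
  apply: le_trans (prob_close_pair p0 p1 bM) _.
  apply: (@le_trans _ _ (expR L ^+ 2 * ((3 * tau) * ((2 * x) * (7 * expR (- (13 / 10 * L))))))).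
    rewrite nL ler_pM2l ?exprn_gt0 ?expR_gt0 //; apply: ler_pM => //.
    - exact: cdf_ge0.
    - by rewrite ler_pM2r // mulr_gt0 ?expR_gt0.
  have -> : expR L ^+ 2 * (3 * tau * (2 * x * (7 * expR (- (13 / 10 * L))))) =
     42 * (expR L * expR L * tau * x * expR (- (13 / 10 * L))) by ring.
  by rewrite ler_pM2l // -!expRD ler_expR; lra.
have -> : (40 / q + 47) * expR (- (L / 20)) =
  40 / q * expR (- (L / 20)) + (5 * expR (- (L / 20)) + 42 * expR (- (L / 20))) by ring.
apply: le_trans (gprobU p0 p1 (fun S => (low_count a S == 0)%N) _) _; apply: lerD => //.
apply: le_trans (gprobU p0 p1 (fun S => (K0 <= low_count (a + j) S)%N) _) _; exact: lerD.
Qed.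

Section Low.
Variable zeta : R.
Hypotheses (z0 : 0 < zeta) (z1 : zeta <= 1).
(** Half of the exponent that the distribution function loses over [zeta * s] steps to the left of a
    point at distance p q s / 100 below the mean. *)
Let e2 := p * q * zeta / 200.
Hypothesis hoef : 2 * expR (- (2 / 9 * (p * q / 100) ^+ 2 * L)) <= 1 / 4.

Let e2_bounds : 0 < e2 /\ e2 <= 1 / 200.
Proof.
have pq0 : 0 < p * q by rewrite mulr_gt0.
have pq1 : p * q <= 1 by apply: mulr_ile1; rewrite ?ltW // gtrBl.
have : 0 < p * q * zeta by rewrite mulr_gt0.
have : p * q * zeta <= 1 by apply: mulr_ile1; rewrite ?(ltW z0) ?(ltW pq0).
by rewrite /e2; split; lra.
Qed.

Let tau := expR (- ((1 - (1 / 2 + e2)) * L)).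

(** Were the quantile closer to the mean, about [2 * c0 * s] further steps would pass the mean and
    reach probability 3/4. But they multiply the tail by at most n^(7/20), up to a constant, and it
    starts near n^(-1/2). *)
Lemma quantile_left a : F a <= 3 * tau -> a%:R <= p * N%:R - p * q / 100 * s.
Proof.
have [e20 e2s] := e2_bounds; have LL := L200; have ss := s0.
have pq0 : 0 < p * q by rewrite mulr_gt0.
have pq1 : p * q <= 1 by apply: mulr_ile1; rewrite ?ltW // gtrBl.
move=> Fa; rewrite leNgt; apply/negP => ha.
have hf := hoef; set c0 := p * q / 100 in hf ha; have c00 : 0 < c0 by rewrite /c0; lra.
have cs0 : 0 <= 2 * c0 * s by rewrite !mulr_ge0 // ltW.
have /andP[js sj] := truncn_itv cs0.
set j := (Num.truncn (2 * c0 * s)).+1.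
have js' : j%:R <= 2 * c0 * s + 1 by rewrite /j -[leLHS]natr1 lerD2r.
have sj' : 2 * c0 * s <= j%:R by apply: ltW.
have [N2 nN] := scale_N nL L3.
have N0 : (0 < N)%N by rewrite -(ltr_nat R); lra.
have N0R : 0 < N%:R :> R by rewrite ltr0n.
have s1 := scale_s1 nL s0 sL L3; have sn := scale_s_n.
have etau : expR (- L) <= tau.
  by rewrite ler_expR lerN2 ler_piMl ?(ltW L0) //; lra.
have lo : 1 - 1 / 4 <= F (a + j).
  apply: le_trans (cdf_right p0 p1 (t := c0 * s) N0 _ _); last 2 first.
  - by rewrite mulr_ge0 // ltW.
  - by rewrite natrD; lra.
  rewrite lerD2l lerN2; apply: le_trans hf; rewrite ler_pM2l // ler_expR lerN2.
  rewrite ler_pdivlMr // [(c0 * s) ^+ 2]exprMn sL scale_n.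
  have : 0 <= c0 ^+ 2 * L by rewrite mulr_ge0 ?sqr_ge0 // ltW.
  lra.
have hi : F (a + j) <= 5 * (expR (7 / 20 * L) * tau).
  apply: cdf_shift => //.
    apply: le_trans js' _; apply: le_trans sn.
    have : c0 * s <= 1 / 100 * s by rewrite ler_pM2r //; rewrite /c0; lra.
    lra.
  apply: (@le_trans _ _ (16 * L / (p * q * s) * (2 * c0 * s + 1))).
    by rewrite ler_wpM2l // divr_ge0 ?mulr_ge0 // ltW.
  rewrite mulrDr mulr1.
  have -> : 16 * L / (p * q * s) * (2 * c0 * s) = 8 / 25 * L.
    by rewrite /c0; field; rewrite !gt_eqF ?q0.
  have := scale_kap_exp p0 p1 nL s0 sL L3 L_big.
  have : expR (- (2 / 5 * L)) <= 1 by rewrite -[leRHS]expR0 ler_expR; lra.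
  lra.
have small : 5 * (expR (7 / 20 * L) * tau) <= 1 / 4.
  have -> : 1 / 4 = 5 * (20 : R)^-1 by field.
  rewrite ler_pM2l // -expRD.
  apply: (@le_trans _ _ (expR (- (L / 10)))).
    rewrite ler_expR; have : e2 * L <= 1 / 200 * L by rewrite ler_pM2r.
    lra.
  by rewrite expRN lef_pV2 ?posrE ?expR_gt0 //; apply: le_trans (expR_ge1Dx _); lra.
lra.
Qed.

(** At level n^(-1/2 + e2) about n^(1/2 + e2) vertices are low, more than 36 s / p. Moving
    [zeta * s] to the left divides the tail by about n^(2 e2), so only about n^(1/2 - e2) vertices
    are much lower. *)
Lemma prob_low_degrees : 36 / p * L <= q / 2 * expR (e2 * L) ->
  exists a : nat, a%:R <= p * N%:R /\
  gprob p (fun S : {set {set 'I_N.+2}} =>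
    ((low_count a S)%:R < 36 / p * s) ||
    (zeta * s < #|[set v | ((deg_in S v)%:R <= a%:R - zeta * s)%R]%SET|%:R)) <=
  (40 / q + 3 * expR 1 / zeta) * expR (- (e2 * L)).
Proof.
move=> e2L; have [e20 e2s] := e2_bounds; have LL := L200; have ss := s0; have zz := z0.
have pq0 : 0 < p * q by rewrite mulr_gt0.
have pq1 : p * q <= 1 by apply: mulr_ile1; rewrite ?ltW // gtrBl.
have [||a aF Fa] := @quantile_at (1 / 2 + e2); [lra|lra|].
have al := quantile_left Fa.
set c0 := p * q / 100 in al; have c00 : 0 < c0 by rewrite /c0; lra.
have cs0 : 0 < c0 * s by rewrite mulr_gt0.
exists a; split; first lra.
have [N2 nN] := scale_N nL L3.
have N0 : (0 < N)%N by rewrite -(ltr_nat R); lra.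
have N0R : 0 < N%:R :> R by rewrite ltr0n.
have n0R : 0 < N.+2%:R :> R by rewrite ltr0n.
have ev1 : gprob p (fun S : {set {set 'I_N.+2}} => (low_count a S)%:R < 36 / p * s) <= 40 / q * expR (- (e2 * L)).
  apply: (@le_trans _ _ (40 / q * expR (- ((1 / 2 + e2) * L)))); last first.
    by rewrite ler_pM2l ?divr_gt0 // ler_expR lerN2 ler_pM2r // lerDr.
  apply: le_trans (prob_few_low_exp p0 p1 nL s0 sL L3 L_big _ _ aF); [|lra|lra].
  apply: (gprob_le p0 p1) => S _ /lt_le_trans; apply.
  apply: (@le_trans _ _ (36 / p * (L * expR (L / 2)))).
    by rewrite ler_pM2l ?divr_gt0 // (scale_s_le nL s0 sL L3).
  rewrite [(_ + e2) * L]mulrDl expRD [1 / 2 * L](_ : _ = L / 2); last by field.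
  rewrite mulrA [expR (L / 2) * _]mulrC [leRHS]mulrA ler_pM2r ?expR_gt0 //.
pose B (S : {set {set 'I_N.+2}}) := [set v | ((deg_in S v)%:R <= a%:R - zeta * s)%R]%SET.
have zs0 : 0 < zeta * s by rewrite mulr_gt0.
have /andP[js sj] := truncn_itv (ltW zs0).
set j := Num.truncn (zeta * s) in js sj.
have ev2 : gprob p (fun S : {set {set 'I_N.+2}} => zeta * s < #|B S|%:R) <= 3 * expR 1 / zeta * expR (- (e2 * L)).
  have Bj S v : v \in B S -> (deg_in S v + j <= a)%N.
    by rewrite inE => h; rewrite -(ler_nat R) natrD; lra.
  have [ja|aj] := leqP j a; last first.
    apply: (@le_trans _ _ 0); last by rewrite mulr_ge0 ?expR_ge0 // divr_ge0 ?mulr_ge0 ?expR_ge0 // ltW.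
    rewrite -[leRHS](bern_cst p (all_pairs N.+2)) /gprob; apply: (ler_bern p0 p1) => S _.
    rewrite (_ : #|B S| = 0%N) ?ltNge ?(ltW zs0) //.
    apply: eq_card0 => v; apply/negP => /Bj h.
    by move: (leq_trans (leq_addl _ _) h); rewrite leqNgt aj.
  apply: (@le_trans _ _ (N.+2%:R * F (a - j) / (zeta * s))).
    apply: le_trans (prob_many_low N p0 p1 (a - j) zs0).
    apply: (gprob_le p0 p1) => S _ /ltW/le_trans; apply.
    rewrite ler_nat; apply/subset_leq_card/fintype.subsetP => v /Bj h.
    by rewrite inE leq_subRL // addnC.
  have kap1 : c0 * s / N%:R <= 1.
    rewrite ler_pdivrMr // mul1r; have : p * N%:R <= 1 * N%:R by rewrite ler_pM2r // ltW.
    have : 0 <= a%:R :> R by []. lra.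
  have rat k : (k < a)%N -> b k <= (1 - c0 * s / N%:R) * b k.+1.
    by move=> ka; apply: ratio_lower => //; apply: le_trans al; rewrite ler_nat.
  have dec : F (a - j) <= expR (- (c0 * s / N%:R * j%:R)) * F a.
    by have := @cdf_decay _ p N p0 p1 _ a kap1 rat (a - j) j; rewrite subnK //; apply.
  have kj : c0 * zeta * L - 1 <= c0 * s / N%:R * j%:R.
    apply: (@le_trans _ _ (c0 * s / N.+2%:R * (zeta * s - 1))).
      have -> : c0 * s / N.+2%:R * (zeta * s - 1) = c0 * zeta * s ^+ 2 / N.+2%:R - c0 * s / N.+2%:R.
        by move: (N.+2%:R) n0R => x x0; field; rewrite gt_eqF.
      rewrite sL [N.+2%:R * L]mulrC !mulrA mulfK ?gt_eqF // lerD2l lerN2.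
      by apply: le_trans kap1; rewrite ler_pM2l // lef_pV2 ?posrE // ler_nat ltnW.
    have [h|h] := lerP (zeta * s - 1) 0.
      apply: (@le_trans _ _ 0); first by rewrite mulr_ge0_le0 // divr_ge0 // ltW.
      by rewrite mulr_ge0 // divr_ge0 // ltW.
    rewrite ler_pM ?(ltW h) ?divr_ge0 ?(ltW cs0) //.
      by rewrite ler_pM2l // lef_pV2 ?posrE // ler_nat ltnW.
    by rewrite lerBlDr natr1 ltW.
  rewrite ler_pdivrMr //.
  have c0e : c0 * zeta = 2 * e2 by rewrite /c0 /e2; field.
  apply: (@le_trans _ _ (expR L * (expR (1 - 2 * e2 * L) * (3 * tau)))).
    rewrite nL ler_pM2l ?expR_gt0 //; apply: le_trans dec _.
    rewrite ler_pM ?expR_ge0 ?cdf_ge0 // ler_expR -c0e; lra.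
  have -> : 3 * expR 1 / zeta * expR (- (e2 * L)) * (zeta * s) = 3 * (expR 1 * expR (- (e2 * L)) * s).
    by move: (expR 1) (expR (- (e2 * L))) => u v; field; rewrite gt_eqF.
  have -> : expR L * (expR (1 - 2 * e2 * L) * (3 * tau)) = 3 * (expR L * expR (1 - 2 * e2 * L) * tau) by ring.
  rewrite ler_pM2l //; apply: (@le_trans _ _ (expR 1 * expR (- (e2 * L)) * expR (L / 2))).
    rewrite -!expRD ler_expR; lra.
  by rewrite ler_pM2l ?mulr_gt0 ?expR_gt0 // (scale_s_ge nL s0 sL L3).
rewrite [leRHS]mulrDl.
exact: le_trans (gprobU p0 p1 (fun S => (low_count a S)%:R < 36 / p * s) (fun S => zeta * s < #|B S|%:R)) (lerD ev1 ev2).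
Qed.
End Low.
End DegreeEvents.

(** * The theorem *)

Lemma degree_deg_in (N : nat) (H : sgraph 'I_N.+2) v : degree H v = deg_in (edges H) v.
Proof. exact: degree_star. Qed.

(** The smallest degree is at most [a], so another vertex of nearly that degree would form a close
    pair, and the vertices within [x] of it are counted by [low_count]. *)
Lemma unique_min_degree (R : realType) (N a K0 : nat) (H : sgraph 'I_N.+2) (x : R) : 0 <= x ->
  low_count a (edges H) != 0%N -> ~~ (K0 <= low_count (a + Num.truncn x) (edges H))%N ->
  ~~ close_pair a K0 (edges H) ->
  exists u, (forall v, v != u -> (degree H u + K0 <= degree H v)%N) /\
    (#|[set v | ((degree H v)%:R <= (degree H u)%:R + x :> R)%R]%SET| <= K0)%N.
Proof.
move=> x0 lo hi far.
have [v0 v0a] : exists v0, (deg_in (edges H) v0 <= a)%N.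
  have /card_gt0P[v0] : (0 < low_count a (edges H))%N by rewrite lt0n.
  by rewrite inE => h; exists v0.
pose u := [arg min_(v < v0) degree H v].
have umin v : (degree H u <= degree H v)%N by rewrite /u; case: arg_minnP => // w _; apply.
have ua : (degree H u <= a)%N by apply: leq_trans (umin v0) _; rewrite degree_deg_in.
exists u; split=> [v vu|].
  rewrite leqNgt; apply: contra far => h; apply/existsP; exists (u, v).
  by rewrite /= eq_sym vu -!degree_deg_in ua umin h.
apply: leq_trans (ltnW (_ : (low_count (a + Num.truncn x) (edges H) < K0)%N)); last by rewrite ltnNge.
apply/subset_leq_card/fintype.subsetP => v; rewrite !inE -degree_deg_in => h.
have /andP[_ xt] := truncn_itv x0.
have h2 : (degree H v)%:R < (degree H u + (Num.truncn x).+1)%:R :> R by rewrite natrD; lra.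
rewrite ltr_nat addnS ltnS in h2; apply: leq_trans h2 _.
by rewrite leq_add2r.
Qed.

Lemma random_like_profile (R : realType) (p : R) (N a1 K0 a2 : nat) (s L c zeta kap tau : R)
    (H : sgraph 'I_N.+2) :
  0 < p -> p < 1 -> 1 <= s -> 0 < L -> s ^+ 2 = N.+2%:R * L ->
  (4 + 20 / p) * s <= p / 100 * N.+2%:R -> 4 <= c * s -> 0 < c -> 0 <= zeta -> 0 < kap ->
  48 / p * L <= kap ^+ 2 * s -> 2 * zeta * c + 8 * zeta <= p * c ^+ 2 / 2 ->
  50 * kap <= p * c -> p <= kap * s -> (0 < K0)%N -> a2%:R <= p * N%:R ->
  ~~ [exists v : 'I_N.+2, 4 * s < `|#|edges H :&: star_to v (~: [set v])%SET|%:R - p * N.+2%:R|] ->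
  ~~ [exists Z : {set 'I_N.+2}, 4 * #|Z|%:R * Num.sqrt (#|Z|%:R * L) <
     `|(#|edges H :&: pairs_in Z| * 2)%:R - p * #|Z|%:R * (#|Z|%:R - 1)|] ->
  ~~ small_bad p (Num.truncn (5 * L / p ^+ 2)) tau (edges H) ->
  ~~ [|| (low_count a1 (edges H) == 0)%N,
    (K0 <= low_count (a1 + Num.truncn (2 * c * s)) (edges H))%N | close_pair a1 K0 (edges H)] ->
  ~~ (((low_count a2 (edges H))%:R < 36 / p * s) ||
    (zeta * s < #|[set v | ((deg_in (edges H) v)%:R <= a2%:R - zeta * s)%R]%SET|%:R)) ->
  exists gamma : nat, profile N.+2 gamma (cost H) /\
    c / 2 * s <= gamma%:R /\ gamma%:R <= 18 / p * s.
Proof.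
move=> p0 p1 s1 L0 sL sn cs c0 z0 k0 kL zc kc ps K00 a2N good1 good2 good3 good4 good5.
have [s0 ip] : 0 < s /\ 1 < p^-1 by split; [lra|rewrite invf_gt1].
have sip : s < s / p by rewrite ltr_pMr.
rewrite !negb_or in good4 good5; case/and3P: good4 => g41 g42 g43; case/andP: good5 => g51 g52.
have cs0 : 0 <= 2 * c * s by rewrite !mulr_ge0 // ltW.
have [u [gap near]] := unique_min_degree cs0 g41 g42 g43.
have w0 : 0 <= 12 / p * s by rewrite mulr_ge0 ?divr_ge0 ?ltW.
have r0 : 0 <= 18 / p * s by rewrite mulr_ge0 ?divr_ge0 ?ltW.
have /andP[wl wu] := truncn_itv w0; have /andP[rl ru] := truncn_itv r0.
(* [w] is 12 s / p rounded up, and [r0] is 18 s / p rounded down, which still leaves p (r0 - 1) >=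
   16 s since p < 1 <= s. *)
apply: (@pseudorandom_profile R _ H p s L c a2%:R zeta kap u K0 (Num.truncn (12 / p * s)).+1 (Num.truncn (18 / p * s))) => //.
- move=> v; rewrite degree_star leNgt; apply: contra good1 => h; apply/existsP; by exists v.
- move=> Z; rewrite inner_pairs_in leNgt; apply: contra good2 => h; apply/existsP; by exists Z.
- move=> A b b2 bA Am; apply: (small_ext_of_good p0 good3) => //.
  have p20 : 0 < p ^+ 2 by rewrite exprn_gt0.
  have L5 : 0 <= 5 * L by rewrite mulr_ge0 // ltW.
  by rewrite truncn_ge_nat ?(divr_ge0 L5 (ltW p20)) // ler_pdivlMr // mulrC.
- by apply: le_trans a2N _; rewrite ler_pM2l // ler_nat -[N.+2]addn2 leq_addr.
- rewrite leNgt; apply: contra g51; congr (_ < _); congr _%:R; apply: eq_card => v.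
  by rewrite !inE -degree_deg_in ler_nat.
- rewrite leNgt; apply: contra g52; congr (_ < _); congr _%:R; apply: eq_card => v.
  by rewrite !inE -degree_deg_in.
- exact: ltW.
- by rewrite -natr1; clear -wl sip s1; lra.
- have := ltW ru; rewrite -(ler_pM2l p0) [p * (18 / p * s)](_ : _ = 18 * s); last by field; rewrite gt_eqF.
  rewrite -natr1; clear -p1 s1; lra.
- have := rl; rewrite -(ler_pM2l p0) (_ : p * (18 / p * s) = 18 * s) //.
  by field; rewrite gt_eqF.
Qed.

Lemma linexp_le (R : realType) (a C : R) : 0 < a -> \forall L \near +oo%R, C * L <= expR (a * L).
Proof.
by move=> a0; apply: filterS (polyexp_le 1 C a0) => L; rewrite expr1.
Qed.

Lemma expRN_vanish (R : realType) (a C eps : R) : 0 < a -> 0 < eps ->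
  \forall L \near +oo%R, C * expR (- (a * L)) <= eps.
Proof.
move=> a0 e0; apply: filterS (polyexp_le 0 (C / eps) a0) => L.
by rewrite expr0 mulr1 expRN !ler_pdivrMr ?expR_gt0 // mulrC.
Qed.

(** * Transfer to [Gnp_prob] and choice of constants *)

Section Probability.
Variables (R : realType) (p : R).
Hypotheses (p0 : 0 < p) (p1 : p < 1).
Local Notation q := (1 - p).

Lemma Gnp_prob_gprob (n : nat) (A : set (sgraph 'I_n)) :
  Gnp_prob p A = 1 - \sum_(G : sgraph 'I_n | G \notin A) Gnp_weight p G.
Proof.
have tot : \sum_(G : sgraph 'I_n) Gnp_weight p G = 1.
  rewrite -[RHS](bern_cst p (all_pairs n)) /bern.
  rewrite -(sum_sgraph (fun S => p ^+ #|S| * q ^+ #|(all_pairs n :\: S)%SET| * 1)).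
  by apply: eq_bigr => G _; rewrite /Gnp_weight Gnp_weightE mulr1.
by rewrite -tot (bigID (fun G => G \in A)) /= addrK.
Qed.

Lemma Gnp_weight_ge0 (n : nat) (G : sgraph 'I_n) : 0 <= Gnp_weight p G.
Proof. by apply: prodr_ge0 => e _; case: ifP => _; rewrite ?subr_ge0 ltW. Qed.

Lemma Gnp_prob_le1 (n : nat) (A : set (sgraph 'I_n)) : Gnp_prob p A <= 1.
Proof. by rewrite Gnp_prob_gprob gerBl sumr_ge0 // => G _; apply: Gnp_weight_ge0. Qed.

Lemma Gnp_prob_ge (n : nat) (A : set (sgraph 'I_n)) (B : pred {set {set 'I_n}}) :
  (forall G, ~~ B (edges G) -> A G) -> 1 - gprob p B <= Gnp_prob p A.
Proof.
move=> BA; rewrite Gnp_prob_gprob lerD2l lerN2 /gprob /bern.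
rewrite -(sum_sgraph (fun S => p ^+ #|S| * q ^+ #|(all_pairs n :\: S)%SET| * (B S)%:R)).
rewrite big_mkcond; apply: ler_sum => G _; rewrite -Gnp_weightE -/(Gnp_weight p G).
case: ifP => GA; last by rewrite mulr_ge0 ?Gnp_weight_ge0.
case: (boolP (B (edges G))) => [_|/BA h]; first by rewrite mulr1.
by move/negP: GA; rewrite inE.
Qed.

Lemma Gnp_prob_sub (n : nat) (A B : set (sgraph 'I_n)) :
  (forall G, A G -> B G) -> Gnp_prob p A <= Gnp_prob p B.
Proof.
move=> AB; rewrite /Gnp_prob [leLHS]big_mkcond [leRHS]big_mkcond; apply: ler_sum => G _.
case: ifP => [|_]; last by case: ifP => // _; apply: Gnp_weight_ge0.
by rewrite inE => /AB h; rewrite mem_set.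
Qed.

(** Five bad events are excluded, each of probability at most eps / 5: for the degrees, the edge
    counts, the small dense sets, the gap at the minimum degree, and the number of low degrees. *)
Lemma Gnp_profile_ge (N : nat) (s L c zeta kap tau eps : R) :
  N.+2%:R = expR L -> 0 < s -> s ^+ 2 = N.+2%:R * L -> 200 <= L ->
  16 * L / (p * q) <= expR (L / 10) ->
  2 * expR (- (2 / 9 * (p * q / 100) ^+ 2 * L)) <= 1 / 4 ->
  0 < c -> 640 * c <= p * q -> 0 < zeta -> zeta <= 1 -> 0 < kap ->
  2 * zeta * c + 8 * zeta <= p * c ^+ 2 / 2 -> 50 * kap <= p * c ->
  36 / p * L <= q / 2 * expR (p * q * zeta / 200 * L) ->
  (4 + 20 / p) * s <= p / 100 * N.+2%:R -> 4 <= c * s -> 48 / p * L <= kap ^+ 2 * s ->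
  p <= kap * s ->
  2 * expR (- L) <= eps / 5 -> 4 * expR (- (7 / 9 * L)) <= eps / 5 ->
  gprob p (small_bad p (n := N.+2) (Num.truncn (5 * L / p ^+ 2)) tau) <= eps / 5 ->
  (40 / q + 47) * expR (- (L / 20)) <= eps / 5 ->
  (40 / q + 3 * expR 1 / zeta) * expR (- (p * q * zeta / 200 * L)) <= eps / 5 ->
  1 - eps <= Gnp_prob p (fun H : sgraph 'I_N.+2 =>
    exists gamma : nat, profile N.+2 gamma (cost H) /\
      c / 2 * s <= gamma%:R /\ gamma%:R <= 18 / p * s).
Proof.
have split5 (x : R) : x = x / 5 + (x / 5 + (x / 5 + (x / 5 + x / 5))) by field.
move=> nL s0 sL L200 L_big hoef c0 cpq z0 z1 k0 zc kc eL sn cs kL ps v1 v2 v3 v4 v5.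
have L3 : 3 <= L by apply: le_trans L200; rewrite ler_nat.
have L0 : 0 < L by apply: lt_le_trans L3; rewrite ltr0n.
have s1 : 1 <= s by apply: le_trans (scale_s1 nL s0 sL L3); rewrite ler_pdivlMr // mul1r ler_nat.
have [a1 [K0 [K00 b4]]] := prob_no_gap p0 p1 nL s0 sL L200 L_big c0 cpq.
have [a2 [a2N b5]] := prob_low_degrees p0 p1 nL s0 sL L200 L_big z0 z1 hoef eL.
have b1 := le_trans (prob_degrees_bad p0 p1 (isT : (2 <= N.+2)%N) s1 L0 sL nL) v1.
have b2 := le_trans (@prob_inner_bad R p N.+2 L p0 p1 L3 nL) v2.
have {v4}b4 := le_trans b4 v4; have {v5}b5 := le_trans b5 v5.
pose E1 (S : {set {set 'I_N.+2}}) := [exists v : 'I_N.+2,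
  4 * s < `|#|S :&: star_to v (~: [set v])%SET|%:R - p * N.+2%:R|].
pose E2 (S : {set {set 'I_N.+2}}) := [exists Z : {set 'I_N.+2}, 4 * #|Z|%:R * Num.sqrt (#|Z|%:R * L) <
     `|(#|S :&: pairs_in Z| * 2)%:R - p * #|Z|%:R * (#|Z|%:R - 1)|].
pose E3 := small_bad p (n := N.+2) (Num.truncn (5 * L / p ^+ 2)) tau.
pose E4 (S : {set {set 'I_N.+2}}) := [|| (low_count a1 S == 0)%N,
    (K0 <= low_count (a1 + Num.truncn (2 * c * s)) S)%N | close_pair a1 K0 S].
pose E5 (S : {set {set 'I_N.+2}}) := ((low_count a2 S)%:R < 36 / p * s) ||
    (zeta * s < #|[set v | ((deg_in S v)%:R <= a2%:R - zeta * s)%R]%SET|%:R).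
have bad : gprob p (fun S => E1 S || (E2 S || (E3 S || (E4 S || E5 S)))) <= eps.
  have -> : eps = eps / 5 + (eps / 5 + (eps / 5 + (eps / 5 + eps / 5))).
    exact: split5.
  apply: le_trans (gprobU p0 p1 E1 _) (lerD b1 _).
  apply: le_trans (gprobU p0 p1 E2 _) (lerD b2 _).
  apply: le_trans (gprobU p0 p1 E3 _) (lerD v3 _).
  exact: le_trans (gprobU p0 p1 E4 E5) (lerD b4 b5).
apply: le_trans (Gnp_prob_ge (B := fun S => E1 S || (E2 S || (E3 S || (E4 S || E5 S)))) _).
  by rewrite lerD2l lerN2.
move=> G /norP[g1 /norP[g2 /norP[g3 /norP[g4 g5]]]].
exact: (random_like_profile p0 p1 s1 L0 sL sn cs c0 (ltW z0) k0 kL zc kc ps K00 a2N g1 g2 g3 g4 g5).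
Qed.

Lemma le_of_scaled (x y L s e : R) : 0 <= x -> 0 < y -> 1 <= L -> e <= s -> x / y * L <= e -> x <= y * s.
Proof.
move=> x0 y0 L1 es h; rewrite mulrC -ler_pdivrMr //; apply: le_trans es; apply: le_trans h.
by rewrite ler_peMr // divr_ge0 // ltW.
Qed.

Lemma le_of_scaled_half (x y L s : R) : 0 < x -> 0 < y -> s <= L * expR (L / 2) ->
  x / y * L <= expR (L / 2) -> x * s <= y * expR L.
Proof.
move=> x0 y0 sle h; apply: (@le_trans _ _ (x * (L * expR (L / 2)))); first by rewrite ler_pM2l.
by rewrite [expR L]expR_half mulrA [leRHS]mulrA ler_pM2r ?expR_gt0 // [leRHS]mulrC -ler_pdivrMr // mulrAC.
Qed.

Lemma profile_whp : exists c C : R, [/\ 0 < c, c < C & forall eps : R, 0 < eps ->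
  \forall L \near +oo%R, forall (N : nat) (s : R),
    N.+2%:R = expR L -> 0 < s -> s ^+ 2 = N.+2%:R * L ->
    1 - eps <= Gnp_prob p (fun H : sgraph 'I_N.+2 =>
      exists gamma : nat, profile N.+2 gamma (cost H) /\ c * s <= gamma%:R /\ gamma%:R <= C * s)].
Proof.
have q0 : 0 < q by rewrite subr_gt0.
have pq0 : 0 < p * q by rewrite mulr_gt0.
have pq1 : p * q <= 1 by apply: mulr_ile1; rewrite ?ltW // gtrBl.
have pp0 := p0; have pp1 := p1.
(* [c] is dictated by the gap event; [kap] and [zeta] are then so small that all errors per vertex,
   in units of [s], stay below the gain p c. *)
pose c : R := p * q / 640; pose kap : R := p * c / 50; pose zeta : R := p * c ^+ 2 / 20.
have c0 : 0 < c by rewrite /c; lra.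
have c1 : c <= 1 by rewrite /c; lra.
have pc0 : 0 < p * c by rewrite mulr_gt0.
have kap0 : 0 < kap by rewrite /kap; lra.
have pcc0 : 0 < p * c ^+ 2 by rewrite mulr_gt0 ?exprn_gt0.
have z0 : 0 < zeta by rewrite /zeta; lra.
have z1 : zeta <= 1.
  have : p * c ^+ 2 <= 1 by apply: mulr_ile1; rewrite ?sqr_ge0 ?exprn_ile1 // ltW.
  rewrite /zeta; lra.
have zc : 2 * zeta * c + 8 * zeta <= p * c ^+ 2 / 2.
  have -> : p * c ^+ 2 / 2 = 10 * zeta by rewrite /zeta; field.
  have : zeta * c <= zeta * 1 by rewrite ler_pM2l.
  lra.
have kc : 50 * kap <= p * c by rewrite /kap; lra.
have c640 : 640 * c <= p * q by rewrite /c; lra.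
have e20 : 0 < p * q * zeta / 200 by have : 0 < p * q * zeta by [rewrite mulr_gt0|]; lra.
have c02 : 0 < 2 / 9 * (p * q / 100) ^+ 2.
  have h : 0 < p * q / 100 by lra.
  by have : 0 < (p * q / 100) ^+ 2 by [rewrite exprn_gt0|]; lra.
have [eta eta0 small] := small_bad_vanish p0 p1.
exists (c / 2), (18 / p); split.
- by rewrite divr_gt0.
- have : 1 < p^-1 by rewrite invf_gt1.
  by rewrite /c; lra.
move=> eps eps0; have eps5 : 0 < eps / 5 by rewrite divr_gt0.
have x0 : 0 < 4 + 20 / p by have : 0 < p^-1 by [rewrite invr_gt0|]; lra.
have y0 : 0 < p / 100 by lra.
have k20 : 0 < kap ^+ 2 by rewrite exprn_gt0.
have half0 : 0 < 2^-1 :> R by rewrite invr_gt0.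
clearbody c kap zeta.
near=> L.
have small_L : forall n m : nat, n%:R = expR L -> m%:R <= 5 * L / p ^+ 2 ->
    gprob p (small_bad p (n := n) m (expR (- ((1 - eta) * L)))) <= eps / 5.
  by near: L; exact: small.
move=> N s nL s0 sL.
have L200 : 200 <= L by near: L; apply: nbhs_pinfty_ge; rewrite num_real.
have L3 : 3 <= L by apply: le_trans L200; rewrite ler_nat.
have L1 : 1 <= L by apply: le_trans L3; rewrite ler1n.
have sge := scale_s_ge nL s0 sL L3; have sle := scale_s_le nL s0 sL L3.
apply: (Gnp_profile_ge (zeta := zeta) (kap := kap) (tau := expR (- ((1 - eta) * L))) nL s0 sL L200) => //.
- rewrite mulrAC [L / 10]mulrC; near: L; apply: linexp_le; by rewrite invr_gt0.
- by near: L; apply: expRN_vanish => //; rewrite divr_gt0.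
- rewrite -ler_pdivrMl ?divr_gt0 // mulrA; near: L; exact: linexp_le.
- rewrite nL; apply: (le_of_scaled_half x0 y0 sle); rewrite [L / 2]mulrC; near: L; exact: linexp_le.
- apply: (le_of_scaled _ c0 L1 sge) => //; rewrite [L / 2]mulrC; near: L; exact: linexp_le.
- rewrite [leRHS]mulrC -ler_pdivrMr // mulrAC; apply: le_trans sge.
  rewrite [L / 2]mulrC; near: L; exact: linexp_le.
- apply: (le_of_scaled (ltW p0) kap0 L1 sge); rewrite [L / 2]mulrC; near: L; exact: linexp_le.
- rewrite -[L]mul1r; near: L; exact: expRN_vanish.
- near: L; apply: expRN_vanish => //; by rewrite divr_gt0.
- have m5 : (Num.truncn (5 * L / p ^+ 2))%:R <= 5 * L / p ^+ 2.
    have h : 0 <= 5 * L / p ^+ 2 by rewrite divr_ge0 ?exprn_ge0 ?mulr_ge0 ?(ltW p0) ?(le_trans _ L1).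
    by have /andP[] := truncn_itv h.
  exact: small_L.
- rewrite [L / 20]mulrC; near: L; apply: expRN_vanish => //; by rewrite invr_gt0.
- near: L; exact: expRN_vanish.
Unshelve. all: by end_near. Qed.
End Probability.

(** The residue [gamma + 1] is decided by whether the two ways of covering it tie; if they do, it is
    left out and [beta] is [gamma + 2]. *)
Lemma profile_elementary_ideal (n gamma : nat) (H : sgraph 'I_n) : profile n gamma (cost H) ->
  exists beta : nat, (beta = (gamma + 1)%N \/ beta = (gamma + 2)%N) /\
    elementary_in H [set r : 'I_n | (r <= gamma)%N] /\ ideal_in H [set r : 'I_n | (beta <= r)%N].
Proof.
move=> P; have el : elementary_in H [set r : 'I_n | (r <= gamma)%N].
  by move=> r; rewrite inE => rg; apply: profile_elementary P rg.
case: (boolP (cost H gamma.+1 < gamma.+1 * cost H 1)%N) => hs.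
  exists (gamma + 1)%N; split; [by left|split=> // r]; rewrite inE addn1 => gr.
  by apply: (profile_ideal P) => //; rewrite /good_residue hs orbT.
exists (gamma + 2)%N; split; [by right|split=> // r]; rewrite inE addn2 => gr.
by apply: (profile_ideal P); rewrite ?(ltnW gr) // /good_residue gr.
Qed.

(** The estimates are stated for a real L tending to infinity; here L becomes [ln n%:R]. *)
Lemma near_ln (R : realType) (P : R -> Prop) :
  (\forall L \near +oo%R, P L) -> (\forall n \near \oo, P (ln n%:R))%classic.
Proof.
case=> M [_ hM]; near=> n; apply: hM.
have n1 : 0 < n%:R :> R by rewrite ltr0n; near: n; exists 1%N.
rewrite -ltr_expR lnK ?posrE //; near: n.
exists (Num.truncn (expR M)).+1 => // n /= Mn.
have /andP[_ h] := truncn_itv (expR_ge0 M).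
by apply: lt_le_trans h _; rewrite ler_nat.
Unshelve. all: by end_near. Qed.

Theorem theorem1p3 (R : realType) (p : R) (hp0 : 0 < p) (hp1 : p < 1) :
  exists c C : R, 0 < c /\ c < C /\
    whp p (fun n (H : sgraph 'I_n) =>
      exists gamma beta : nat,
        (gamma < n)%N /\
        c * Num.sqrt (n%:R * ln n%:R) <= gamma%:R /\
        gamma%:R <= C * Num.sqrt (n%:R * ln n%:R) /\
        (beta = (gamma + 1)%N \/ beta = (gamma + 2)%N) /\
        elementary_in H [set r : 'I_n | (r <= gamma)%N] /\
        ideal_in H [set r : 'I_n | (beta <= r)%N]).
Proof.
have [c [C [c0 cC main]]] := profile_whp hp0 hp1.
exists c, C; split=> //; split=> //; apply/cvgrPdist_le => eps eps0.
near=> n.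
have n2 : (2 <= n)%N by near: n; exists 2%N.
have far : forall (N : nat) (s : R), N.+2%:R = expR (ln n%:R) :> R -> 0 < s ->
    s ^+ 2 = N.+2%:R * ln n%:R -> 1 - eps <= Gnp_prob p (fun H : sgraph 'I_N.+2 =>
      exists gamma : nat, profile N.+2 gamma (cost H) /\ c * s <= gamma%:R /\ gamma%:R <= C * s).
  by near: n; apply: (near_ln (main eps eps0)).
rewrite ger0_norm ?subr_ge0 ?Gnp_prob_le1 // lerBlDr addrC -lerBlDr.
(* The degree estimates are stated for [N.+2] vertices. *)
move: n2 far; move: (n) => [|[|N]] // _ far.
have n0 : 0 < N.+2%:R :> R by rewrite ltr0n.
have l0 : 0 < ln N.+2%:R :> R by rewrite ln_gt0 // ltr1n.
have nl0 : 0 < N.+2%:R * ln N.+2%:R :> R by rewrite mulr_gt0.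
apply: (le_trans (far N (Num.sqrt (N.+2%:R * ln N.+2%:R)) _ _ _)).
- by rewrite lnK.
- by rewrite sqrtr_gt0.
- by rewrite sqr_sqrtr // ltW.
apply: (Gnp_prob_sub hp0 hp1) => H [gamma [P [lo hi]]].
have [beta [bE [el id]]] := profile_elementary_ideal P.
exists gamma, beta; split => //.
apply: leq_trans (profile_half P); rewrite mul2n -addnn addn2 ltnS.
exact: leqW (leq_addr _ _).
Unshelve. all: by end_near. Qed.
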